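(* Let $G$ be an infinite, connected, locally finite, unimodular quasitransitive graph. Suppose that $\mathcal{F}$ is an ergodic random spanning forest of $G$ that satisfies weak insertion tolerance, and that (almost surely) one of its components has infinitely many ends. Then, almost surely, $\mathcal{F}$ either has exactly one component or has infinitely many components.
   Context: A graph $G$ is quasitransitive if $\mathrm{Aut}(G)$ has finitely many orbits on $V(G)$; it is unimodular if $\mathrm{Aut}(G)$ is a unimodular locally compact group. A random spanning forest of $G$ is a random subgraph $\omega\in 2^{E(G)}$ (with vertex set $V(G)$) containing no cycles, with law $\mathbf{P}$. It is ergodic if $\mathbf{P}$ is $\mathrm{Aut}(G)$-invariant and every $\mathrm{Aut}(G)$-invariant event has probability 0 or 1. $C_x$ denotes the component of the vertex $x$ in $\omega$, and $B(x,r)$ the ball of radius $r$ around $x$ in $G$. For $e\in E(G)$, $f\in E(G)\cup\{\emptyset\}$ and $\omega\in 2^{E(G)}$ let $\pi_e^f\omega:=(\omega\cup\{e\})\setminus\{f\}$ (nothing is removed if $f=\emptyset$). For an event $A$ (and $f$ possibly depending on $\omega$) let $\pi_e^fA:=\{\pi_e^f\omega:\omega\in A\}$. Weak insertion tolerance (WIT). A random forest of $G$ with law $\mathbf{P}$ is weakly insertion tolerant if for any edge $e=\{x,y\}\in E(G)$ (with a choice of endpoint $x$), any nonnegative integer $r$, and any configuration $\omega$ such that $x$ and $y$ are in different components, there exists $f=f(\omega,e,x,r)\in E(G)\cup\{\emptyset\}$ such that: for fixed $e,x,r$, $f$ is a measurable function of $\omega$; if $A$ is an event with $\mathbf{P}(A)>0$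 and $C_x\neq C_y$ for almost every configuration in $A$, then $\mathbf{P}(\pi_e^fA)>0$; and, almost surely, if $f\neq\emptyset$ then $f$ is an edge in $C_x\cap B(x,r)^c$ (an edge of $C_x$ outside the ball $B(x,r)$). *)

(* Defs.v *)
From HB Require Import structures.
From mathcomp Require Import all_boot all_order all_algebra.
From mathcomp Require Import all_classical all_reals all_analysis.

Set Implicit Arguments.
Unset Strict Implicit.
Unset Printing Implicit Defensive.

Import Order.TTheory GRing.Theory Num.Theory.
Local Open Scope classical_set_scope.
Local Open Scope ring_scope.

(** * Graphs *)

Record graph := Graph {
  vertex :> choiceType;
  adj : rel vertex;
  adj_sym : symmetric adj;
  adj_irr : irreflexive adj }.

Definition joined (V : eqType) (r : rel V) (x y : V) : Prop :=
  exists2 p, path r x p & last x p = y.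

Section Graph.
Variable G : graph.

Definition graph_connected := forall x y : G, joined (@adj G) x y.

Definition locally_finite := forall x : G, finite_set [set y | adj x y].

Definition graph_ball (x : G) (r : nat) : set G :=
  [set y | exists2 p, path (@adj G) x p & last x p = y /\ (size p <= r)%N].

Definition is_edge (e : set G) := exists x y : G, adj x y /\ e = [set x; y].

Definition edge := {e : set G | is_edge e}.

End Graph.

(** * The automorphism group *)

Record aut (G : graph) := Aut {
  aut_fun :> G -> G;
  aut_bij : bijective aut_fun;
  aut_adj : forall x y, adj (aut_fun x) (aut_fun y) = adj x y }.

Lemma aut_id_subproof (G : graph) : bijective (@id G).
Proof. by exists id. Qed.

Definition aut_id (G : graph) : aut G :=
  Aut (@aut_id_subproof G) (fun _ _ => erefl).

Lemma aut_comp_adj (G : graph) (g h : aut G) (x y : G) :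
  adj ((g \o h) x) ((g \o h) y) = adj x y.
Proof. by rewrite /= !aut_adj. Qed.

Definition aut_comp (G : graph) (g h : aut G) : aut G :=
  Aut (bij_comp (aut_bij g) (aut_bij h)) (aut_comp_adj g h).

HB.instance Definition _ (G : graph) := gen_eqMixin (aut G).
HB.instance Definition _ (G : graph) := gen_choiceMixin (aut G).
HB.instance Definition _ (G : graph) := isPointed.Build (aut G) (aut_id G).

(* Topology of pointwise convergence, the vertex set being discrete. *)
Definition aut_ptws (G : graph) (g : aut G) :
  {ptws G -> discrete_topology (vertex G)} := g.

HB.instance Definition _ (G : graph) :=
  Topological.copy (aut G) (initial_topology (@aut_ptws G)).

Definition orbit_of (G : graph) (x : G) : set G :=
  [set g x | g in [set: aut G]].

Definition quasitransitive (G : graph) := finite_set (range (@orbit_of G)).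

Definition borel (T : ptopologicalType) := g_sigma_algebraType (@open T).

Section Haar.
Local Open Scope ereal_scope.
Variables (R : realType) (G : graph).
Implicit Type mu : {measure set (borel (aut G)) -> \bar R}.

Definition radon mu :=
  [/\ forall K : set (aut G), compact K -> mu K < +oo,
      forall A : set (borel (aut G)), measurable A ->
        mu A = ereal_inf [set mu U | U in
                 [set U : set (aut G) | open U /\ A `<=` U]]
    & forall U : set (aut G), open U ->
        mu U = ereal_sup [set mu K | K in
                 [set K : set (aut G) | compact K /\ K `<=` U]]].

Definition left_invariant mu :=
  forall (g : aut G) (A : set (borel (aut G))), measurable A ->
    mu [set aut_comp g h | h in A] = mu A.

Definition right_invariant mu :=
  forall (g : aut G) (A : set (borel (aut G))), measurable A ->
    mu [set aut_comp h g | h in A] = mu A.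

Definition left_haar mu := [/\ radon mu, mu setT != 0 & left_invariant mu].

(* A left Haar measure exists and is unique up to scaling, so that asking this
   of one left Haar measure is the same as asking it of all of them. *)
Definition unimodular := exists2 mu, left_haar mu & right_invariant mu.

End Haar.

(** * Configurations: elements of 2^E, with the product sigma-algebra *)

Definition edge_cylinders (G : graph) : set (set (set (edge G))) :=
  range (fun (e : edge G) => [set w : set (edge G) | w e]).

Definition config (G : graph) := g_sigma_algebraType (@edge_cylinders G).

Section Configuration.
Variable G : graph.
Implicit Types (w : config G) (x y : G) (C : set G) (r s : nat -> G).

Definition wadj w : rel G :=
  [rel x y | `[< exists2 e : edge G, w e & sval e = [set x; y] >]].

Definition acyclic w :=
  ~ exists c : seq G, (2 < size c)%N /\ ucycle (wadj w) c.

Definition comp_of w x : set G := [set y | joined (wadj w) x y].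

Definition components w : set (set G) := range (comp_of w).

(* Ends of a component: rays up to the relation of having, for every finite
   set S of vertices, tails in the same component of w minus S. *)
Definition ray w r := injective r /\ forall n, wadj w (r n) (r n.+1).

Definition ray_in w C : set (nat -> G) :=
  [set r | ray w r /\ forall n, C (r n)].

Definition wadj_minus w (S : seq G) : rel G :=
  [rel x y | [&& wadj w x y, x \notin S & y \notin S]].

Definition same_end w r s := forall S : seq G, exists N : nat,
  forall m n, (N <= m)%N -> (N <= n)%N ->
    [/\ r m \notin S, s n \notin S & joined (wadj_minus w S) (r m) (s n)].

Definition ends w C : set (set (nat -> G)) :=
  [set [set s | ray_in w C s /\ same_end w r s] | r in ray_in w C].

Definition act (g : aut G) w : config G :=
  [set e' : edge G | exists2 e : edge G, w e & sval e' = g @` sval e].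

Definition switch (e : edge G) (f : option (edge G)) w : config G :=
  if f is Some c then (w `|` [set e]) `\` [set c] else w `|` [set e].

End Configuration.

(** * Random spanning forests *)

Section RandomForest.
Local Open Scope ereal_scope.
Variables (R : realType) (G : graph) (P : probability (config G) R).

Definition random_forest := {ae P, forall w, acyclic w}.

Definition ergodic :=
  (forall (g : aut G) (A : set (config G)), measurable A ->
     P (act g @^-1` A) = P A) /\
  (forall A : set (config G), measurable A ->
     (forall g : aut G, act g @^-1` A = A) -> P A = 0 \/ P A = 1).

(* [f] is total, but its values where x and y are connected play no role. *)
Definition weakly_insertion_tolerant :=
  forall (e : edge G) (x y : G), sval e = [set x; y] ->
  forall r : nat, exists f : config G -> option (edge G),
    [/\ forall S : set (option (edge G)), measurable (f @^-1` S),
        forall A : set (config G), measurable A -> 0 < P A ->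
          {ae P, forall w, A w -> comp_of w x <> comp_of w y} ->
          0 < P [set switch e (f w) w | w in A]
      & {ae P, forall w, comp_of w x <> comp_of w y ->
          forall c, f w = Some c ->
            [/\ w c, sval c `<=` comp_of w x
              & sval c `<=` ~` graph_ball x r]}].

End RandomForest.

(* Main.v *)
(* Run a lazy random walk on [G].  By mass transport (from the bi-invariant Haar
   measure) the probability that walks of lengths m and n from the same root end
   in the same component depends, averaged over roots, on m + n only and
   decreases along the diagonal.  Hence along suitable deterministic times the
   frequency with which the walk visits each component C of the forest converges
   almost surely to a density alpha(C) which does not depend on the root, and
   which is positive if there are finitely many components.  By ergodicity the
   energy, the sum of alpha(C)^2, is then deterministic.

   Mass transport also excludes, in a component with a furcation (a vertex with
   three infinite branches), every invariant orientation of edges under which at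
   most one edge leaves each vertex.  Orienting edges towards the heavier side,
   resp. out of a side without furcations, shows that an edge both of whose
   sides are infinite splits such a component into two sides of equal density,
   each of which contains a furcation.

   Suppose now that there are finitely many, but at least two components.  The
   one with infinitely many ends, C, contains a furcation m.  Take adjacent x in
   C and y in another component D.  By weak insertion tolerance the configuration
   in which xy is inserted and an edge f of C far from x is removed is typical
   again, so it has the same energy.  Without removal the energy would increase
   by 2 alpha(C) alpha(D) > 0.  If f cuts C into A (containing x) and B, then the
   energy changes by 2 alpha(A) (alpha(D) - alpha(B)), which forces
   alpha(A) = alpha(B) = alpha(C) / 2.  A second cut, far beyond m and a furcation
   of B, leaves in A or in B a part of density 0 around a furcation m', hence an
   infinite branch at m' of density 0: an edge with sides of unequal densities. *)
Require Import Defs.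
From mathcomp Require Import all_boot all_order all_algebra.
From mathcomp Require Import all_classical all_reals all_analysis.
From mathcomp Require Import measurable_realfun ring lra.
Local Open Scope classical_set_scope.
Local Open Scope ring_scope.
Set Implicit Arguments.
Unset Strict Implicit.
Unset Printing Implicit Defensive.
Import Order.TTheory GRing.Theory Num.Theory.
Import numFieldNormedType.Exports.

(** * Trees *)

(** Typicality supplies densities of whole components only, whereas the final argument compares the
    two sides of a removed edge. A side gets a density because the switched configuration is typical
    as well and has that side as a component, up to the component of [y]; where no density is
    available, sides are compared by eventual inequalities between walk masses. Convergence of
    frequencies is a Hilbert space argument. Being joined is a positive semidefinite kernel, whose
    expectation turns walk laws into points of a seminormed space; dependence on m + n alone makes
    them Cauchy along even times. The square of a signed combination of values for one component is
    bounded by the quadratic form, so that a single estimate serves all components at once. Energies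
    of a configuration and of its switch are never compared in law: one fixed set of rational bounds
    belongs to almost every configuration, and insertion tolerance is used only to see that switches
    almost surely avoid a given null set. The zero-one law enters only through the energy. *)

Section Joined.
Variable V : eqType.
Implicit Types (r : rel V) (x y z : V).

Definition minus r (S : seq V) : rel V :=
  [rel x y | [&& r x y, x \notin S & y \notin S]].

Lemma joined_refl r x : joined r x x.
Proof. by exists [::]. Qed.

Lemma joined1 r x y : r x y -> joined r x y.
Proof. by move=> rxy; exists [:: y] => //=; rewrite rxy. Qed.

Lemma joined_trans r x y z : joined r x y -> joined r y z -> joined r x z.
Proof.
move=> [p pp <-] [q pq <-]; exists (p ++ q); last by rewrite last_cat.
by rewrite cat_path pp.
Qed.

Lemma joined_closed r (Z : V -> Prop) x y :
  (forall a b, Z a -> r a b -> Z b) -> Z x -> joined r x y -> Z y.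
Proof.
move=> cl + [p + <-]; elim: p x => //= a p IH x Zx /andP[rxa pp].
exact: IH (cl _ _ Zx rxa) pp.
Qed.

Lemma joined_mono r r' x y :
  (forall a b, joined r x a -> r a b -> r' a b) -> joined r x y -> joined r' x y.
Proof.
move=> h jxy; suff: joined r x y /\ joined r' x y by case.
apply: (joined_closed (Z := fun z => joined r x z /\ joined r' x z) _ _ jxy).
  move=> a b [ja ja'] rab; split; first exact: joined_trans ja (joined1 rab).
  exact: joined_trans ja' (joined1 (h _ _ ja rab)).
by split; exact: joined_refl.
Qed.

Lemma joined_sub r r' x y : subrel r r' -> joined r x y -> joined r' x y.
Proof. by move=> s; apply: joined_mono => a b _; exact: s. Qed.

Lemma joined_sym r x y : symmetric r -> joined r x y -> joined r y x.
Proof.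
move=> rs [p pp <-]; exists (rev (belast x p)).
  by rewrite rev_path (eq_path (e' := r)) // => a b; exact: rs.
by case: p pp => //= a p _; rewrite rev_cons last_rcons.
Qed.

Lemma joined_simple r x y : joined r x y ->
  exists p, [/\ path r x p, last x p = y & uniq (x :: p)].
Proof. by move=> [p pp <-]; case/shortenP: pp => q pq uq _; exists q. Qed.

Lemma minus_sub r S : subrel (minus r S) r.
Proof. by move=> x y /and3P[]. Qed.

Lemma minus_sym r S : symmetric r -> symmetric (minus r S).
Proof. by move=> rs x y; rewrite /minus /= rs; congr andb; rewrite andbC. Qed.

Lemma path_minus r S x p : x \notin S ->
  path (minus r S) x p = path r x p && all (fun z => z \notin S) p.
Proof.
elim: p x => //= a p IH x xS; rewrite {1}/minus /= xS /=.
case: (boolP (a \in S)) => aS /=; first by rewrite !andbF.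
by rewrite andbT IH // andbA.
Qed.

Lemma joined_minus_notin r S x y : joined (minus r S) x y -> x \notin S -> y \notin S.
Proof.
move=> jxy xS; apply: (joined_closed (Z := fun z => is_true (z \notin S)) _ xS jxy).
by move=> a b aS /and3P[].
Qed.

End Joined.

Section Tree.
Variables (V : eqType) (e : rel V).

(** For an edge of a forest, deleting the vertex [w] leaves around [v] the same set as deleting the
    edge; vertex deletion has the advantage of making sense for arbitrary pairs. *)
Definition side (v w : V) : set V := [set z | joined (minus e [:: w]) v z].

Definition stem (v u : V) (n : nat) : Prop :=
  exists p, [/\ size p = n, path e v (u :: p) & uniq (v :: u :: p)].

(** Finite simple paths of every length replace an infinite ray, so that only countable quantifiers
    occur and the event is measurable. With finite degrees the two notions agree by König's
    lemma. *)
Definition branch (v u : V) : Prop := forall n, stem v u n.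

Definition furcation (m : V) : Prop := exists u1 u2 u3,
  [/\ uniq [:: u1; u2; u3], branch m u1, branch m u2 & branch m u3].

Hypotheses (esym : symmetric e) (eirr : irreflexive e).

Lemma side_joined v w z : side v w z -> joined e v z.
Proof. exact: joined_sub (@minus_sub _ _ _). Qed.

Lemma side_notin v w z : v != w -> side v w z -> z != w.
Proof.
by move=> vw /joined_minus_notin; rewrite !inE => /(_ vw).
Qed.

Lemma path_side v w p : v != w -> path e v p -> w \notin p -> side v w (last v p).
Proof.
move=> vw pp wp; exists p => //; rewrite path_minus ?inE // pp /=.
by apply/allP => z zp; rewrite inE; apply: contraNneq wp => <-.
Qed.

Lemma path_side_mem v w p z :
  path e v p -> w \notin v :: p -> z \in v :: p -> side v w z.
Proof.
move=> pp wp /splitPl zp; case: zp pp wp => p1 p2 <-.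
rewrite cat_path -cat_cons mem_cat inE !negb_or => /andP[pp _] /andP[/andP[wv wp] _].
by apply: path_side => //; rewrite eq_sym.
Qed.

Lemma side_simple v w z : v != w -> side v w z ->
  exists p, [/\ path e v p, last v p = z, uniq (v :: p) & w \notin v :: p].
Proof.
move=> vw /joined_simple[p [pp lp up]]; exists p; split=> //.
  by apply: sub_path pp; exact: minus_sub.
rewrite in_cons negb_or eq_sym vw /=.
move: pp; rewrite path_minus ?inE // => /andP[_ /allP h].
by apply/negP => /h; rewrite inE eqxx.
Qed.

Lemma adj_neq v w : e v w -> v != w.
Proof. by move=> evw; apply: contraTneq evw => ->; rewrite eirr. Qed.

Lemma stemS v u n : stem v u n.+1 -> stem v u n.
Proof.
move=> [p [sp pp up]]; exists (take n p); split.
- by rewrite size_takel // sp.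
- move: pp; rewrite /= => /andP[-> pp] /=.
  by rewrite -(cat_take_drop n p) cat_path in pp; case/andP: pp.
- move: up; rewrite -{1}(cat_take_drop n p) -!cat_cons cat_uniq.
  by case/andP.
Qed.

Lemma stem_le v u m n : (m <= n)%N -> stem v u n -> stem v u m.
Proof.
elim: n => [|n IH]; first by rewrite leqn0 => /eqP ->.
by rewrite leq_eqVlt => /predU1P[->//|]; rewrite ltnS => /IH h /stemS.
Qed.

Lemma branch_adj v u : branch v u -> e v u.
Proof. by move=> /(_ 0)[p [_ /= /andP[]]]. Qed.

(* Pigeonhole over the finite list [s], since [stem] is antitone in [n]. *)
Lemma branch_finite v (s : seq V) (Q : pred V) :
  (forall n, exists u, [/\ u \in s, Q u & stem v u n]) ->
  exists u, [/\ u \in s, Q u & branch v u].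
Proof.
elim: s => [|a s IH] h; first by case: (h 0) => u [].
case: (pselect (branch v a /\ Q a)) => [[ba Qa]|nba].
  by exists a; rewrite inE eqxx.
have [//|u [us Qu bu]] := IH _; last by exists u; rewrite inE us orbT.
move=> n; have [N hN] : exists N, ~ (stem v a N /\ Q a).
  apply: contrapT => hN; apply: nba; split.
    by move=> k; apply: contrapT => hk; apply: hN; exists k => -[].
  by apply: contrapT => hk; apply: hN; exists 0%N => -[].
have [u [us Qu st]] := h (maxn n N); exists u; split=> //; last first.
  by apply: stem_le st; rewrite leq_max leqnn.
move: us; rewrite inE => /predU1P[ua|//]; case: hN; subst u; split=> //.
by apply: stem_le st; rewrite leq_max leqnn orbT.
Qed.

Hypothesis eacyc : ~ exists c : seq V, (2 < size c)%N /\ ucycle e c.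

(* A simple path from [u] to [v] avoiding their common neighbour [w] closes up
   into a cycle. *)
Lemma side_disjoint u v w : e w u -> e w v -> u != v -> ~ side u w v.
Proof.
move=> ewu ewv uv suv; have wu := adj_neq ewu.
have uw : u != w by rewrite eq_sym.
have [p [pp lp up wp]] := side_simple uw suv.
apply: eacyc; exists (w :: u :: p); split.
  case: p lp {pp up wp} => [/= uv'|//]; by rewrite uv' eqxx in uv.
rewrite /ucycle cons_uniq wp up andbT /= rcons_path ewu pp lp /= esym ewv.
by [].
Qed.

Lemma side_meet u v w z : e w u -> e w v -> side u w z -> side v w z -> u = v.
Proof.
move=> ewu ewv su sv; apply/eqP/negPn/negP => uv.
apply: (side_disjoint ewu ewv uv); apply: joined_trans su _.
by apply: joined_sym sv; exact: minus_sym.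
Qed.

(** If the simple path from [v] to [z] visits [w], its part after [w] cannot return to [v]. *)
Lemma side_cover v w z : e v w -> joined e v z -> side v w z \/ side w v z.
Proof.
move=> evw /joined_simple[p [pp lp up]].
have vw := adj_neq evw.
have [wp|wp] := boolP (w \in p); last by left; rewrite -lp; exact: path_side.
right; case/splitPr: wp pp lp up => p1 p2.
rewrite cat_path last_cat /= => /and3P[_ _ pp] <-.
rewrite mem_cat cat_uniq inE !negb_or => /andP[/and3P[_ _ vp] _].
by apply: path_side => //; rewrite eq_sym.
Qed.

(** A simple path from [w] to [z] avoiding [v] starts with a neighbour [u] of [w] other than [v];
    then [z] would lie beyond both [u] and [v] as seen from [w]. *)
Lemma side_inter v w z : e v w -> side v w z -> ~ side w v z.
Proof.
move=> evw svz swz; have vw := adj_neq evw; have wv : w != v by rewrite eq_sym.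
have [[|u p] [pp lp up vp]] := side_simple wv swz.
  by move: (side_notin vw svz); rewrite -lp eqxx.
move: pp up vp lp => /= /andP[ewu pp] /andP[wup uup].
rewrite inE negb_or inE negb_or => /and3P[_ vu _] lp.
have uw : u != w by rewrite eq_sym (adj_neq ewu).
have wp : w \notin p by move: wup; rewrite inE negb_or => /andP[].
have suz : side u w z by rewrite -lp; apply: path_side.
by move: vu; rewrite (side_meet _ ewu svz suz) ?eqxx // esym.
Qed.

(** A path from [u] avoiding [v] never meets [w], since [u] and [w] are distinct neighbours of [v]
    and cannot be joined off [v]. *)
Lemma side_sub u v w : e v w -> e u v -> u != w -> side u v `<=` side v w.
Proof.
move=> evw euv uw z suz; have vw := adj_neq evw.
have evu : e v u by rewrite esym.
have swv : joined (minus e [:: w]) v u.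
  by apply: joined1; rewrite /minus /= !inE evu vw uw.
apply: joined_trans swv _; apply: joined_mono suz => a b ja.
move=> /and3P[eab av bv]; rewrite /minus /= eab !inE.
have nw c : side u v c -> c != w.
  move=> sc; apply/eqP => cw; subst c.
  exact: (side_disjoint evu evw uw).
rewrite !nw //; apply: joined_trans ja (joined1 _).
by rewrite /minus /= eab av bv.
Qed.

Lemma side_step a b v w : e v w -> side v w a -> e a b ->
  b = w /\ a = v \/ side v w b.
Proof.
move=> evw sa eab; have vw := adj_neq evw; have aw := side_notin vw sa.
have [bw|bw] := eqVneq b w; last first.
  by right; apply: joined_trans sa (joined1 _); rewrite /minus /= eab !inE aw bw.
left; split=> //; subst b.
have ewa : e w a by rewrite esym.
have ewv : e w v by rewrite esym.
symmetry; apply: (side_meet ewv ewa sa); exact: joined_refl.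
Qed.

(** A vertex common to both pieces would lie beyond [u] and also beyond the predecessor [t] of [m],
    two distinct neighbours of [m]. *)
Lemma uniq_cat_path x p m u q : path e x p -> uniq (x :: p) -> last x p = m ->
  path e m (u :: q) -> uniq (m :: u :: q) -> u \notin x :: p ->
  uniq (x :: p ++ u :: q).
Proof.
move=> pp up lp pq uq uxp; rewrite -cat_cons cat_uniq up.
move: uq; rewrite cons_uniq => /andP[muq ->]; rewrite andbT.
apply/hasPn => z zq; apply/negP => zp.
case/lastP: p pp up lp uxp zp => [|p m'].
  rewrite inE => _ _ /= -> _; rewrite inE => /eqP zm; subst z.
  by rewrite zq in muq.
rewrite last_rcons => pp up mm; subst m'.
move: pp up; rewrite rcons_path -rcons_cons rcons_uniq => /andP[pp etm].
move=> /andP[mxp up]; rewrite mem_rcons inE negb_or => /andP[um uxp].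
rewrite mem_rcons inE => /predU1P[zm|zp]; first by subst z; rewrite zq in muq.
set t := last x p in etm *.
have emt : e m t by rewrite esym.
have emu : e m u by case/andP: pq.
have tm : t != m by rewrite eq_sym (adj_neq emt).
have ut : u != t by apply: contraNneq uxp => ->; rewrite mem_last.
have sz1 : side u m z.
  by apply: path_side_mem zq => //; case/andP: pq.
have sxt : side x m t by apply: path_side_mem (mem_last _ _).
have sxz : side x m z by exact: path_side_mem zp.
have stz : side t m z.
  by apply: joined_trans sxz; apply: joined_sym sxt; exact: minus_sym.
by move: ut; rewrite (side_meet emu emt sz1 stz) eqxx.
Qed.

Lemma path_last_nbr x p m z : path e x (rcons p m) -> uniq (x :: rcons p m) ->
  e m z -> z \in x :: rcons p m -> z = last x p.
Proof.
rewrite rcons_path -rcons_cons rcons_uniq => /andP[pp etm] /andP[mp up] emz.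
rewrite mem_rcons inE => /predU1P[zm|zp]; first by subst z; rewrite eirr in emz.
apply/eqP/negPn/negP => zt.
have emt : e m (last x p) by rewrite esym.
apply: (side_disjoint emz emt zt).
have xm : x != m by apply: contraNneq mp => <-; rewrite mem_head.
case/splitPl: zp pp mp {etm emt up} => p1 p2 lz.
rewrite cat_path last_cat lz -cat_cons mem_cat negb_or => /andP[_ pp] /andP[_ mp].
apply: path_side => //; apply: contraNneq zt => zm.
by rewrite zm eirr in emz.
Qed.

(* Of three branches at [m], at most one backtracks along the path. *)
Lemma furcation_branch v u p m : path e v (u :: p) -> uniq (v :: u :: p) ->
  last v (u :: p) = m -> furcation m -> branch v u.
Proof.
move=> pp up lp [u1 [u2 [u3 [uu b1 b2 b3]]]] n.
have [z bz zp] : exists2 z, branch m z & z \notin v :: u :: p.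
  have [p' up'] : exists p', u :: p = rcons p' m.
    by exists (belast u p); rewrite -lp -lastI.
  rewrite up' in pp up *.
  have [z bz zt] : exists2 z, branch m z & z != last v p'.
    have [u1t|] := eqVneq u1 (last v p'); last by exists u1.
    exists u2 => //; rewrite -u1t eq_sym.
    by move: uu; rewrite /= !inE negb_or -andbA => /and3P[].
  exists z => //; apply: contra zt => zp; apply/eqP.
  by apply: path_last_nbr pp up (branch_adj bz) zp.
have [q [sq pq uq]] := bz n.
apply: (@stem_le _ _ _ (size (p ++ z :: q))).
  by rewrite size_cat /= sq addnS ltnW // ltnS leq_addl.
exists (p ++ z :: q); split=> //.
  by rewrite -cat_cons cat_path pp lp.
by rewrite -(cat_cons u); apply: uniq_cat_path lp pq uq zp.
Qed.

(** The path from [w] across the edge to [m] is prolonged by a branch at [m] that does not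
    backtrack. *)
Lemma furcation_side v w m : e v w -> side v w m -> furcation m -> branch w v.
Proof.
move=> evw svm fm; have vw := adj_neq evw.
have [p [pp lp up wp]] := side_simple vw svm.
by apply: (furcation_branch (p := p) (m := m)) fm; rewrite /= ?wp // esym evw.
Qed.

(* Each of [w1] and [w2] lies beyond at most one of the three branches. *)
Lemma furcation_third m w1 w2 : furcation m -> exists u,
  [/\ branch m u, ~ side u m w1 & ~ side u m w2].
Proof.
move=> [u1 [u2 [u3 [uu b1 b2 b3]]]]; apply: contrapT => h.
have h' u : branch m u -> side u m w1 \/ side u m w2.
  move=> bu; apply: contrapT => hu; apply: h; exists u; split=> // hs.
    by apply: hu; left.
  by apply: hu; right.
have inj u u' w : branch m u -> branch m u' -> side u m w -> side u' m w -> u = u'.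
  by move=> /branch_adj eu /branch_adj eu'; exact: side_meet.
move: uu; rewrite /= !inE negb_or -andbA => /and4P[/eqP n12 /eqP n13 /eqP n23 _].
by case: (h' _ b1) (h' _ b2) (h' _ b3) => s1 [] s2 [] s3;
  first [exact: (n12 (inj _ _ _ b1 b2 s1 s2)) | exact: (n13 (inj _ _ _ b1 b3 s1 s3))
        |exact: (n23 (inj _ _ _ b2 b3 s2 s3))].
Qed.

Variable nb : V -> seq V.
Hypothesis nbP : forall v u, e v u -> u \in nb v.

(** One step of König's lemma: arbitrarily long paths leave [v] through finitely many neighbours. *)
Lemma branch_step w v : e w v -> branch w v -> exists2 u, u != w & branch v u.
Proof.
move=> ewv bwv.
have [n|u [_ uw bu]] := @branch_finite v (nb v) (fun u => u != w).
  have [[|u p] [sp pp up]] := bwv n.+1; first by [].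
  case: sp => sp.
  move: pp => /= /and3P[_ evu pp]; move: up; rewrite cons_uniq => /andP[wp up].
  exists u; split; [exact: nbP| |by exists p; rewrite /= evu].
  by apply: contraNneq wp => ->; rewrite !inE eqxx orbT.
by exists u.
Qed.

Fixpoint nb_ball (v : V) (n : nat) : seq V :=
  if n is n'.+1 then v :: flatten [seq nb_ball u n' | u <- nb v] else [:: v].

Lemma nb_ballP v p n : path e v p -> (size p <= n)%N -> last v p \in nb_ball v n.
Proof.
elim: n v p => [|n IH] v [|a p] //=; rewrite inE ?eqxx //.
move=> /andP[eva pp] sp; apply/orP; right.
by apply/flattenP; exists (nb_ball a n); [apply: map_f; exact: nbP|exact: IH].
Qed.

(** An infinite side has points outside the finite ball of radius [n], and the simple path to such a
    point is longer than [n]. *)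
Lemma infinite_side_branch v w : e v w ->
  (forall s : seq V, exists2 z, side w v z & z \notin s) -> branch v w.
Proof.
move=> evw inf n; have wv : w != v by rewrite eq_sym (adj_neq evw).
have [z sz zn] := inf (nb_ball w n).
have [p [pp lp up vp]] := side_simple wv sz.
apply: (@stem_le _ _ _ (size p)); last first.
  by exists p; rewrite /= evw pp; split=> //; rewrite -/(uniq (v :: w :: p)) cons_uniq vp up.
rewrite leqNgt; apply: contra zn => sp.
by rewrite -lp; apply: nb_ballP => //; exact: ltnW.
Qed.

End Tree.

(** * Ends of a tree *)

Section Rays.
Variables (V : choiceType) (e : rel V) (nb : V -> seq V).
Hypotheses (esym : symmetric e) (eirr : irreflexive e).
Hypothesis eacyc : ~ exists c : seq V, (2 < size c)%N /\ ucycle e c.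
Hypothesis nbP : forall v u, e v u -> u \in nb v.
Implicit Types (r s t : nat -> V) (u v z : V).

Definition is_ray r := injective r /\ forall n, e (r n) (r n.+1).

Definition equiv_ray r s := forall S : seq V, exists N : nat,
  forall m n, (N <= m)%N -> (N <= n)%N ->
    [/\ r m \notin S, s n \notin S & joined (minus e S) (r m) (s n)].

(** The direction at [v] of the end represented by [r]; an initial piece of the ray has no
    influence. *)
Definition heads r v u := e v u /\ exists N, forall n, (N <= n)%N -> side e u v (r n).

Lemma ray_escape r (S : seq V) : injective r ->
  exists N, forall n, (N <= n)%N -> r n \notin S.
Proof.
move=> ri; elim: S => [|a S [N hN]]; first by exists 0%N.
have [[k rk]|h] := pselect (exists k, r k = a).
  exists (maxn N k.+1) => n; rewrite geq_max => /andP[Nn kn].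
  rewrite inE negb_or hN // andbT; apply/eqP => rn.
  by move: kn; rewrite (ri n k) ?ltnn // rn rk.
exists N => n Nn; rewrite inE negb_or hN // andbT.
by apply/eqP => rn; apply: h; exists n.
Qed.

(** After its last visit to [v] the ray stays in one component of the complement of [v], entered
    through the first vertex of a simple path from [v] to the ray. *)
Lemma heads_ex r v : is_ray r -> joined e v (r 0%N) -> exists u, heads r v u.
Proof.
move=> [ri re] jv; have [N hN] := ray_escape [:: v] ri.
have jN : joined e v (r N).
  elim: {hN} N => [//|N IH]; apply: joined_trans IH _; exact: joined1.
have [[|a p] [pp lp up]] := joined_simple jN.
  by have := hN N (leqnn N); rewrite -lp inE eqxx.
move: pp lp up => /= /andP[eva pp] lp /andP[vap up].
have va : a != v by rewrite eq_sym; exact: adj_neq eva.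
exists a; split=> //; exists N; elim=> [|n IH].
  rewrite leqn0 => /eqP N0; subst N; rewrite -lp.
  by apply: path_side => //; move: vap; rewrite inE negb_or => /andP[].
rewrite leq_eqVlt => /predU1P[Nn|]; last rewrite ltnS => Nn.
  rewrite -Nn -lp; apply: path_side => //.
  by move: vap; rewrite inE negb_or => /andP[].
apply: joined_trans (IH Nn) (joined1 _).
have := hN _ Nn; have := hN _ (leqW Nn); rewrite /minus /= re !inE.
by move=> -> ->.
Qed.

Lemma heads_uniq r v u u' : heads r v u -> heads r v u' -> u = u'.
Proof.
move=> [eu [N hN]] [eu' [M hM]].
exact: (side_meet esym eirr eacyc eu eu' (hN _ (leq_maxl N M)) (hM _ (leq_maxr N M))).
Qed.

Lemma heads_branch r v u : is_ray r -> heads r v u -> branch e v u.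
Proof.
move=> [ri _] [evu [N hN]]; apply: (infinite_side_branch eirr nbP evu) => S.
have [M hM] := ray_escape S ri.
by exists (r (maxn N M)); [apply: hN; exact: leq_maxl|apply: hM; exact: leq_maxr].
Qed.

Lemma heads_back r s v u u' : heads r v u -> heads s v u' -> u != u' -> heads s u v.
Proof.
move=> [evu _] [evu' [M hM]] uu'; split; first by rewrite esym.
exists M => n Mn; apply: (side_sub esym eirr eacyc evu _ _ (hM _ Mn)).
  by rewrite esym.
by rewrite eq_sym.
Qed.

Lemma heads_forward r v u u' : heads r v u -> heads r u u' -> u' != v.
Proof.
move=> [evu [N hN]] [euu' [M hM]]; apply/eqP => u'v; subst u'.
exact: (side_inter esym eirr eacyc evu (hM _ (leq_maxr N M)) (hN _ (leq_maxl N M))).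
Qed.

Section Walk.
Variables (r t : nat -> V) (v : nat -> V).
Hypothesis vr : forall j, heads r (v j) (v j.+1).
Hypothesis vt : forall j, heads t (v j) (v j.+1).

Lemma walk_side_sub i j : (i <= j)%N ->
  side e (v j.+1) (v j) `<=` side e (v i.+1) (v i).
Proof.
elim: j => [|j IH]; first by rewrite leqn0 => /eqP ->.
rewrite leq_eqVlt => /predU1P[->//|]; rewrite ltnS => /IH; apply: subset_trans.
have [e1 _] := vr j; have [e2 _] := vr j.+1.
apply: side_sub => //; rewrite 1?esym //; exact: heads_forward (vr j) (vr j.+1).
Qed.

(** If [z] stayed ahead of the walk forever, the simple path from [v 0] to [z] would be forced to
    follow the walk step by step, and it is finite. *)
Lemma walk_leaves z : exists i, ~ side e (v i.+1) (v i) z.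
Proof.
apply: contrapT => h.
have h' i : side e (v i.+1) (v i) z by apply: contrapT => hi; apply: h; exists i.
have [p [pp lp up]] : exists p, [/\ path e (v 0%N) p, last (v 0%N) p = z & uniq (v 0%N :: p)].
  apply: joined_simple; have [e0 _] := vr 0.
  exact: joined_trans (joined1 e0) (side_joined (h' 0%N)).
elim: p 0%N pp lp up => [|a p IH] i /=.
  move=> _ viz _; have [ei _] := vr i.
  have n : v i.+1 != v i by rewrite eq_sym; exact: adj_neq ei.
  by have := side_notin n (h' i); rewrite viz eqxx.
move=> /andP[ea pp] lp /andP[vap uap].
have [ei _] := vr i.
have sa : side e a (v i) z.
  rewrite -lp; apply: path_side => //.
    by rewrite eq_sym; exact: adj_neq ea.
  by move: vap; rewrite inE negb_or => /andP[].
have av := side_meet esym eirr eacyc ea ei sa (h' i); subst a.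
exact: IH pp lp uap.
Qed.

(** The sides ahead of the walk decrease to the empty set, so one of them misses [S]; it is
    connected and contains tails of both rays. *)
Lemma walk_equiv : equiv_ray r t.
Proof.
move=> S; have [j hj] : exists j, forall z, z \in S -> ~ side e (v j.+1) (v j) z.
  elim: S => [|a S [j hj]]; first by exists 0%N.
  have [i hi] := walk_leaves a; exists (maxn i j) => z.
  rewrite inE => /predU1P[->|zS] sz.
    exact: hi (walk_side_sub (leq_maxl _ _) sz).
  exact: hj zS (walk_side_sub (leq_maxr _ _) sz).
have [_ [N hN]] := vr j; have [_ [M hM]] := vt j.
have nS z : side e (v j.+1) (v j) z -> z \notin S.
  by move=> sz; apply/negP => zS; exact: hj zS sz.
exists (maxn N M) => m n; rewrite !geq_max => /andP[Nm _] /andP[_ Mn].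
have sr := hN _ Nm; have st := hM _ Mn; split; [exact: nS|exact: nS|].
have jrt : joined (minus e [:: v j]) (r m) (t n).
  by apply: joined_trans st; apply: joined_sym sr; exact: minus_sym.
apply: joined_mono jrt => a b ja mab.
have sa : side e (v j.+1) (v j) a by apply: joined_trans sr ja.
have sb : side e (v j.+1) (v j) b by apply: joined_trans sa (joined1 mab).
by case/and3P: mab => eab _ _; rewrite /minus /= eab !nS.
Qed.

End Walk.

(** Follow the directions of [r] from [v0]. If [t] shared all of them, the rays would be equivalent,
    so there is a first disagreement [k]. *)
Lemma heads_split r t v0 : is_ray r -> is_ray t ->
  joined e v0 (r 0%N) -> joined e v0 (t 0%N) -> ~ equiv_ray r t ->
  exists (v : nat -> V) k, [/\ v 0%N = v0,
    forall j, (j < k)%N -> heads r (v j) (v j.+1) /\ heads t (v j) (v j.+1),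
    forall j, joined e v0 (v j), heads r (v k) (v k.+1) & ~ heads t (v k) (v k.+1)].
Proof.
move=> rr rt j0r j0t nrt.
have [D hD] : exists D : V -> V, forall v, joined e v (r 0%N) -> heads r v (D v).
  have hex v : exists u, joined e v (r 0%N) -> heads r v u.
    have [jv|njv] := pselect (joined e v (r 0%N)); last by exists v.
    by have [u hu] := heads_ex rr jv; exists u.
  by exists (fun v => projT1 (cid (hex v))) => v; exact: (projT2 (cid (hex v))).
pose v j := iter j D v0.
have jv j : joined e v0 (v j).
  elim: j => [|j IH]; first exact: joined_refl.
  have [ev _] : heads r (v j) (v j.+1).
    by apply: hD; apply: joined_trans (joined_sym esym IH) j0r.
  exact: joined_trans IH (joined1 ev).
have vr j : heads r (v j) (v j.+1).
  by apply: hD; apply: joined_trans (joined_sym esym (jv j)) j0r.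
have ex : exists k, `[< ~ heads t (v k) (v k.+1) >].
  apply: contrapT => h; apply: nrt; apply: (@walk_equiv r t v vr) => j.
  by apply: contrapT => hj; apply: h; exists j; apply/asboolP.
exists v, (ex_minn ex); case: ex_minnP => k /asboolP hk kmin; split=> // j jk.
split=> //; apply: contrapT => hj.
by have := kmin j (asboolT hj); rewrite leqNgt jk.
Qed.

Lemma three_heads r s t v : is_ray r -> is_ray s -> is_ray t ->
  joined e v (r 0%N) -> joined e v (s 0%N) -> joined e v (t 0%N) ->
  (forall u, heads r v u -> ~ heads s v u) ->
  (forall u, heads r v u -> ~ heads t v u) ->
  (forall u, heads s v u -> ~ heads t v u) -> furcation e v.
Proof.
move=> rr rs rt jr js jt rsN rtN stN.
have [[ur hr] [us hs] [ut ht]] := And3 (heads_ex rr jr) (heads_ex rs js) (heads_ex rt jt).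
exists ur, us, ut; split; first last.
- exact: heads_branch ht.
- exact: heads_branch hs.
- exact: heads_branch hr.
rewrite /= !inE negb_or !andbT; apply/andP; split; [apply/andP; split|];
  apply/eqP => E; subst; [exact: rsN hr hs|exact: rtN hr ht|exact: stN hs ht].
Qed.

(* From a vertex at which [r] and [s] part, follow [r] for as long as [t] does:
   all along, [s] points backwards, so that the three directions are distinct
   at the vertex where [t] leaves. *)
Lemma furcation_follow r s t v : is_ray r -> is_ray s -> is_ray t ->
  joined e v (r 0%N) -> joined e v (s 0%N) -> joined e v (t 0%N) ->
  ~ equiv_ray r t -> (forall u, heads r v u -> ~ heads s v u) ->
  (forall u, heads s v u -> ~ heads t v u) ->
  exists2 m, joined e v m & furcation e m.
Proof.
move=> rr rs rt jr js jt nrt rsN stN.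
have [x [k [x0 xk xj xr xt]]] := heads_split rr rt jr jt nrt.
exists (x k) => //.
have jx w j : joined e v (w 0%N) -> joined e (x j) (w 0%N).
  by apply: joined_trans; exact: joined_sym.
have N1 u : heads r (x k) u -> ~ heads t (x k) u.
  by move=> hr; rewrite (heads_uniq hr xr).
have hs j : (j < k)%N -> heads s (x j.+1) (x j).
  elim: j => [|j IH] jk.
    have [us hs] := heads_ex rs (jx s 0%N js); have [h1 _] := xk _ jk.
    apply: (heads_back h1 hs); apply/eqP => E; move: h1 hs; rewrite x0 -E.
    exact: rsN.
  have [h1 _] := xk _ jk; have [h0 _] := xk _ (ltnW jk).
  apply: (heads_back h1 (IH (ltnW jk))); exact: heads_forward h0 h1.
apply: (@three_heads r s t) => //; try exact: jx.
- case: k {xt N1} xk xr hs => [|k] xk xr hs u; first by rewrite x0; exact: rsN.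
  move=> hu hsu; have hsk := hs k (ltnSn k); have [h0 _] := xk k (ltnSn k).
  move: (heads_forward h0 hu); rewrite (heads_uniq hsu hsk) eqxx; by [].
- case: k {xt N1 xr} xk hs => [|k] xk hs u; first by rewrite x0; exact: stN.
  move=> hsu ht; have hsk := hs k (ltnSn k); have [_ h0] := xk k (ltnSn k).
  by move: (heads_forward h0 ht); rewrite (heads_uniq hsu hsk) eqxx.
Qed.

(** Where [r] and [s] part, the third ray shares a direction with at most one of them. If with none,
    the vertex is a furcation; otherwise the shared direction is followed until the two rays
    separate. *)
Lemma furcation_rays r s t : is_ray r -> is_ray s -> is_ray t ->
  joined e (r 0%N) (s 0%N) -> joined e (r 0%N) (t 0%N) ->
  ~ equiv_ray r s -> ~ equiv_ray r t -> ~ equiv_ray s t ->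
  exists2 m, joined e (r 0%N) m & furcation e m.
Proof.
move=> rr rs rt js jt nrs nrt nst.
have [x [k [x0 _ xj xr xs]]] := heads_split rr rs (joined_refl _ _) js nrs.
set v := x k in xr xs; set u := x k.+1 in xr xs.
have jv w : joined e (r 0%N) (w 0%N) -> joined e v (w 0%N).
  by apply: joined_trans; apply: joined_sym (xj k).
have jr := jv r (joined_refl _ _); have jvs := jv s js; have jvt := jv t jt.
have N u' : heads r v u' -> ~ heads s v u' by move=> h; rewrite (heads_uniq h xr).
suff [m jm fm] : exists2 m, joined e v m & furcation e m.
  by exists m => //; exact: joined_trans (xj k) jm.
have [ht|nht] := pselect (heads t v u).
  apply: (@furcation_follow r s t) => // u' hs ht'.
  by apply: (N u'); rewrite // (heads_uniq ht' ht).
have [us hs] := heads_ex rs jvs.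
have [ht|nht'] := pselect (heads t v us).
  apply: (@furcation_follow s r t) => // u' h h'; first exact: N h' h.
  by apply: nht; rewrite -(heads_uniq h xr).
exists v; first exact: joined_refl.
apply: (@three_heads r s t) => // u' h; first by rewrite (heads_uniq h xr).
by rewrite (heads_uniq h hs).
Qed.

End Rays.

(** * Flows and edge exchanges in a forest *)

Section Flow.
Variables (V : choiceType) (e : rel V) (nb : V -> seq V).
Hypotheses (esym : symmetric e) (eirr : irreflexive e).
Hypothesis eacyc : ~ exists c : seq V, (2 < size c)%N /\ ucycle e c.
Hypothesis nbP : forall v u, e v u -> u \in nb v.
Hypothesis nb_uniq : forall v, uniq (nb v).
Variable o : V -> V -> Prop.

Definition one_way := forall v w, e v w -> o v w -> ~ o w v.
(** Typical of an orientation that depends monotonically on the sides of an edge: one step backwards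
    from the tail, the side behind shrinks. *)
Definition inherited :=
  forall u v w, e v w -> o v w -> e u v -> u != w -> o u v.

(** The last clause demands an infinite side behind the tail [v], so that a flow leaving [v] is
    always fed from further back. *)
Definition flow (v w : V) : Prop := [/\ e v w, o v w & branch e w v].

Hypotheses (o_one : one_way) (o_inh : inherited).

Lemma flow_unique v w w' : flow v w -> flow v w' -> w = w'.
Proof.
move=> [evw ovw _] [evw' ovw' _]; apply/eqP/negPn/negP => ww'.
apply: (o_one evw' ovw'); apply: (o_inh evw ovw); last by rewrite eq_sym.
by rewrite esym.
Qed.

Lemma flow_back v w u : flow v w -> branch e v u -> u != w -> flow u v.
Proof.
move=> [evw ovw bwv] bvu uw; have euv : e u v by rewrite esym (branch_adj bvu).
by split=> //; exact: o_inh evw ovw euv uw.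
Qed.

Lemma flow_out_le v : (count (fun u => `[< flow v u >]) (nb v) <= 1)%N.
Proof.
case: (pselect (exists w, flow v w)) => [[w fw]|nf].
  apply: (@leq_trans (count (pred1 w) (nb v))).
    by apply: sub_count => u /asboolP fu /=; rewrite (flow_unique fu fw).
  by rewrite count_uniq_mem // leq_b1.
rewrite leqW // leqn0 -leqn0 leqNgt -has_count; apply/hasPn => u _.
by apply/asboolP => fu; apply: nf; exists u.
Qed.

Lemma flow_in v u : flow u v -> (0 < count (fun u => `[< flow u v >]) (nb v))%N.
Proof.
move=> fu; rewrite -has_count; apply/hasP; exists u; last exact/asboolP.
by apply: nbP; rewrite esym; case: fu.
Qed.

Lemma flow_out v u : flow v u -> count (fun u => `[< flow v u >]) (nb v) = 1%N.
Proof.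
move=> fu; apply/eqP; rewrite eqn_leq flow_out_le -has_count.
by apply/hasP; exists u; [apply: nbP; case: fu|exact/asboolP].
Qed.

(** If an edge flows out of [v], it is the only one, and the infinite side behind it contains a
    branch at [v], along which the orientation is inherited and flows in. *)
Lemma flow_out_le_in v : (count (fun u => `[< flow v u >]) (nb v) <=
  count (fun u => `[< flow u v >]) (nb v))%N.
Proof.
case: (pselect (exists w, flow v w)) => [[w fw]|nf]; last first.
  rewrite (leq_trans _ (leq0n _)) // leqNgt -has_count; apply/hasPn => u _.
  by apply/asboolP => fu; apply: nf; exists u.
rewrite (flow_out fw); have [evw _ bwv] := fw.
have [u uw bvu] := branch_step nbP (etrans (esym w v) evw) bwv.
exact: (flow_in (flow_back fw bvu uw)).
Qed.

Hypothesis balanced : forall v, count (fun u => `[< flow v u >]) (nb v) =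
  count (fun u => `[< flow u v >]) (nb v).

(* Being the tail of a flow edge propagates along the path to the furcation,
   where two of the three branches would flow in and only one edge out. *)
Lemma balanced_no_flow v w m : furcation e m -> flow v w -> ~ joined e v m.
Proof.
move=> fm fvw /joined_simple[p [pp lp up]].
elim: p v w fvw pp lp up => [|v1 p IH] v w fvw.
  move=> _ /= vm _; subst v.
  have [u1 [u2 [u3 [uu b1 b2 b3]]]] := fm.
  have [a [b [ab fa fb]]] : exists a b, [/\ a != b, flow a m & flow b m].
    have fu u : branch e m u -> u != w -> flow u m by move=> bu; exact: flow_back fvw bu.
    move: uu; rewrite /= !inE negb_or -andbA => /and4P[n12 n13 n23 _].
    have [u1w|u1w] := eqVneq u1 w.
      by exists u2, u3; split; rewrite ?n23 //; apply: fu => //; rewrite -u1w eq_sym.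
    have [u2w|u2w] := eqVneq u2 w.
      exists u1, u3; split; rewrite ?n13 //; apply: fu => //.
      by rewrite -u2w eq_sym.
    by exists u1, u2; split; rewrite ?n12 //; apply: fu.
  have : (2 <= count (fun u => `[< flow u m >]) (nb m))%N.
    have : {subset [:: a; b] <= [seq u <- nb m | `[< flow u m >]]}.
      move=> z; rewrite !inE mem_filter => /orP[]/eqP ->.
        by rewrite (asboolT fa) /= nbP // esym; case: fa.
      by rewrite (asboolT fb) /= nbP // esym; case: fb.
    move/uniq_leq_size; rewrite size_filter; apply.
    by rewrite /= inE ab.
  by rewrite -balanced (flow_out fvw).
move=> pp lp up.
(* If the path follows the outgoing edge, [v1] receives flow and must emit some by balance.
   Otherwise its first edge leads to a furcation, hence starts a branch, and that branch flows back
   into [v]. *)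
have [w1 fw1] : exists w1, flow v1 w1.
  have [v1w|v1w] := eqVneq v1 w.
    subst w; have : (0 < count (fun u => `[< flow v1 u >]) (nb v1))%N.
      by rewrite balanced; exact: flow_in fvw.
    by rewrite -has_count => /hasP[z _ /asboolP fz]; exists z.
  exists v; apply: flow_back fvw _ v1w.
  exact: (furcation_branch esym eirr eacyc pp up lp fm).
move: pp up => /andP[_ pp] /andP[_ up]; exact: IH fw1 pp lp up.
Qed.

End Flow.

(** * The connectivity kernel after an edge exchange or an insertion *)

Section Switched.
Variables (V : choiceType) (e e' : rel V).
Hypotheses (esym : symmetric e) (esym' : symmetric e').

(* [e'] reconnects the components [A `|` B] and [D] of [e] into
   [A `|` D] and [B]. *)
Variables (A B D : set V).
Hypotheses (AB : forall z, A z -> ~ B z) (AD : forall z, A z \/ B z -> ~ D z).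
Hypothesis comp1 : forall z z', A z \/ B z -> (joined e z z' <-> A z' \/ B z').
Hypothesis comp2 : forall z z', D z -> (joined e z z' <-> D z').
Hypothesis comp1' : forall z z', A z \/ D z -> (joined e' z z' <-> A z' \/ D z').
Hypothesis comp2' : forall z z', B z -> (joined e' z z' <-> B z').
Hypothesis same : forall z z', ~ (A z \/ B z \/ D z) -> ~ (A z' \/ B z' \/ D z') ->
  e z z' = e' z z'.

(** The kernel is the sum, over classes, of products of indicators. Classes disjoint from [A], [B]
    and [D] cancel: the relations agree outside these sets, and no path leads into them from
    outside. *)
Lemma switched_joined (R : pzRingType) (z z' : V) :
  \1_[set y | joined e' z y] z' - \1_[set y | joined e z y] z' =
  \1_(A `|` D) z * \1_(A `|` D) z' + \1_B z * \1_B z' -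
  \1_(A `|` B) z * \1_(A `|` B) z' - \1_D z * \1_D z' :> R.
Proof.
have cD y : D y \/ ~ D y by exact: EM.
have iff (P Q : Prop) : (P <-> Q) -> `[< P >] = `[< Q >].
  by move=> [a b]; apply/asboolP/asboolP.
have ind (X : set V) y : \1_X y = (`[< X y >])%:R :> R.
  by rewrite indicE -/(in_mem _ _) /in_mem.
rewrite !ind /setU /=.
have [Az|nAz] := pselect (A z).
  rewrite (iff _ _ (comp1' z' (or_introl Az))) (iff _ _ (comp1 z' (or_introl Az))).
  rewrite (asboolF (AB Az)) (asboolF (AD (or_introl Az))).
  rewrite !(@asboolT (A z \/ _)) ?mul1r ?mul0r ?addr0 ?subr0 //; by left.
have [Bz|nBz] := pselect (B z).
  rewrite (iff _ _ (comp2' z' Bz)) (iff _ _ (comp1 z' (or_intror Bz))).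
  rewrite (asboolT Bz) (asboolF (AD (or_intror Bz))).
  rewrite (@asboolF (A z \/ D z)); last by case=> // Dz; exact: AD (or_intror Bz) Dz.
  rewrite !(@asboolT (A z \/ _)) ?mul1r ?mul0r ?add0r ?subr0 //; by right.
have nAB : ~ (A z \/ B z) by case.
rewrite (asboolF nAB) (asboolF nBz).
have [Dz|nDz] := pselect (D z).
  rewrite (iff _ _ (comp1' z' (or_intror Dz))) (iff _ _ (comp2 z' Dz)).
  rewrite (asboolT Dz) (@asboolT (A z \/ _)) ?mul1r ?mul0r ?addr0 ?subr0 //; by right.
have nAD : ~ (A z \/ D z) by case.
rewrite (asboolF nAD) (asboolF nDz) !mul0r addr0 !subr0.
apply/eqP; rewrite subr_eq0; apply/eqP; congr (_%:R); congr nat_of_bool; apply: iff.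
have out : ~ (A z \/ B z \/ D z) by case=> [|[]].
split=> j.
  suff [] : joined e z z' /\ ~ (A z' \/ B z' \/ D z') by [].
  apply: (joined_closed (Z := fun y => joined e z y /\ ~ (A y \/ B y \/ D y))) j.
    move=> a b [ja na] eab.
    have nb : ~ (A b \/ B b \/ D b).
      have jba : joined e' b a by apply: joined1; rewrite esym'.
      case=> [Ab|[Bb|Db]]; apply: na.
      - by have := (comp1' a (or_introl Ab)).1 jba; tauto.
      - by right; left; exact: (comp2' a Bb).1 jba.
      - by have := (comp1' a (or_intror Db)).1 jba; tauto.
    by split=> //; apply: joined_trans ja (joined1 _); rewrite same.
  by split=> //; exact: joined_refl.
suff [] : joined e' z z' /\ ~ (A z' \/ B z' \/ D z') by [].
apply: (joined_closed (Z := fun y => joined e' z y /\ ~ (A y \/ B y \/ D y))) j.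
  move=> a b [ja na] eab.
  have nb : ~ (A b \/ B b \/ D b).
    have jba : joined e b a by apply: joined1; rewrite esym.
    case=> [Ab|[Bb|Db]]; apply: na.
    - by have := (comp1 a (or_introl Ab)).1 jba; tauto.
    - by have := (comp1 a (or_intror Bb)).1 jba; tauto.
    - by right; right; exact: (comp2 a Db).1 jba.
  by split=> //; apply: joined_trans ja (joined1 _); rewrite -same.
by split=> //; exact: joined_refl.
Qed.

End Switched.

Section Exchange.
Variables (V : choiceType) (e e' : rel V).
Hypotheses (esym : symmetric e) (eirr : irreflexive e).
Hypothesis eacyc : ~ exists c : seq V, (2 < size c)%N /\ ucycle e c.
Variables (x y v w : V).
Hypotheses (nxy : ~ joined e x y) (evw : e v w) (xv : side e v w x).
Hypothesis e'E : forall a b, e' a b <->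
  (e a b \/ [set a; b] = [set x; y]) /\ [set a; b] <> [set v; w].

Lemma set2_eq (a b c d : V) : [set a; b] = [set c; d] ->
  (a = c /\ b = d) \/ (a = d /\ b = c).
Proof.
move=> E; have := E => /seteqP[s1 s2].
have [] := s1 a (or_introl erefl); have [] := s1 b (or_intror erefl) => /= bE aE.
- subst; have [] := s2 d (or_intror erefl) => /= ?; subst; by left.
- by left.
- by right.
- subst; have [] := s2 c (or_introl erefl) => /= ?; subst; by left.
Qed.

Lemma exchange_sym : symmetric e'.
Proof.
suff h a b : e' a b -> e' b a by move=> a b; apply/idP/idP; exact: h.
by rewrite !e'E esym (setUC [set a]).
Qed.

Let A := side e v w.
Let B := side e w v.
Let D := [set z | joined e y z].

Let xz z : A z \/ B z <-> joined e x z.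
Proof.
have jxv : joined e x v by apply: joined_sym => //; exact: side_joined xv.
split=> [[Az|Bz]|jxz].
- exact: joined_trans jxv (side_joined Az).
- apply: joined_trans jxv (joined_trans (joined1 evw) (side_joined Bz)).
- apply: side_cover => //; apply: joined_trans jxz; exact: side_joined xv.
Qed.

Let AB z : A z -> ~ B z. Proof. exact: side_inter. Qed.

Let ABD z : A z \/ B z -> ~ D z.
Proof.
by move=> /xz jx jy; apply: nxy; apply: joined_trans jx (joined_sym esym jy).
Qed.

Let subA a b : A a -> e a b -> A b \/ (a = v /\ b = w).
Proof.
by move=> Aa eab; have [[-> ->]|] := side_step esym eirr eacyc evw Aa eab; [right|left].
Qed.

Let subB a b : B a -> e a b -> B b \/ (a = w /\ b = v).
Proof.
have ewv : e w v by rewrite esym.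
by move=> Ba eab; have [[-> ->]|] := side_step esym eirr eacyc ewv Ba eab; [right|left].
Qed.

(** A path avoiding [q] cannot use the removed edge, one of whose endpoints is [q]. *)
Let conn (p q z : V) : e p q -> [set p; q] = [set v; w] -> side e p q z ->
  joined e' p z.
Proof.
move=> epq pqvw; apply: joined_sub => a b /and3P[eab aq bq]; apply/e'E.
split; first by left.
move=> abvw; have /(_ q) [_ /(_ (or_intror erefl))] : forall c, [set a; b] c <-> [set p; q] c.
  by rewrite abvw pqvw.
by move: aq bq; rewrite !inE => aq bq [] qe; [move: aq|move: bq]; rewrite qe eqxx.
Qed.

Let xyE a b : [set a; b] = [set x; y] -> (a = x /\ b = y) \/ (a = y /\ b = x).
Proof. exact: set2_eq. Qed.

Let Ax : A x. Proof. exact: xv. Qed.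
Let Dy : D y. Proof. exact: joined_refl. Qed.

Let closAD a b : A a \/ D a -> e' a b -> A b \/ D b.
Proof.
move=> ADa /e'E[[eab|/xyE[[_ ->]|[_ ->]]] nab]; [|by right|by left].
case: ADa => [Aa|Da]; last by right; exact: joined_trans Da (joined1 eab).
by case: (subA Aa eab) => [|[av bw]]; [left|case: nab; rewrite av bw].
Qed.

Let closB a b : B a -> e' a b -> B b.
Proof.
move=> Ba /e'E[[eab|/xyE[[ax _]|[ay _]]] nab].
- by case: (subB Ba eab) => [//|[av bw]]; case: nab; rewrite av bw setUC.
- by subst a; case: (AB Ax Ba).
- by subst a; case: (ABD (or_intror Ba) Dy).
Qed.

Let joinAD z : A z \/ D z -> joined e' x z.
Proof.
have AAz u : A u -> joined e' v u by apply: conn.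
(* The inserted edge is not the removed one, because [y] is outside the component that contains [v]
   and [w]. *)
have xy : joined e' x y.
  apply/joined1/e'E; split; first by right.
  move=> xyvw; have /(_ y) [/(_ (or_intror erefl)) h _] :
    forall c, [set x; y] c <-> [set v; w] c by rewrite xyvw.
  apply: nxy; apply/xz; case: h => /= ->; first by left; exact: joined_refl.
  by right; exact: joined_refl.
case=> [Az|Dz].
  apply: joined_trans (AAz z Az); apply: joined_sym (AAz x Ax); exact: exchange_sym.
apply: joined_trans xy _; apply: joined_mono Dz => a b ja eab.
apply/e'E; split; first by left.
move=> abvw; have /(_ a) [/(_ (or_introl erefl)) h _] :
  forall c, [set a; b] c <-> [set v; w] c by rewrite abvw.
suff : A a \/ B a by move/ABD.
by case: h => /= ->; [left|right]; exact: joined_refl.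
Qed.

Lemma exchange_comp1 z z' : A z \/ D z -> (joined e' z z' <-> A z' \/ D z').
Proof.
move=> ADz; split=> [j|ADz']; first exact: (joined_closed closAD ADz j).
apply: joined_trans (joinAD ADz'); apply: joined_sym (joinAD ADz); exact: exchange_sym.
Qed.

Lemma exchange_comp2 z z' : B z -> (joined e' z z' <-> B z').
Proof.
move=> Bz; split=> [j|Bz']; first exact: (joined_closed closB Bz j).
have h u : B u -> joined e' w u by apply: conn; [rewrite esym|rewrite setUC].
apply: joined_trans (h z' Bz'); apply: joined_sym (h z Bz); exact: exchange_sym.
Qed.

Lemma exchange_joined (R : pzRingType) (z z' : V) :
  \1_[set y | joined e' z y] z' - \1_[set y | joined e z y] z' =
  \1_(A `|` D) z * \1_(A `|` D) z' + \1_B z * \1_B z' -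
  \1_(A `|` B) z * \1_(A `|` B) z' - \1_D z * \1_D z' :> R.
Proof.
apply: switched_joined => //.
- exact: exchange_sym.
- move=> a b /xz jxa; rewrite xz; split; first exact: joined_trans.
  by apply: joined_trans; apply: joined_sym.
- move=> a b Da; split; first exact: joined_trans.
  by apply: joined_trans; apply: joined_sym.
- exact: exchange_comp1.
- exact: exchange_comp2.
- move=> a b na nb; apply/idP/idP => [eab|/e'E[[]// /xyE[[ax _]|[ay _]] _]].
  + apply/e'E; split; first by left.
    move=> /set2_eq[[av _]|[aw _]]; apply: na; first by left; rewrite av; exact: joined_refl.
    by right; left; rewrite aw; exact: joined_refl.
  + by case: na; left; rewrite ax.
  + by case: na; right; right; rewrite ay.
Qed.

End Exchange.

Section Merge.
Variables (V : choiceType) (e e' : rel V).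
Hypotheses (esym : symmetric e).
Variables (x y : V).
Hypotheses (nxy : ~ joined e x y).
Hypothesis e'E : forall a b, e' a b <-> e a b \/ [set a; b] = [set x; y].

Let C := [set z | joined e x z].
Let D := [set z | joined e y z].

Lemma merge_joined (R : pzRingType) (z z' : V) :
  \1_[set y | joined e' z y] z' - \1_[set y | joined e z y] z' =
  \1_(C `|` D) z * \1_(C `|` D) z' -
  \1_C z * \1_C z' - \1_D z * \1_D z' :> R.
Proof.
have sym' : symmetric e'.
  suff h a b : e' a b -> e' b a by move=> a b; apply/idP/idP; exact: h.
  by rewrite !e'E esym (setUC [set a]).
have ee' a b : joined e a b -> joined e' a b.
  by apply: joined_sub => c d ecd; apply/e'E; left.
have jCD u : C u \/ D u -> joined e' x u.
  case=> [/ee'//|/ee']; apply: joined_trans; apply/joined1/e'E; by right.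
have cl a b : C a \/ D a -> e' a b -> C b \/ D b.
  move=> CDa /e'E[eab|/set2_eq[[_ ->]|[_ ->]]].
  - by case: CDa => j; [left|right]; exact: joined_trans j (joined1 eab).
  - by right; exact: joined_refl.
  - by left; exact: joined_refl.
(* Insertion without removal is the exchange whose far side [B] is empty. *)
have -> : \1_(C `|` D) z * \1_(C `|` D) z' -
  \1_C z * \1_C z' - \1_D z * \1_D z' =
  \1_(C `|` D) z * \1_(C `|` D) z' + \1_set0 z * \1_set0 z' -
  \1_(C `|` set0) z * \1_(C `|` set0) z' - \1_D z * \1_D z' :> R.
  by rewrite setU0 indic0 mul0r addr0.
apply: switched_joined => //.
- by move=> u _ [].
- by move=> u [|//] Cu Du; apply: nxy; apply: joined_trans Cu (joined_sym esym Du).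
- move=> a b [Ca|//]; split; first by left; exact: joined_trans Ca _.
  by case=> // Cb; apply: joined_trans Cb; apply: joined_sym.
- move=> a b Da; split; first exact: joined_trans.
  by apply: joined_trans; apply: joined_sym.
- move=> a b CDa; split=> [j|CDb]; first exact: (joined_closed cl CDa j).
  by apply: joined_trans (jCD _ CDb); apply: joined_sym (jCD _ CDa).
- move=> a b na nb; apply/idP/idP => [eab|/e'E[//|/set2_eq[[ax _]|[ay _]]]].
  + by apply/e'E; left.
  + by case: na; left; rewrite ax; exact: joined_refl.
  + by case: na; right; right; rewrite ay; exact: joined_refl.
Qed.

End Merge.

(** * The mass-transport principle *)

Section Nbrs.
Variable G : graph.

Definition nbrs (x : G) : seq G := finmap.enum_fset (fset_set [set y | adj x y]).
(** The closed neighbourhood: including [x] makes the walk lazy and lets a root be compared directly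
    with its neighbours. *)
Definition star (x : G) : seq G := x :: nbrs x.

Lemma nbrs_uniq x : uniq (nbrs x).
Proof. exact: finmap.fset_uniq. Qed.

Hypothesis Glf : locally_finite G.

Lemma mem_nbrs x y : (y \in nbrs x) = adj x y.
Proof.
have -> : (y \in nbrs x) = (y \in [set y | adj x y]) := in_fset_set (Glf x) y.
by apply/idP/idP; rewrite inE.
Qed.

Lemma mem_star x y : (y \in star x) = (y == x) || adj x y.
Proof. by rewrite inE mem_nbrs. Qed.

Lemma star_sym x y : (y \in star x) = (x \in star y).
Proof. by rewrite !mem_star eq_sym adj_sym. Qed.

Lemma star_uniq x : uniq (star x).
Proof. by rewrite /star cons_uniq mem_nbrs adj_irr nbrs_uniq. Qed.

Lemma ball_star (n : nat) (x : G) : exists s : seq G, forall p,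
  path (@adj G) x p -> (size p <= n)%N -> last x p \in s.
Proof.
exists (nb_ball nbrs x n) => p; apply: nb_ballP => u v.
by rewrite mem_nbrs.
Qed.

End Nbrs.

(** * Compactness of vertex stabilisers, countability, orbit representatives *)

Section Aut.
Variable G : graph.
Implicit Types g h : aut G.

Lemma aut_eqP g h : g =1 h -> g = h.
Proof.
case: g h => [g bg ag] [h bh ah] /= /funext gh; subst h.
by rewrite (Prop_irrelevance bg bh) (Prop_irrelevance ag ah).
Qed.

Lemma aut_inv_ex g : exists h : aut G, cancel g h /\ cancel h g.
Proof.
have [h gK hK] := aut_bij g.
have hb : bijective h by exists g.
have ha x y : adj (h x) (h y) = adj x y by rewrite -(aut_adj g) !hK.
by exists (Aut hb ha).
Qed.

Lemma aut_inj g : injective g.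
Proof. by have [h gK hK] := aut_bij g; exact: can_inj gK. Qed.

Lemma mem_star_aut (Glf : locally_finite G) g x y :
  (g y \in star (g x)) = (y \in star x).
Proof. by rewrite !mem_star // aut_adj (inj_eq (@aut_inj g)). Qed.

Lemma star_aut (Glf : locally_finite G) g x : perm_eq (star (g x)) (map g (star x)).
Proof.
apply: uniq_perm; first exact: star_uniq.
  by rewrite map_inj_uniq; [exact: star_uniq|exact: aut_inj].
move=> y; rewrite mem_star //; have [h [gK hK]] := aut_inv_ex g.
apply/idP/mapP => [yg|[z zx ->]].
  exists (h y); last by rewrite hK.
  rewrite mem_star //; case/predU1P: yg => [->|a]; first by rewrite gK eqxx.
  by rewrite -(aut_adj g) hK a orbT.
by move: zx; rewrite mem_star // => /predU1P[->|a]; rewrite ?eqxx // aut_adj a orbT.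
Qed.

Definition carry (x y : G) : set (aut G) := [set g | g x = y].

Lemma carry_open x y : open (carry x y).
Proof.
exists (@proj G (fun=> discrete_topology G) x @^-1` [set y : discrete_topology G]) => //.
by apply: open_comp; [move=> f _; exact: proj_continuous|exact: discrete_open].
Qed.

Lemma carry_measurable x y : measurable (carry x y : set (borel (aut G))).
Proof. by apply: sub_sigma_algebra; exact: carry_open. Qed.

Lemma ultra_finite (T : Type) (V : eqType) (F : set_system T) (f : T -> V) (s : seq V) :
  UltraFilter F -> F [set t | f t \in s] -> exists y, F [set t | f t = y].
Proof.
move=> UF; elim: s => [|a s IH] Fs.
  by have [t] := filter_ex Fs; rewrite /= in_nil.
have [Fa|Fa] := in_ultra_setVsetC [set t | f t = a] UF; first by exists a.
apply: IH; apply: filterS (filterI Fs Fa) => t [] /=.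
by rewrite inE => /predU1P[].
Qed.

Hypothesis Glf : locally_finite G.
Hypothesis Gconn : graph_connected G.

(** Automorphisms fixing [x] keep each vertex in a finite ball, so along an ultrafilter the image of
    each vertex is eventually constant. Inverses are followed too, because a pointwise limit of
    bijections need not be onto by itself. *)
Lemma carry_compact x : compact (carry x x).
Proof.
rewrite compact_ultra => F UF Fx.
have evx (h : aut G -> aut G) : (forall g, cancel g (h g)) -> (forall g, cancel (h g) g) ->
  forall z, exists y, F [set g | g z = y /\ True] /\ exists y', F [set g | h g z = y'].
  move=> gK hK z; have [p pp lp] := Gconn x z.
  have [s hs] := ball_star Glf (size p) x.
  have img (k : aut G) : k x = x -> k z \in s.
    move=> kx; have -> : k z = last x (map k p) by rewrite -lp -(last_map k) kx.
    apply: hs; last by rewrite size_map.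
    by rewrite -{1}kx path_map; apply: sub_path pp => a b; rewrite /= aut_adj.
  have [y Fy] : exists y, F [set g : aut G | g z = y].
    apply: (@ultra_finite _ _ F _ s) => //; apply: filterS Fx => g gx; exact: img.
  exists y; split; first by apply: filterS Fy.
  apply: (@ultra_finite _ _ F _ s) => //; apply: filterS Fx => g gx; apply: img.
  by rewrite -{1}gx gK.
pose h g := projT1 (cid (aut_inv_ex g)).
have gK g : cancel g (h g) by case: (projT2 (cid (aut_inv_ex g))).
have hK g : cancel (h g) g by case: (projT2 (cid (aut_inv_ex g))).
have ev z : exists y, F [set g : aut G | g z = y].
  have [y [Fy _]] := evx h gK hK z; exists y; by apply: filterS Fy => g [].
have ev' z : exists y, F [set g : aut G | h g z = y].
  by have [y [_ Fy]] := evx h gK hK z.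
pose f z := projT1 (cid (ev z)).
have Ff z : F [set g : aut G | g z = f z] := projT2 (cid (ev z)).
pose f' z := projT1 (cid (ev' z)).
have Ff' z : F [set g : aut G | h g z = f' z] := projT2 (cid (ev' z)).
have fK : cancel f f'.
  move=> z; have [g [[/= g1 g2] g3]] := filter_ex (filterI (filterI (Ff z) (Ff' (f z))) (Ff z)).
  by rewrite -g2 -g1 gK.
have f'K : cancel f' f.
  move=> z; have [g [/= g1 g2]] := filter_ex (filterI (Ff' z) (Ff (f' z))).
  by rewrite -g2 -g1 hK.
have fa a b : adj (f a) (f b) = adj a b.
  have [g [/= <- <-]] := filter_ex (filterI (Ff a) (Ff b)); exact: aut_adj.
pose fA : aut G := Aut (Bijective fK f'K) fa.
exists fA; split.
  by have [g [/= gx gf]] := filter_ex (filterI Fx (Ff x)); rewrite /carry /= -gf.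
move=> A [B [[C oC <-] CfA BA]].
suff FC : F (@aut_ptws G @^-1` C) by apply: filterS FC => g; exact: BA.
have cv : {ptws, (@aut_ptws G @ F) --> aut_ptws fA}.
  apply/cvg_sup => z U [W [[D oD <-] Df WU]].
  suff : F (@aut_ptws G @^-1` U) by [].
  apply: (filterS _ (Ff z)) => g /= gz; apply: WU; move: Df; rewrite /aut_ptws /=.
  by rewrite gz.
apply: cv; exact: open_nbhs_nbhs.
Qed.

Lemma graph_countable : countable [set: G].
Proof.
have [x0|nG] := pselect (exists x0 : G, True); last first.
  suff -> : [set: G] = set0 by exact: countable0.
  by rewrite -subset0 => x _; apply: nG; exists x.
have [x _] := x0; pose s n := projT1 (cid (ball_star Glf n x)).
have sP n := projT2 (cid (ball_star Glf n x)).
apply: (@sub_countable _ _ _ (\bigcup_n [set` s n])).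
  apply: subset_card_le => y _; have [p pp lp] := Gconn x y.
  by exists (size p) => //=; rewrite -lp; exact: (sP (size p)).
by apply: bigcup_countable => // n _; apply: finite_set_countable; exact: finite_seq.
Qed.

Definition orbit_reps (reps : seq G) := [/\ uniq reps,
  forall x, exists2 o, o \in reps & exists g : aut G, g o = x
  & forall o o' (g : aut G), o \in reps -> o' \in reps -> g o = o' -> o = o'].

Lemma orbit_reps_ex : quasitransitive G -> exists reps, orbit_reps reps.
Proof.
move=> /finite_seqP[s sE].
have [[x0 _]|nG] := pselect (exists x : G, True); last first.
  by exists [::]; split=> // x; case: nG; exists x.
have rep_ex S : exists x : G, S \in s -> orbit_of x = S.
  have [sS|nS] := boolP (S \in s); last by exists x0.
  have : range (@orbit_of G) S by rewrite sE.
  by case=> x _ <-; exists x.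
pose rep S := projT1 (cid (rep_ex S)).
have repE S : S \in s -> orbit_of (rep S) = S := projT2 (cid (rep_ex S)).
have orb_eq (x y : G) (g : aut G) : g x = y -> orbit_of x = orbit_of y.
  have sub (a b : G) (k : aut G) : k a = b -> orbit_of b `<=` orbit_of a.
    by move=> <- z [h _ <-]; exists (aut_comp h k).
  move=> gx; apply/seteqP; split; last exact: sub gx.
  by have [h [gK hK]] := aut_inv_ex g; apply: (sub _ _ h); rewrite -gx gK.
exists (map rep (undup s)); split.
- rewrite map_inj_in_uniq ?undup_uniq // => S S'.
  by rewrite !mem_undup => /repE {2}<- /repE {2}<- ->.
- move=> x; have os : orbit_of x \in s.
    have : range (@orbit_of G) (orbit_of x) by exists x.
    by rewrite sE.
  exists (rep (orbit_of x)); first by apply: map_f; rewrite mem_undup.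
  have : orbit_of (rep (orbit_of x)) x.
    by rewrite repE //; exists (aut_id G).
  by case=> g _ gx; exists g.
- move=> a b g /mapP[S + ->] /mapP[S' + ->]; rewrite !mem_undup => Ss S's.
  by move=> /orb_eq; rewrite !repE // => ->.
Qed.

End Aut.

Lemma negligible_countable_bigcup d (T : measurableType d) (R : realType)
  (mu : {measure set T -> \bar R}) (U : Type) (F : U -> set T) :
  countable [set: U] -> (forall u, mu.-negligible (F u)) ->
  mu.-negligible (\bigcup_u F u).
Proof.
move=> /countable_injP[f fi] Fn.
pose F' n := \bigcup_(u in [set u | f u = n]) F u.
have -> : \bigcup_u F u = \bigcup_n F' n.
  apply/seteqP; split=> [x [u _ Fx]|x [n _ [u _ Fx]]]; last by exists u.
  by exists (f u) => //; exists u.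
apply: negligible_bigcup => n.
have [[u un]|nu] := pselect (exists u, f u = n).
  suff -> : F' n = F u by [].
  apply/seteqP; split=> [x [v /= vn Fx]|x Fx]; last by exists u.
  by rewrite (fi u v) ?inE // un vn.
suff -> : F' n = set0 by exact: negligible_set0.
by rewrite -subset0 => x [u un _]; apply: nu; exists u.
Qed.

Section MassTransport.
Variables (R : realType) (G : graph).
Hypotheses (Glf : locally_finite G) (Gconn : graph_connected G).
Variable mu : {measure set (borel (aut G)) -> \bar R}.
Hypotheses (muH : left_haar mu) (muR : right_invariant mu).
Implicit Types (g h : aut G) (x y : G).

Let mcarry x y : measurable (carry x y : set (borel (aut G))) := carry_measurable x y.

Lemma carry_left h x y : mu (carry x (h y)) = mu (carry x y).
Proof.
have [_ _ L] := muH; have [k [hK kK]] := aut_inv_ex h.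
rewrite -(L h _ (mcarry x y)); congr (mu _); apply/seteqP; split=> g /=.
  move=> gx; exists (aut_comp k g); first by rewrite /carry /= gx hK.
  by apply: aut_eqP => z /=; rewrite kK.
by move=> [g' g'x <-] /=; rewrite /carry /= g'x.
Qed.

Lemma carry_right h x y : mu (carry (h x) y) = mu (carry x y).
Proof.
have [k [hK kK]] := aut_inv_ex h.
rewrite -(muR h (mcarry (h x) y)); congr (mu _); apply/seteqP; split=> g /=.
  by move=> [g' g'x <-] /=; rewrite /carry /= g'x.
move=> gx; exists (aut_comp g k); first by rewrite /carry /= hK gx.
by apply: aut_eqP => z /=; rewrite hK.
Qed.

Lemma carry_fin x y : (mu (carry x y) < +oo)%E.
Proof.
have [[h hx]|nh] := pselect (exists h : aut G, h x = y).
  rewrite -hx carry_left; have [[K _ _] _ _] := muH.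
  by apply: K; exact: carry_compact.
suff -> : carry x y = set0 by rewrite measure0.
by rewrite -subset0 => g gx; apply: nh; exists g.
Qed.

Definition haar x y : R := fine (mu (carry x y)).

(** The group is a countable union of cosets of the stabiliser; were one null, left invariance would
    make all of them null, and the whole group with them. *)
Lemma haar_pos x : 0 < haar x x.
Proof.
rewrite fine_gt0 // carry_fin andbT lt0e measure_ge0 andbT.
apply/eqP => m0; have [_ /eqP mT _] := muH; apply: mT.
apply/negligibleP; first exact: measurableT.
suff -> : [set: borel (aut G)] = \bigcup_y carry x y.
  apply: negligible_countable_bigcup; first exact: graph_countable.
  move=> y; apply/negligibleP; first exact: mcarry.
  have [[h hx]|nh] := pselect (exists h : aut G, h x = y).
    by rewrite -hx; exact: etrans (carry_left _ _ _) m0.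
  suff -> : carry x y = set0 by rewrite measure0.
  by rewrite -subset0 => g gx; apply: nh; exists g.
by apply/seteqP; split=> // g _; exists (g x).
Qed.

(** Left invariance compares cosets of one stabiliser. The second equality compares stabilisers of
    different vertices of an orbit, and it is here that unimodularity enters the transport. *)
Lemma haar_orbit x y (h : aut G) : h x = y -> haar x y = haar x x /\ haar x y = haar y y.
Proof. by move=> <-; rewrite /haar !carry_left carry_right. Qed.

Lemma haar_not_orbit x y : (forall h : aut G, h x <> y) -> haar x y = 0.
Proof.
move=> nh; rewrite /haar; suff -> : carry x y = set0 by rewrite measure0.
by rewrite -subset0 => g gx; exact: nh gx.
Qed.

Lemma fine_measure_fibers (f : aut G -> G) (A : set (borel (aut G))) (s : seq G) :
  (forall y, measurable ([set g | f g = y] : set (borel (aut G)))) ->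
  measurable A -> (mu A < +oo)%E -> uniq s -> (forall g, A g -> f g \in s) ->
  fine (mu A) = \sum_(y <- s) fine (mu (A `&` [set g | f g = y])).
Proof.
move=> mf.
elim: s A => [|a s IH] A mA Afin.
  move=> _ As; rewrite big_nil; suff -> : A = set0 by rewrite measure0.
  by rewrite -subset0 => g /As.
move=> /= /andP[as_ us] As; rewrite big_cons.
pose fa := [set g | f g = a].
have mAa : measurable (A `&` fa) by apply: measurableI => //; exact: mf.
have mAc : measurable (A `\` fa) by apply: measurableD => //; exact: mf.
have finS B : measurable B -> B `<=` A -> (mu B < +oo)%E.
  by move=> mB BA; apply: le_lt_trans Afin; apply: le_measure => //; rewrite inE.
have -> : \sum_(y <- s) fine (mu (A `&` [set g | f g = y])) = fine (mu (A `\` fa)).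
  rewrite (IH (A `\` fa)) //; last first.
  - by move=> g [/As + nga]; rewrite inE => /predU1P[].
  - by apply: finS => // g [].
  apply: eq_big_seq => y ys; congr (fine (mu _)).
  apply/seteqP; split=> g /= [Ag gy]; last by case: Ag.
  split=> //; split=> // ga; move: as_; by rewrite -ga gy ys.
rewrite -fineD.
- rewrite -measureU //; last by rewrite -subset0 => g [[_ ga] [_ nga]].
  by rewrite setUIDK.
- by rewrite ge0_fin_numE // finS // => g [].
- by rewrite ge0_fin_numE // finS // => g [].
Qed.

Variable reps : seq G.
Hypothesis trep : orbit_reps reps.

Lemma haar_reps_r y : \sum_(o <- reps) haar y o / haar o o = 1.
Proof.
have [ur rx ro] := trep; have [c cr [g go]] := rx y.
rewrite (bigD1_seq c) //= big1_seq ?addr0.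
  have [h [gK hK]] := aut_inv_ex g.
  have hy : h y = c by rewrite -go gK.
  by have [_ ->] := haar_orbit hy; rewrite divff // gt_eqF // haar_pos.
move=> o /andP[oc ors]; rewrite haar_not_orbit ?mul0r // => h hy.
by move/eqP: oc; apply; symmetry; apply: (ro _ _ (aut_comp h g)) => //=; rewrite go.
Qed.

Lemma haar_reps_l y : \sum_(o <- reps) haar o y / haar o o = 1.
Proof.
have [ur rx ro] := trep; have [c cr [g go]] := rx y.
rewrite (bigD1_seq c) //= big1_seq ?addr0.
  by have [-> _] := haar_orbit go; rewrite divff // gt_eqF // haar_pos.
move=> o /andP[oc ors]; rewrite haar_not_orbit ?mul0r // => h hy.
have [k [gK kK]] := aut_inv_ex g.
by move/eqP: oc; apply; apply: (ro _ _ (aut_comp k h)) => //=; rewrite hy -go gK.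
Qed.

(* Double counting of the automorphisms mapping [y] to [o'] and [o] to [y']. *)
Theorem mass_transport (F : G -> G -> R) :
  (forall g x y, F (g x) (g y) = F x y) ->
  \sum_(o <- reps) (haar o o)^-1 * \sum_(y <- star o) F o y =
  \sum_(o <- reps) (haar o o)^-1 * \sum_(y <- star o) F y o.
Proof.
move=> Finv.
pose nu o o' y y' := fine (mu (carry y o' `&` carry o y')).
have nu_r o o' y : y \in star o -> \sum_(y' <- star o') nu o o' y y' = haar y o'.
  move=> yo; rewrite /haar (@fine_measure_fibers (fun g => g o) _ (star o')) //; first last.
  - by move=> g gy; rewrite -gy mem_star_aut // star_sym.
  - exact: star_uniq.
  - exact: carry_fin.
  - by move=> z; exact: mcarry.
have nu_l o o' y' : y' \in star o' -> \sum_(y <- star o) nu o o' y y' = haar o y'.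
  move=> y'o; pose inv_o' (g : aut G) := projT1 (cid (aut_inv_ex g)) o'.
  have inv_fib y : [set g | inv_o' g = y] = carry y o'.
    apply/seteqP; split=> g /=; have [gK hK] := projT2 (cid (aut_inv_ex g)).
      by move=> <-; exact: hK.
    by rewrite /carry /inv_o' /= => <-; exact: gK.
  rewrite /haar (@fine_measure_fibers inv_o' _ (star o)) //; first last.
  - move=> g gy'; have [gK hK] := projT2 (cid (aut_inv_ex g)).
    have gi : g (inv_o' g) = o' := hK o'.
    by rewrite -(mem_star_aut Glf g) gi gy' star_sym.
  - exact: star_uniq.
  - exact: carry_fin.
  - move=> y; suff -> : [set g | inv_o' g = y] = carry y o' by exact: mcarry.
    exact: inv_fib.
  by apply: eq_bigr => y _; rewrite inv_fib setIC.
(* An automorphism counted by [nu] carries the pair (o, y) to (y', o'), where [F] takes the same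
   value; if there is none, both sides vanish. *)
have nuF o o' y y' : F o y * nu o o' y y' = F y' o' * nu o o' y y'.
  have [[g [gy go]]|ng] := pselect (exists g : aut G, g y = o' /\ g o = y').
    by rewrite -(Finv g) gy go.
  rewrite /nu (_ : _ `&` _ = set0) ?measure0 ?mulr0 //.
  by rewrite -subset0 => g [gy go]; apply: ng; exists g.
transitivity (\sum_(o <- reps) \sum_(o' <- reps) (haar o o)^-1 * (haar o' o')^-1 *
   \sum_(y <- star o) \sum_(y' <- star o') F o y * nu o o' y y').
  apply: eq_bigr => o _; rewrite mulr_sumr.
  transitivity (\sum_(y <- star o) \sum_(o' <- reps) (haar o o)^-1 * (haar o' o')^-1 *
     (F o y * haar y o')).
    apply: eq_bigr => y _; rewrite -[in LHS](mulr1 (F o y)) -(haar_reps_r y) !mulr_sumr.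
    by apply: eq_bigr => o' _; ring.
  rewrite exchange_big; apply: eq_bigr => o' _; rewrite -mulr_sumr; congr (_ * _).
  apply: eq_big_seq => y ys; rewrite -(nu_r o o' y ys) mulr_sumr; by [].
rewrite [RHS](eq_bigr (fun o' => \sum_(o <- reps) (haar o o)^-1 * (haar o' o')^-1 *
   \sum_(y' <- star o') F y' o' * haar o y')); last first.
  move=> o' _; rewrite mulr_sumr.
  under [RHS]eq_bigr do rewrite mulr_sumr.
  rewrite exchange_big; apply: eq_bigr => y' _ /=.
  rewrite -[in LHS](mulr1 (F y' o')) -(haar_reps_l y') !mulr_sumr.
  by apply: eq_bigr => o _; ring.
rewrite [RHS]exchange_big; apply: eq_bigr => o _; apply: eq_bigr => o' _.
congr (_ * _); rewrite exchange_big /=; apply: eq_big_seq => y' y's.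
rewrite -(nu_l o o' y' y's) mulr_sumr; apply: eq_bigr => y _; exact: nuF.
Qed.

End MassTransport.

(** * Configurations and events *)

Section Transport.
Variables (V : choiceType) (e e' : rel V) (g h : V -> V).
Hypotheses (gK : cancel g h) (hK : cancel h g).
Hypothesis ge : forall x y, e' (g x) (g y) = e x y.

Let he x y : e (h x) (h y) = e' x y. Proof. by rewrite -ge !hK. Qed.

Lemma path_transport x p : path e' (g x) (map g p) = path e x p.
Proof. by rewrite path_map; apply: eq_path => a b; rewrite /= ge. Qed.

Lemma joined_transport x y : joined e' (g x) (g y) <-> joined e x y.
Proof.
split=> -[p pp lp]; last by exists (map g p); rewrite ?path_transport // last_map lp.
have pE : p = map g (map h p) by rewrite -map_comp map_id_in // => z _ /=; rewrite hK.
exists (map h p); first by rewrite -path_transport -pE.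
by apply: (can_inj gK); rewrite -last_map -pE.
Qed.

Lemma stem_transport v u n : stem e' (g v) (g u) n <-> stem e v u n.
Proof.
have gi := can_inj gK; split=> -[p [sp pp up]].
  have pE : p = map g (map h p) by rewrite -map_comp map_id_in // => z _ /=; rewrite hK.
  exists (map h p); split; first by rewrite size_map.
    by rewrite -path_transport /= -pE.
  by rewrite -(map_inj_uniq gi) /= -pE.
exists (map g p); split; first by rewrite size_map.
  by rewrite -map_cons path_transport.
by rewrite -!map_cons map_inj_uniq.
Qed.

Lemma branch_transport v u : branch e' (g v) (g u) <-> branch e v u.
Proof. by split=> b n; apply/stem_transport. Qed.

Lemma furcation_transport m : furcation e' (g m) <-> furcation e m.
Proof.
have gi := can_inj gK; split=> -[u1 [u2 [u3 [uu b1 b2 b3]]]].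
  exists (h u1), (h u2), (h u3); split; try by apply/branch_transport; rewrite hK.
  by rewrite -(map_inj_uniq gi) /= !hK.
exists (g u1), (g u2), (g u3); split; try exact/branch_transport.
by rewrite -[X in uniq X]/(map g [:: u1; u2; u3]) map_inj_uniq.
Qed.

Lemma minus_transport w x y : minus e' [:: g w] (g x) (g y) = minus e [:: w] x y.
Proof. by rewrite /minus /= ge !inE !(inj_eq (can_inj gK)). Qed.

End Transport.

Lemma side_transport (V : choiceType) (e e' : rel V) (g h : V -> V) v w z :
  cancel g h -> cancel h g -> (forall x y, e' (g x) (g y) = e x y) ->
  side e' (g v) (g w) (g z) <-> side e v w z.
Proof. by move=> gK hK ge; apply: joined_transport => // x y; exact: minus_transport. Qed.

(** * Countable operations on events *)

Section Events.
Context d (T : measurableType d).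
Implicit Types (A B : T -> Prop).

Lemma meas_not A : measurable [set w | A w] -> measurable [set w | ~ A w].
Proof. by move=> mA; rewrite -[X in measurable X]/(~` [set w | A w]); exact: measurableC. Qed.

Lemma meas_and A B : measurable [set w | A w] -> measurable [set w | B w] ->
  measurable [set w | A w /\ B w].
Proof. exact: measurableI. Qed.

Lemma meas_or A B : measurable [set w | A w] -> measurable [set w | B w] ->
  measurable [set w | A w \/ B w].
Proof. exact: measurableU. Qed.

Lemma meas_prop (Q : Prop) : measurable [set w : T | Q].
Proof.
have [q|nq] := pselect Q.
  by rewrite (_ : [set _ | _] = setT) //; apply/seteqP; split.
by rewrite (_ : [set _ | _] = set0) //; apply/seteqP; split.
Qed.

Lemma meas_imp A B : measurable [set w | A w] -> measurable [set w | B w] ->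
  measurable [set w | A w -> B w].
Proof.
move=> mA mB; rewrite (_ : [set w | _] = [set w | ~ A w \/ B w]).
  by apply: meas_or => //; exact: meas_not.
by apply/seteqP; split=> w /=; [move=> h; case: (pselect (A w)); tauto|tauto].
Qed.

Lemma meas_ex (U : Type) (A : U -> T -> Prop) : countable [set: U] ->
  (forall u, measurable [set w | A u w]) -> measurable [set w | exists u, A u w].
Proof.
move=> cU mA; rewrite (_ : [set w | _] = \bigcup_u [set w | A u w]).
  exact: countable_bigcupT_measurable.
by apply/seteqP; split=> w /= [u]; [exists u|exists u].
Qed.

Lemma meas_all (U : Type) (A : U -> T -> Prop) : countable [set: U] ->
  (forall u, measurable [set w | A u w]) -> measurable [set w | forall u, A u w].
Proof.
move=> cU mA; rewrite (_ : [set w | _] = [set w | ~ exists u, ~ A u w]).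
  by apply: meas_not; apply: meas_ex => // u; exact: meas_not.
apply/seteqP; split=> w /=; first by move=> h [u]; apply.
by move=> h u; apply: contrapT => hu; apply: h; exists u.
Qed.

Lemma nat_countable : countable [set: nat]. Proof. exact: countableP. Qed.

End Events.

Lemma seq_countable (U : choiceType) : countable [set: U] -> countable [set: seq U].
Proof.
move=> /countable_injP[f fi]; apply/countable_injP.
exists (fun s => pickle (map f s)) => s t _ _ /(pcan_inj pickleK).
have fi' : injective f by move=> x y; apply: fi; rewrite inE.
exact: inj_map.
Qed.

Section AE.
Context d (T : measurableType d) (R : realType) (P : {measure set T -> \bar R}).

Lemma ae_all (U : Type) (Q : U -> T -> Prop) : countable [set: U] ->
  (forall u, {ae P, forall w, Q u w}) -> {ae P, forall w, forall u, Q u w}.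
Proof.
move=> cU aQ; rewrite /almost_everywhere /=.
have := negligible_countable_bigcup cU aQ.
by apply: negligibleS => w /= nQ; apply: contrapT => h; apply: nQ => u;
  apply: contrapT => hu; apply: h; exists u.
Qed.

Lemma ae_and (Q Q' : T -> Prop) : {ae P, forall w, Q w} -> {ae P, forall w, Q' w} ->
  {ae P, forall w, Q w /\ Q' w}.
Proof. by move=> a b; apply: filterS2 a b => w. Qed.

End AE.

Section Config.
Variable G : graph.
Implicit Types (w : config G) (x y z : G) (g : aut G).

Lemma wadj_sym w : symmetric (wadj w).
Proof. by move=> x y; apply/asboolP/asboolP => -[e we ee]; exists e => //; rewrite setUC. Qed.

Lemma wadj_adj w x y : wadj w x y -> adj x y.
Proof.
move=> /asboolP[[e [a [b [ab eab]]]] /= _]; rewrite eab.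
by move=> /set2_eq[[<- <-]|[<- <-]] //; rewrite adj_sym.
Qed.

Lemma wadj_irr w : irreflexive (wadj w).
Proof.
by move=> x; apply/negP => /wadj_adj; rewrite adj_irr.
Qed.

Lemma edge_inj (e e' : edge G) : sval e = sval e' -> e = e'.
Proof. by case: e e' => [e he] [e' he'] /= ee; subst e'; rewrite (Prop_irrelevance he he'). Qed.

Lemma wadj_edge w (e : edge G) x y : sval e = [set x; y] -> wadj w x y <-> w e.
Proof.
move=> exy; split; last by move=> we; apply/asboolP; exists e.
by move=> /asboolP[e' we' e'xy]; rewrite (@edge_inj e e') // exy e'xy.
Qed.

Lemma edge_image g (e : edge G) : is_edge (g @` sval e).
Proof.
case: e => e /= [x [y [xy ->]]]; exists (g x), (g y); rewrite aut_adj; split=> //.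
by rewrite image_setU !image_set1.
Qed.

Lemma wadj_act g w x y : wadj (act g w) (g x) (g y) = wadj w x y.
Proof.
have gi := @aut_inj _ g.
apply/asboolP/asboolP => [[e' [e we e'e] e'xy]|[e we exy]].
  exists e => //.
  have : g @` sval e = g @` [set x; y] by rewrite -e'e e'xy image_setU !image_set1.
  move=> /seteqP[s1 s2]; apply/seteqP; split=> z ez.
    by have [z' z'xy /gi <-] := s1 (g z) (imageP g ez).
  by have [z' z'e /gi <-] := s2 (g z) (imageP g ez).
exists (exist _ _ (edge_image g e)) => /=; first by exists e.
by rewrite exy image_setU !image_set1.
Qed.

Lemma measurable_wadj x y : measurable [set w : config G | wadj w x y].
Proof.
have [[e exy]|ne] := pselect (exists e : edge G, sval e = [set x; y]).
  rewrite (_ : [set w | _] = [set w : set (edge G) | w e]).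
    by apply: sub_sigma_algebra; exists e.
  by apply/seteqP; split=> w /= /(wadj_edge w exy).
rewrite (_ : [set w | _] = set0) //.
rewrite -subset0 => w /asboolP[e _ exy]; apply: ne; by exists e.
Qed.

Hypothesis Glf : locally_finite G.
Hypothesis Gconn : graph_connected G.

Lemma vertex_countable : countable [set: G]. Proof. exact: graph_countable. Qed.
Lemma vseq_countable : countable [set: seq G].
Proof. exact: seq_countable vertex_countable. Qed.

Section Relation.
Variable r : config G -> rel G.
Hypothesis mr : forall x y, measurable [set w : config G | r w x y].

Lemma measurable_path x p : measurable [set w : config G | path (r w) x p].
Proof.
elim: p x => [|a p IH] x /=; first exact: meas_prop.
rewrite (_ : [set w | _] = [set w | r w x a /\ path (r w) a p]).
  by apply: meas_and.
by apply/seteqP; split=> w /= /andP.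
Qed.

Lemma measurable_joined x y : measurable [set w : config G | joined (r w) x y].
Proof.
rewrite (_ : [set w | _] = [set w | exists p, path (r w) x p /\ last x p = y]).
  apply: meas_ex => [|p]; first exact: vseq_countable.
  by apply: meas_and; [exact: measurable_path|exact: meas_prop].
by apply/seteqP; split=> w /= [p]; [exists p|case=> ? ?; exists p].
Qed.

Lemma measurable_minus S x y : measurable [set w : config G | minus (r w) S x y].
Proof.
rewrite (_ : [set w | _] = [set w | r w x y /\ (x \notin S /\ y \notin S)]).
  by apply: meas_and => //; exact: meas_prop.
by apply/seteqP; split=> w /=; [move=> /and3P[]|move=> [? [? ?]]; apply/and3P].
Qed.

Lemma measurable_branch v u : measurable [set w : config G | branch (r w) v u].
Proof.
apply: meas_all => [|n]; first exact: nat_countable.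
rewrite (_ : [set w | _] = [set w | exists p,
   path (r w) v (u :: p) /\ (size p = n /\ uniq (v :: u :: p))]).
  apply: meas_ex => [|p]; first exact: vseq_countable.
  by apply: meas_and; [exact: measurable_path|exact: meas_prop].
by apply/seteqP; split=> w /= [p]; [case=> ? ? ?|case=> ? [? ?]]; exists p.
Qed.

End Relation.

Lemma measurable_side v u z : measurable [set w : config G | side (wadj w) v u z].
Proof.
apply: measurable_joined => x y; apply: measurable_minus => a b.
exact: measurable_wadj.
Qed.

Lemma measurable_furcation m : measurable [set w : config G | furcation (wadj w) m].
Proof.
have cv := vertex_countable.
apply: meas_ex => // u1; apply: meas_ex => // u2; apply: meas_ex => // u3.
rewrite (_ : [set w | _] = [set w | uniq [:: u1; u2; u3] /\ (branch (wadj w) m u1 /\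
  (branch (wadj w) m u2 /\ branch (wadj w) m u3))]).
  apply: meas_and; first exact: meas_prop.
  by repeat apply: meas_and; apply: measurable_branch => a b; exact: measurable_wadj.
by apply/seteqP; split=> w /=; [case|case=> ? [? [? ?]]].
Qed.

Section Act.
Variables (g : aut G) (w : config G).

Lemma joined_act x y : joined (wadj (act g w)) (g x) (g y) <-> joined (wadj w) x y.
Proof.
have [h [gK hK]] := aut_inv_ex g.
by apply: (joined_transport gK hK) => a b; exact: wadj_act.
Qed.

Lemma branch_act x y : branch (wadj (act g w)) (g x) (g y) <-> branch (wadj w) x y.
Proof.
have [h [gK hK]] := aut_inv_ex g.
by apply: (branch_transport gK hK) => a b; exact: wadj_act.
Qed.

Lemma furcation_act x : furcation (wadj (act g w)) (g x) <-> furcation (wadj w) x.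
Proof.
have [h [gK hK]] := aut_inv_ex g.
by apply: (furcation_transport gK hK) => a b; exact: wadj_act.
Qed.

Lemma side_act x y z : side (wadj (act g w)) (g x) (g y) (g z) <-> side (wadj w) x y z.
Proof.
have [h [gK hK]] := aut_inv_ex g.
by apply: (side_transport _ _ _ gK hK) => a b; exact: wadj_act.
Qed.

End Act.

(** * Measurability of switches and of their images *)

Section Switch.
Variable e : edge G.

Definition setbit (e : edge G) (b : bool) : config G -> config G :=
  fun w => if b then w `|` [set e] else w `\` [set e].

Lemma measurable_setbit b (A : set (config G)) : measurable A ->
  measurable (setbit e b @^-1` A).
Proof.
move=> mA; rewrite -[X in measurable X]setTI.
suff : @measurable_fun _ _ (config G) (config G) setT (setbit e b) by apply.
apply: (@measurability _ _ (config G) (config G) setT (setbit e b) (@edge_cylinders G)) => //.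
move=> _ [_ [e' _ <-] <-]; rewrite setTI.
have [ee|ee] := pselect (e' = e).
  subst e'; case: b.
    by rewrite (_ : _ @^-1` _ = setT) //; apply/seteqP; split=> // w _; right.
  rewrite (_ : _ @^-1` _ = set0) //; rewrite -subset0 => w [_]; exact.
have me' : measurable ([set w : config G | w e']).
  by apply: sub_sigma_algebra; exists e'.
rewrite (_ : _ @^-1` _ = [set w : config G | w e']) //.
apply/seteqP; split=> w /=; rewrite /setbit; case: b => /=; rewrite /setU /setD /=; tauto.
Qed.

(** A configuration is an image exactly when its bit at [e] is [b] and one of the two configurations
    agreeing with it off [e] is in [A]. This writes an image through preimages, which are
    measurable. *)
Lemma setbit_image b (A : set (config G)) : setbit e b @` A =
  [set w | w e <-> b] `&` (setbit e true @^-1` A `|` setbit e false @^-1` A).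
Proof.
have idem (w : config G) (b' : bool) : (w e <-> b') -> setbit e b' w = w.
  move=> wb; apply/seteqP; rewrite /setbit; split=> e'; case: b' wb => /= -[w1 w2].
  - by case=> // ->; exact: w2.
  - by case.
  - by left.
  - by move=> we'; split=> // ee'; subst e'; have := w1 we'.
have comp (w : config G) b1 b2 : setbit e b1 (setbit e b2 w) = setbit e b1 w.
  apply/seteqP; rewrite /setbit; split=> e'; case: b1; case: b2 => /=;
   rewrite /setU /setD /=; have := EM (e' = e); tauto.
have val (w : config G) (b' : bool) : setbit e b' w e <-> b'.
  by rewrite /setbit; case: b'; split=> //; [move=> _; right|move=> [_ /(_ erefl)]].
apply/seteqP; split=> [_ [w Aw <-]|w [wb hw]].
  split; first exact: val.
  have [we|nwe] := pselect (w e).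
    left; suff E : setbit e true (setbit e b w) = w by rewrite /preimage /mkset E.
    by rewrite comp idem.
  right; suff E : setbit e false (setbit e b w) = w by rewrite /preimage /mkset E.
  by rewrite comp idem.
case: hw => hw; [exists (setbit e true w)|exists (setbit e false w)] => //;
  by rewrite comp idem.
Qed.

Lemma measurable_setbit_image b (A : set (config G)) : measurable A ->
  measurable (setbit e b @` A).
Proof.
move=> mA; rewrite setbit_image; apply: measurableI; last first.
  by apply: measurableU; exact: measurable_setbit.
have me : measurable ([set w : config G | w e]).
  by apply: sub_sigma_algebra; exists e.
case: b; first by rewrite (_ : [set w | _] = [set w : config G | w e]) //;
  apply/seteqP; split=> w /=; [case=> _; exact|by move=> ?; split].
rewrite (_ : [set w | _] = ~` [set w : config G | w e]); first exact: measurableC.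
by apply/seteqP; split=> w /=; [move=> [a _] /a|move=> nw; split].
Qed.

End Switch.

Lemma edge_countable : countable [set: edge G].
Proof.
apply/countable_injP; have [f fi] := countable_injP _ vseq_countable.
have ex (e : edge G) : exists s : seq G, sval e = [set` s].
  case: e => e /= [x [y [_ ->]]]; exists [:: x; y].
  by apply/seteqP; split=> z /=; rewrite !inE; [case=> ->; rewrite eqxx ?orbT|
    move=> /orP[]/eqP ->; [left|right]].
exists (fun e => f (projT1 (cid (ex e)))) => e e' _ _ /fi ee'.
apply: edge_inj; rewrite (projT2 (cid (ex e))) (projT2 (cid (ex e'))).
by rewrite ee' ?inE.
Qed.

Lemma option_countable (U : Type) : countable [set: U] -> countable [set: option U].
Proof.
move=> /countable_injP[f fi]; apply/countable_injP.
exists (fun o => if o is Some u then (f u).+1 else 0%N) => -[u|] [v|] _ _ //= [uv].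
by rewrite (fi u v) ?inE.
Qed.

Section SwitchFun.
Variables (e : edge G) (f : config G -> option (edge G)).
Hypothesis mf : forall S : set (option (edge G)), measurable (f @^-1` S).
Let tau w := switch e (f w) w.

Let opt_countable := option_countable edge_countable.

Lemma measurable_switch (A : set (config G)) : measurable A -> measurable (tau @^-1` A).
Proof.
move=> mA; rewrite (_ : tau @^-1` A = [set w | exists c, f w = c /\ A (switch e c w)]).
  apply: meas_ex => // c; apply: meas_and.
    exact: (mf [set c]).
  case: c => [c|]; last exact: (measurable_setbit e true mA).
  exact: (measurable_setbit e true (measurable_setbit c false mA)).
by apply/seteqP; split=> w /=; [move=> h; exists (f w)|move=> [c [<-]]].
Qed.

(** Measurable images are no general fact; here the countably many values of [f] cut the image into
    images under switches of fixed edges. *)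
Lemma measurable_switch_image (A : set (config G)) : measurable A -> measurable (tau @` A).
Proof.
move=> mA; rewrite (_ : tau @` A =
    [set w | exists c, (switch e c @` (A `&` f @^-1` [set c])) w]).
  apply: meas_ex => // c.
  have mAc : measurable (A `&` f @^-1` [set c]) by apply: measurableI.
  case: c mAc => [c|] mAc; last exact: (measurable_setbit_image e true mAc).
  have := measurable_setbit_image c false (measurable_setbit_image e true mAc).
  by rewrite image_comp.
apply/seteqP; split=> w' /=; first by move=> [w Aw <-]; exists (f w), w.
by move=> [c [w [Aw /= <-] <-]]; exists w.
Qed.

End SwitchFun.

End Config.

(** * Random walk functionals *)

Section Functional.
Variables (R : realType) (V : choiceType).
Implicit Types (L M : seq (R * V)) (phi psi : V -> R) (K : V -> V -> R).

(* A finite list of weighted points stands for the functional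
   [phi |-> \sum c * phi z]. *)
Definition ev L phi : R := \sum_(l <- L) l.1 * phi l.2.

Lemma ev_ext L phi psi : phi =1 psi -> ev L phi = ev L psi.
Proof. by move=> h; apply: eq_bigr => l _; rewrite h. Qed.

Lemma evD L phi psi : ev L (fun z => phi z + psi z) = ev L phi + ev L psi.
Proof. by rewrite /ev -big_split /=; apply: eq_bigr => l _; rewrite mulrDr. Qed.

Lemma evB L phi psi : ev L (fun z => phi z - psi z) = ev L phi - ev L psi.
Proof. by rewrite /ev -sumrB; apply: eq_bigr => l _; rewrite mulrBr. Qed.

Lemma evZ L c phi : ev L (fun z => c * phi z) = c * ev L phi.
Proof. by rewrite /ev mulr_sumr; apply: eq_bigr => l _; rewrite mulrCA. Qed.

Lemma evZr L c phi : ev L (fun z => phi z * c) = ev L phi * c.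
Proof. by rewrite mulrC -evZ; apply: ev_ext => z; rewrite mulrC. Qed.

Lemma ev_sum (I : Type) (s : seq I) L (F : I -> V -> R) :
  ev L (fun z => \sum_(i <- s) F i z) = \sum_(i <- s) ev L (F i).
Proof.
rewrite /ev exchange_big; apply: eq_bigr => l _; by rewrite mulr_sumr.
Qed.

Lemma ev_exchange L M K :
  ev L (fun z => ev M (K z)) = ev M (fun z' => ev L (K^~ z')).
Proof.
rewrite /ev; under eq_bigr do rewrite mulr_sumr.
rewrite exchange_big; apply: eq_bigr => m _; rewrite mulr_sumr.
by apply: eq_bigr => l _; rewrite mulrCA.
Qed.

Definition ev2 L M K := ev L (fun z => ev M (K z)).

Definition evdiff L M : seq (R * V) := L ++ [seq (- l.1, l.2) | l <- M].

Lemma ev_evdiff L M phi : ev (evdiff L M) phi = ev L phi - ev M phi.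
Proof.
rewrite /ev /evdiff big_cat big_map /= -sumrN; congr (_ + _).
by apply: eq_bigr => l _; rewrite mulNr.
Qed.

Lemma ev2_sym L M K : (forall z z', K z z' = K z' z) -> ev2 L M K = ev2 M L K.
Proof.
by move=> Ks; rewrite /ev2 ev_exchange; apply: ev_ext => z; apply: ev_ext => z'.
Qed.

Lemma ev2_evdiff L M K : (forall z z', K z z' = K z' z) ->
  ev2 (evdiff L M) (evdiff L M) K = ev2 L L K - 2 * ev2 L M K + ev2 M M K.
Proof.
move=> Ks; rewrite {1}/ev2 (ev_ext _ (fun z => ev_evdiff L M (K z))) ev_evdiff !evB.
rewrite -/(ev2 L L K) -/(ev2 L M K) -/(ev2 M L K) -/(ev2 M M K) (ev2_sym M L Ks).
by ring.
Qed.

Section Classes.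
Variable e : rel V.
Hypothesis esym : symmetric e.

Definition conn (z z' : V) : R := \1_[set y | joined e z y] z'.

Lemma connE z z' : conn z z' = (`[< joined e z z' >])%:R.
Proof. by rewrite /conn indicE -/(in_mem _ _) /in_mem. Qed.

Lemma conn_sym z z' : conn z z' = conn z' z.
Proof.
by rewrite !connE; congr (_%:R); congr nat_of_bool; apply/asboolP/asboolP; exact: joined_sym.
Qed.

Lemma joined_rep (y : V) : exists rho : V -> V, (forall z, joined e z (rho z)) /\
  forall z z', joined e z z' -> rho z = rho z'.
Proof.
exists (fun z => xget y [set z' | joined e z z']); split=> [z|z z' jz].
  exact: (xgetPex y (ex_intro [set z' | joined e z z'] z (joined_refl e z))).
congr xget; apply/seteqP; split=> u /=; apply: joined_trans => //.
exact: joined_sym.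
Qed.

(* Grouping the points by class turns the quadratic form into a sum of squares,
   one of which comes from the class of [y]. *)
Lemma conn_psd L y : (ev L (conn y)) ^+ 2 <= ev2 L L conn.
Proof.
have [rho [rhoP rhoJ]] := joined_rep y.
have rhoE z z' : conn z z' = (rho z == rho z')%:R.
  rewrite connE; congr (_%:R); congr nat_of_bool; apply/asboolP/eqP => [/rhoJ//|rzz].
  apply: joined_trans (rhoP z) _; rewrite rzz; apply: joined_sym => //; exact: rhoP.
pose S := undup (rho y :: [seq rho l.2 | l <- L]).
pose s c := ev L (fun z => (rho z == c)%:R).
have -> : ev2 L L conn = \sum_(c <- S) s c ^+ 2.
  rewrite /ev2 (eq_bigr (fun c => ev L (fun z => (rho z == c)%:R * s c))); last first.
    by move=> c _; rewrite expr2 /s evZr.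
  rewrite -ev_sum; rewrite /ev; apply: eq_big_seq => l lL; congr (_ * _).
  rewrite -/(ev L (conn l.2)) (bigD1_seq (rho l.2)) ?undup_uniq //=; last first.
    by rewrite mem_undup inE; apply/orP; right; apply/mapP; exists l.
  rewrite eqxx mul1r big1 ?addr0; last by move=> c /negbTE; rewrite eq_sym => ->; rewrite mul0r.
  by apply: ev_ext => z; rewrite rhoE eq_sym.
have -> : ev L (conn y) = s (rho y) by apply: ev_ext => z; rewrite rhoE eq_sym.
rewrite (bigD1_seq (rho y)) ?undup_uniq //= ?mem_undup ?mem_head //.
by rewrite lerDl sumr_ge0 // => c _; exact: sqr_ge0.
Qed.

Lemma conn_ge0 L : 0 <= ev2 L L conn.
Proof.
case: L => [|l L]; first by rewrite /ev2 /ev big_nil.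
by apply: le_trans (conn_psd _ l.2); exact: sqr_ge0.
Qed.

End Classes.

End Functional.

Lemma cvg_sum_seq (R : realType) (I : Type) (s : seq I) (f : I -> nat -> R) (l : I -> R) :
  (forall x, f x i @[i --> \oo] --> l x) ->
  \sum_(x <- s) f x i @[i --> \oo] --> \sum_(x <- s) l x.
Proof.
move=> fl; elim: s => [|a s IH].
  by rewrite big_nil; under eq_cvg do rewrite big_nil; exact: cvg_cst.
by rewrite big_cons; under eq_cvg do rewrite big_cons; exact: cvgD.
Qed.

Section Walk.
Variables (R : realType) (G : graph).
Hypothesis Glf : locally_finite G.
Implicit Types (x y z : G) (phi psi : G -> R).

(** Degree plus one, counting the loop of the lazy walk, which is reversible for these weights. *)
Definition deg x : R := (size (star x))%:R.

Fixpoint walk (n : nat) (x : G) : seq (R * G) :=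
  if n is n'.+1 then
    flatten [seq [seq ((deg x)^-1 * l.1, l.2) | l <- walk n' y] | y <- star x]
  else [:: (1, x)].

Lemma deg_gt0 x : 0 < deg x. Proof. by rewrite ltr0n. Qed.
Lemma deg_ge1 x : 1 <= deg x. Proof. by rewrite ler1n. Qed.

Lemma walk0 x phi : ev (walk 0 x) phi = phi x.
Proof. by rewrite /ev big_seq1 mul1r. Qed.

Lemma walkS n x phi :
  ev (walk n.+1 x) phi = (deg x)^-1 * \sum_(y <- star x) ev (walk n y) phi.
Proof.
have -> : walk n.+1 x = flatten
  [seq [seq ((deg x)^-1 * l.1, l.2) | l <- walk n y] | y <- star x] by [].
rewrite /ev big_flatten big_map mulr_sumr; apply: eq_bigr => y _.
by rewrite big_map mulr_sumr; apply: eq_bigr => l _; rewrite /= mulrA.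
Qed.

Lemma walk_le n x phi psi : (forall z, phi z <= psi z) ->
  ev (walk n x) phi <= ev (walk n x) psi.
Proof.
move=> h; elim: n x => [|n IH] x; first by rewrite !walk0.
rewrite !walkS ler_pM2l ?invr_gt0 ?deg_gt0 //.
by apply: ler_sum.
Qed.

Lemma walk_cst n x c : ev (walk n x) (fun=> c) = c.
Proof.
elim: n x => [|n IH] x; first by rewrite walk0.
rewrite walkS (eq_bigr (fun=> c)) // big_const_seq count_predT iter_addr_0.
by rewrite -mulr_natl mulrA mulVf ?mul1r // gt_eqF // deg_gt0.
Qed.

Lemma walk_ge0 n x phi : (forall z, 0 <= phi z) -> 0 <= ev (walk n x) phi.
Proof. by move=> h; rewrite -(walk_cst n x 0); exact: walk_le. Qed.

Lemma deg_aut (g : aut G) x : deg (g x) = deg x.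
Proof. by rewrite /deg (perm_size (star_aut Glf g x)) size_map. Qed.

Lemma walk_aut (g : aut G) n x phi : ev (walk n (g x)) phi = ev (walk n x) (phi \o g).
Proof.
elim: n x => [|n IH] x; first by rewrite !walk0.
rewrite !walkS deg_aut (perm_big _ (star_aut Glf g x)) big_map.
by under eq_bigr do rewrite IH.
Qed.

Lemma walk2_aut (g : aut G) m n x y (K : G -> G -> R) :
  (forall z z', K (g z) (g z') = K z z') ->
  ev2 (walk m (g x)) (walk n (g y)) K = ev2 (walk m x) (walk n y) K.
Proof.
move=> Kg; rewrite /ev2 walk_aut; apply: ev_ext => z /=.
by rewrite walk_aut; apply: ev_ext => z' /=.
Qed.

(* The walk is reversible, so that the total mass of a finite set seen from any
   family of starting points stays bounded. *)
Lemma walk_mass n phi (B : R) : (forall z, 0 <= phi z) ->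
  (forall s : seq G, uniq s -> \sum_(x <- s) deg x * phi x <= B) ->
  forall s : seq G, uniq s -> \sum_(x <- s) deg x * ev (walk n x) phi <= B.
Proof.
move=> p0 pB; elim: n => [|n IH] s us.
  by under eq_bigr do rewrite walk0; exact: pB.
pose U := undup (flatten [seq star x | x <- s]).
apply: le_trans (IH U (undup_uniq _)).
have -> : \sum_(x <- s) deg x * ev (walk n.+1 x) phi =
  \sum_(y <- U) (\sum_(x <- s) (y \in star x)%:R) * ev (walk n y) phi.
  under [RHS]eq_bigr do rewrite mulr_suml.
  rewrite exchange_big; apply: eq_big_seq => x xs.
  rewrite walkS mulrA mulfV ?mul1r ?gt_eqF ?deg_gt0 //.
  rewrite [RHS](bigID (fun y => y \in star x)) /= [X in _ + X]big1 ?addr0; last first.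
    by move=> y /negbTE ->; rewrite mul0r.
  rewrite [RHS](eq_bigr (fun y => ev (walk n y) phi)); last first.
    by move=> y ->; rewrite mul1r.
  rewrite -[RHS]big_filter.
  apply: perm_big; apply: uniq_perm; first exact: star_uniq.
    by rewrite filter_uniq // undup_uniq.
  move=> y; rewrite mem_filter mem_undup.
  case yx: (y \in star x) => //=; symmetry.
  by apply/flattenP; exists (star x) => //; exact: map_f.
apply: ler_sum => y _; apply: ler_wpM2r; first exact: walk_ge0.
rewrite -natr_sum ler_nat /deg.
have -> : (\sum_(x <- s) (y \in star x))%N = size [seq x <- s | x \in star y].
  rewrite size_filter -sum1_count [RHS]big_mkcond /=; apply: eq_bigr => x _.
  by rewrite star_sym //; case: (x \in star y).
apply: uniq_leq_size; first by rewrite filter_uniq.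
by move=> x; rewrite mem_filter => /andP[].
Qed.

(* If the walk from every point charged the finite set [F] with mass at least
   [d] in the limit, the total mass would be infinite. *)
Lemma walk_finite_null (Ginf : infinite_set [set: G]) (t : nat -> nat) (F : seq G) (d : R) :
  (forall x, ev (walk (t i) x) \1_[set` F] @[i --> \oo] --> d) -> d <= 0.
Proof.
move=> cv; rewrite leNgt; apply/negP => d0.
pose B : R := \sum_(z <- undup F) deg z.
have bnd (s : seq G) : uniq s -> \sum_(x <- s) deg x * \1_[set` F] x <= B.
  move=> us; rewrite (eq_bigr (fun x => if x \in F then deg x else 0)); last first.
    move=> x _; rewrite indicE mem_setE; case: ifP => _; by rewrite ?mulr1 ?mulr0.
  rewrite -big_mkcond -big_filter /B.
  rewrite (perm_big [seq x <- undup F | x \in s]) /=; last first.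
    apply: uniq_perm; rewrite ?filter_uniq ?undup_uniq // => x.
    by rewrite !mem_filter mem_undup andbC.
  rewrite big_filter [leRHS](bigID (fun x => x \in s)) /= lerDl.
  by rewrite sumr_ge0 // => x _; exact: ltW (deg_gt0 x).
(* More than [B / d] starting points, each with mass [d] in the limit, will exceed the total [B],
   since every [deg] is at least 1. *)
have [s [us ss]] : exists s : seq G, uniq s /\ B / d < (size s)%:R.
  have [m hm] : exists m : nat, B / d < m%:R.
    exists (Num.bound `|B / d|); apply: le_lt_trans (archi_boundP _) => //.
    exact: ler_norm.
  suff [s [us sm]] : exists s : seq G, uniq s /\ size s = m by exists s; rewrite sm.
  elim: m {hm} => [|m [s [us sm]]]; first by exists [::].
  have [x xs] : exists x, x \notin s.
    apply: contrapT => h; apply: Ginf; apply/finite_seqP; exists s.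
    apply/seteqP; split=> x //= _; apply: contrapT => xs; apply: h; exists x.
    exact/negP.
  by exists (x :: s); rewrite /= xs us sm.
have h : \sum_(x <- s) deg x * d <= B.
  have cs : \sum_(x <- s) deg x * ev (walk (t i) x) \1_[set` F] @[i --> \oo]
      --> \sum_(x <- s) deg x * d.
    by apply: cvg_sum_seq => x; apply: cvgMl_tmp; exact: cv.
  apply: (cvgr_to_le cs); apply: nearW => i; exact: walk_mass.
move: h; apply/negP; rewrite -ltNge; move: ss; rewrite ltr_pdivrMr // => ss.
apply: lt_le_trans ss _; rewrite -mulr_suml ler_pM2r //.
rewrite -[leLHS]mulr1 -sum1_size natr_sum mulr1; apply: ler_sum => x _; exact: deg_ge1.
Qed.

End Walk.

(** * Bounded random variables *)

Section Bounded.
Context d (T : measurableType d) (R : realType) (P : probability T R).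
Implicit Types (X Y : T -> R) (Q : T -> Prop).

Definition bnd X := measurable_fun setT X /\ exists M, forall w, `|X w| <= M.

Definition ind (Q : Prop) : R := (`[< Q >])%:R.

Lemma bnd_cst c : bnd (fun=> c).
Proof. by split; [exact: measurable_cst|exists `|c|]. Qed.

Lemma bndD X Y : bnd X -> bnd Y -> bnd (fun w => X w + Y w).
Proof.
move=> [mX [M hM]] [mY [N hN]]; split; first exact: measurable_funD.
by exists (M + N) => w; apply: le_trans (ler_normD _ _) _; exact: lerD.
Qed.

Lemma bndM X Y : bnd X -> bnd Y -> bnd (fun w => X w * Y w).
Proof.
move=> [mX [M hM]] [mY [N hN]]; split; first exact: measurable_funM.
by exists (M * N) => w; rewrite normrM; apply: ler_pM.
Qed.

Lemma bndZ c X : bnd X -> bnd (fun w => c * X w).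
Proof. by move=> bX; apply: bndM => //; exact: bnd_cst. Qed.

Lemma bndB X Y : bnd X -> bnd Y -> bnd (fun w => X w - Y w).
Proof.
move=> bX bY; have := bndD bX (bndZ (-1) bY).
by congr bnd; apply/funext => w; rewrite mulN1r.
Qed.

Lemma bnd_sum (I : Type) (s : seq I) (F : I -> T -> R) :
  (forall i, bnd (F i)) -> bnd (fun w => \sum_(i <- s) F i w).
Proof.
move=> bF; elim: s => [|a s IH].
  by have := bnd_cst 0; congr bnd; apply/funext => w; rewrite big_nil.
have := bndD (bF a) IH; congr bnd; apply/funext => w; by rewrite big_cons.
Qed.

Lemma ind_indic Q : (fun w => ind (Q w)) = \1_[set w | Q w].
Proof. by apply/funext => w; rewrite indicE -/(in_mem _ _) /in_mem. Qed.

Lemma bnd_ind Q : measurable [set w | Q w] -> bnd (fun w => ind (Q w)).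
Proof.
move=> mQ; split; first by rewrite ind_indic; exact: measurable_indic.
by exists 1 => w; rewrite /ind; case: `[< _ >]; rewrite ?normr1 ?normr0.
Qed.

Lemma bnd_integrable X : bnd X -> P.-integrable setT (EFin \o X).
Proof.
move=> [mX [M hM]]; apply: measurable_bounded_integrable => //.
  by rewrite (le_lt_trans (probability_le1 P measurableT)) ?ltry.
by exists M; split; [exact: num_real|move=> N MN w _; apply: le_trans (ltW MN)].
Qed.

Definition EX X : R := \int[P]_w X w.

Lemma EX_ext X Y : (forall w, X w = Y w) -> EX X = EX Y.
Proof. by move=> h; congr EX; apply/funext. Qed.

Lemma EXD X Y : bnd X -> bnd Y -> EX (fun w => X w + Y w) = EX X + EX Y.
Proof. by move=> /bnd_integrable iX /bnd_integrable iY; exact: RintegralD. Qed.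

Lemma EXB X Y : bnd X -> bnd Y -> EX (fun w => X w - Y w) = EX X - EX Y.
Proof. by move=> /bnd_integrable iX /bnd_integrable iY; exact: RintegralB. Qed.

Lemma EXZ c X : bnd X -> EX (fun w => c * X w) = c * EX X.
Proof. by move=> /bnd_integrable iX; exact: RintegralZl. Qed.

Lemma EX_sum (I : Type) (s : seq I) (F : I -> T -> R) : (forall i, bnd (F i)) ->
  EX (fun w => \sum_(i <- s) F i w) = \sum_(i <- s) EX (F i).
Proof.
move=> bF; elim: s => [|a s IH].
  rewrite big_nil (EX_ext (Y := fun=> 0)) => [|w]; last by rewrite big_nil.
  by rewrite /EX Rintegral_cst // mul0r.
rewrite big_cons -IH -EXD //; last exact: bnd_sum.
by apply: EX_ext => w; rewrite big_cons.
Qed.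

Lemma EX_ind Q : measurable [set w | Q w] -> EX (fun w => ind (Q w)) = fine (P [set w | Q w]).
Proof.
move=> mQ; rewrite /EX ind_indic /Rintegral.
by rewrite integral_indic // setIT.
Qed.

Lemma EX_le X Y : bnd X -> bnd Y -> (forall w, X w <= Y w) -> EX X <= EX Y.
Proof. by move=> /bnd_integrable iX /bnd_integrable iY h; apply: le_Rintegral. Qed.

Lemma EX_ge0 X : (forall w, 0 <= X w) -> 0 <= EX X.
Proof. by move=> h; apply: Rintegral_ge0. Qed.

Lemma EX_markov X eps : bnd X -> (forall w, 0 <= X w) ->
  eps * fine (P [set w | eps <= X w]) <= EX X.
Proof.
move=> bX X0; have mA : measurable [set w | eps <= X w].
  have := bX.1 measurableT [set` `[eps, +oo[] (measurable_itv _).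
  by rewrite setTI; congr measurable; apply/seteqP; split=> w /=; rewrite in_itv /= andbT.
rewrite -EX_ind // -EXZ; last exact: bnd_ind.
apply: EX_le => //; first by apply: bndZ; exact: bnd_ind.
move=> w; rewrite /ind; case: asboolP => [h|_]; by rewrite ?mulr1 ?mulr0.
Qed.

Lemma EX_ae X Y : bnd X -> bnd Y -> {ae P, forall w, X w = Y w} -> EX X = EX Y.
Proof.
move=> bX bY XY; congr fine; apply: ae_eq_integral => //.
- by apply/measurable_EFinP; case: bX.
- by apply/measurable_EFinP; case: bY.
- by apply: filterS XY => w h _ /=; rewrite h.
Qed.

Lemma bnd_norm X : bnd X -> bnd (fun w => `|X w|).
Proof.
move=> [mX [M hM]]; split; first exact: measurableT_comp.
by exists M => w; rewrite normr_id.
Qed.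

Lemma EX_ge0_ae X : bnd X -> {ae P, forall w, 0 <= X w} -> 0 <= EX X.
Proof.
move=> bX X0; rewrite -(EX_ae (bnd_norm bX) bX); first exact: EX_ge0.
by apply: filterS X0 => w h; exact: ger0_norm.
Qed.

Lemma EX_ae0 X : bnd X -> {ae P, forall w, 0 <= X w} -> EX X <= 0 ->
  {ae P, forall w, X w = 0}.
Proof.
move=> bX X0 EX0.
have bN := bnd_norm bX.
have E0 : EX (fun w => `|X w|) <= 0.
  by rewrite (EX_ae bN bX) //; apply: filterS X0 => w h; exact: ger0_norm.
have E0' : EX (fun w => `|X w|) = 0.
  by apply/eqP; rewrite eq_le E0 EX_ge0.
pose Z (w : T) : \bar R := (X w)%:E.
have : {ae P, forall w, setT w -> Z w = 0%E}.
  have mX : measurable_fun setT Z by apply/measurable_EFinP; case: bX.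
  have [h _] := ae_eq_integral_abs P measurableT mX.
  apply: h.
  have iN := bnd_integrable bN.
  rewrite -[LHS](@fineK R); last first.
    by rewrite (_ : (fun x => _) = EFin \o (fun w => `|X w|)) //; exact: integrable_fin_num.
  by rewrite -[X in X%:E]/(EX (fun w => `|X w|)) E0'.
by apply: filterS => w /(_ I) /= [].
Qed.

Lemma EX_dominated (X : nat -> T -> R) : (forall i, bnd (X i)) ->
  (forall i w, `|X i w| <= 1) -> {ae P, forall w, X i w @[i --> \oo] --> (0 : R)} ->
  EX (X i) @[i --> \oo] --> (0 : R).
Proof.
move=> bX X1 X0.
have [] := @dominated_convergence _ T R P setT measurableT
  (fun i w => (X i w)%:E) (cst 0%E) (cst 1%E).
- by move=> i; apply/measurable_EFinP; case: (bX i).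
- exact: measurable_cst.
- apply: filterS X0 => w h _; apply: cvg_EFin; first exact: nearW.
  exact: h.
- exact: (bnd_integrable (bnd_cst 1)).
- by apply: aeW => w i _; rewrite /= lee_fin.
move=> _ _; rewrite integral0 => h.
by move/fine_cvgP: h => [].
Qed.

(** The first Borel-Cantelli lemma; the explicit rate bounds the tail union [U n] by the geometric
    tail 2^-n. *)
Lemma ae_eventually_not (A : nat -> set T) : (forall i, measurable (A i)) ->
  (forall i, (P (A i) <= ((2 ^+ i.+1)^-1)%:E)%E) ->
  {ae P, forall w, exists n, forall i, (n <= i)%N -> ~ A i w}.
Proof.
move=> mA PA.
pose U n := \bigcup_i A (i + n)%N.
have mU n : measurable (U n) by apply: bigcupT_measurable => i.
have PU n : (P (U n) <= ((2 ^+ n)^-1)%:E)%E.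
  apply: le_trans (generalized_Boole_inequality P _ (mU n)) _.
    by move=> i.
  apply: (@le_trans _ _ (\sum_(i <oo) (((2 ^+ n)^-1) / (2 ^ i.+1)%:R)%:E)%E); last first.
    by apply: epsilon_trick0; rewrite invr_ge0 exprn_ge0.
  apply: lee_nneseries; first by move=> i *; exact: measure_ge0.
  move=> i _.
  apply: le_trans (PA _) _; rewrite lee_fin.
  have -> : (i + n).+1 = (n + i.+1)%N by rewrite addnS addnC.
  by rewrite exprD invfM natrX.
exists (\bigcap_n U n); split.
- exact: bigcapT_measurable.
- apply/eqP; rewrite eq_le measure_ge0 andbT; apply/lee_addgt0Pr => eps e0.
  have [n hn] : exists n : nat, ((2 ^+ n)^-1 : R) < eps.
    have [n hn] : exists n : nat, eps^-1 < n%:R.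
      by exists (Num.bound eps^-1); apply: archi_boundP; rewrite invr_ge0 ltW.
    exists n; rewrite invf_plt ?posrE ?exprn_gt0 //; apply: lt_le_trans hn _.
    by rewrite -natrX ler_nat; exact: ltnW (ltn_expl _ _).
  rewrite add0e; apply: (@le_trans _ _ (P (U n))).
    apply: le_measure; rewrite ?inE //; first exact: bigcapT_measurable.
    by move=> w; exact.
  by apply: le_trans (PU n) _; rewrite lee_fin ltW.
- move=> w /= nw n _; apply: contrapT => hn; apply: nw; exists n => i ni Ai.
  by apply: hn; exists (i - n)%N => //; rewrite subnK.
Qed.

Variable V : choiceType.
Implicit Types (L M : seq (R * V)).

Lemma bnd_ev L (F : V -> T -> R) : (forall z, bnd (F z)) -> bnd (fun w => ev L (F^~ w)).
Proof. by move=> bF; apply: bnd_sum => l; exact: bndZ. Qed.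

Lemma EX_ev L (F : V -> T -> R) : (forall z, bnd (F z)) ->
  EX (fun w => ev L (F^~ w)) = ev L (fun z => EX (F z)).
Proof.
move=> bF; rewrite /ev EX_sum; last by move=> l; exact: bndZ.
by apply: eq_bigr => l _; rewrite EXZ.
Qed.

Lemma bnd_ev2 L M (F : V -> V -> T -> R) : (forall z z', bnd (F z z')) ->
  bnd (fun w => ev2 L M (fun z z' => F z z' w)).
Proof.
move=> bF; apply: (bnd_ev L (F := fun z w => ev M (fun z' => F z z' w))) => z.
exact: bnd_ev.
Qed.

Lemma EX_ev2 L M (F : V -> V -> T -> R) : (forall z z', bnd (F z z')) ->
  EX (fun w => ev2 L M (fun z z' => F z z' w)) = ev2 L M (fun z z' => EX (F z z')).
Proof.
move=> bF; rewrite /ev2 (EX_ev L (F := fun z w => ev M (fun z' => F z z' w))).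
  by apply: ev_ext => z; rewrite EX_ev.
by move=> z; exact: bnd_ev.
Qed.

End Bounded.

(** * Frequencies and energies of the components *)

Section Invariant.
Variables (R : realType) (G : graph) (P : probability (config G) R).
Hypotheses (Glf : locally_finite G) (Gconn : graph_connected G).
Variables (reps : seq G) (wt : G -> R).
Hypothesis wt0 : forall x, 0 < wt x.
Hypothesis trep : orbit_reps reps.
Hypothesis mtp : forall F : G -> G -> R, (forall (g : aut G) x y, F (g x) (g y) = F x y) ->
  \sum_(o <- reps) wt o * \sum_(y <- star o) F o y =
  \sum_(o <- reps) wt o * \sum_(y <- star o) F y o.
Hypothesis Pinv : forall (g : aut G) (A : set (config G)), measurable A ->
  P (act g @^-1` A) = P A.
Implicit Types (x y z : G) (w : config G) (g : aut G).

Let vc := vertex_countable Glf Gconn.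

Lemma EX_ind_inv g (Q Q' : config G -> Prop) : measurable [set w | Q w] ->
  measurable [set w | Q' w] -> (forall w, Q' (act g w) <-> Q w) ->
  EX P (fun w => ind R (Q' w)) = EX P (fun w => ind R (Q w)).
Proof.
move=> mQ mQ' QQ'; rewrite !EX_ind // -(Pinv g mQ'); congr (fine (P _)).
by apply/seteqP; split=> w /= /QQ'.
Qed.

Lemma reps_ind (Q : G -> Prop) : (forall g x, Q x -> Q (g x)) ->
  (forall o, o \in reps -> Q o) -> forall x, Q x.
Proof. by move=> Qg Qo x; have [_ /(_ x)[c cr [g <-]] _] := trep; apply: Qg; exact: Qo. Qed.

Lemma sum_wt_le (f : G -> R) (c : R) o : (forall x, 0 <= f x) -> o \in reps ->
  \sum_(o <- reps) wt o * f o <= c -> f o <= c / wt o.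
Proof.
move=> f0 oreps; rewrite (bigD1_seq o) //=; last by case: trep.
move=> h; rewrite ler_pdivlMr // mulrC; apply: le_trans h; rewrite lerDl.
by apply: sumr_ge0 => x _; rewrite mulr_ge0 // ltW.
Qed.

(** * Mass transport excludes flows in components with a furcation *)

Section Flows.
Hypothesis Pforest : random_forest P.
Variable o : config G -> G -> G -> Prop.
Hypothesis mo : forall x y, measurable [set w | o w x y].
Hypothesis oinv : forall g w x y, o (act g w) (g x) (g y) <-> o w x y.
Hypothesis o_one : forall w, acyclic w -> one_way (wadj w) (o w).
Hypothesis o_inh : forall w, acyclic w -> inherited (wadj w) (o w).

Let S w x y := flow (wadj w) (o w) x y.

Let mS x y : measurable [set w : config G | S w x y].
Proof.
rewrite (_ : [set w | _] = [set w : config G | wadj w x y /\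
    (o w x y /\ branch (wadj w) y x)]).
  apply: meas_and; first exact: measurable_wadj.
  by apply: meas_and => //; apply: measurable_branch => // a b; exact: measurable_wadj.
by apply/seteqP; split=> w /=; [case|case=> ? []].
Qed.

Let X x w : R := \sum_(y <- star x) ind R (S w y x) - \sum_(y <- star x) ind R (S w x y).

Let XE x w : X x w = (count (fun u => `[< S w u x >]) (star x))%:R -
  (count (fun u => `[< S w x u >]) (star x))%:R.
Proof.
rewrite /X /ind -!natr_sum -!sum1_count.
rewrite [in RHS]big_mkcond [in X in _ = _ - X]big_mkcond /=.
by congr (_%:R - _%:R); apply: eq_bigr => y _; case: `[< _ >].
Qed.

Let nbS w x y : wadj w x y -> y \in star x.
Proof. by move=> /wadj_adj axy; rewrite mem_star // axy orbT. Qed.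

Let bX x : bnd (X x).
Proof. by apply: bndB; apply: bnd_sum => y; apply: bnd_ind. Qed.

Let X0 x : {ae P, forall w, 0 <= X x w}.
Proof.
apply: filterS Pforest => w aw; rewrite XE subr_ge0 ler_nat.
apply: flow_out_le_in.
- exact: wadj_sym.
- exact: nbS.
- exact: star_uniq.
- exact: o_one.
- exact: o_inh.
Qed.

(** The net inflow [X] is almost surely nonnegative in a forest, and mass transport makes its
    weighted expectation over [reps] vanish. Hence it is almost surely 0 at every vertex, and the
    flow is balanced. *)
Lemma flow_ae : {ae P, forall w, forall x y m,
  furcation (wadj w) m -> flow (wadj w) (o w) x y -> ~ joined (wadj w) x m}.
Proof.
pose p x y := EX P (fun w => ind R (S w x y)).
have pinv g x y : p (g x) (g y) = p x y.
  apply: (EX_ind_inv (g := g)) => // w; rewrite /S /flow.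
  split=> -[h1 h2 h3]; split.
  - by rewrite -(wadj_act g).
  - exact/oinv/h2.
  - exact/(branch_act g).
  - by rewrite wadj_act.
  - exact/oinv.
  - exact/branch_act.
have EE x : EX P (X x) = \sum_(y <- star x) p y x - \sum_(y <- star x) p x y.
  by rewrite EXB ?EX_sum // => *; try apply: bnd_sum => *; exact: bnd_ind.
have E0 x : EX P (X x) <= 0.
  move: x; apply: reps_ind => [g x|r rr].
    suff -> : EX P (X (g x)) = EX P (X x) by [].
    rewrite !EE !(perm_big _ (star_aut Glf g x)) !big_map.
    by congr (_ - _); apply: eq_bigr => y _; exact: pinv.
  have := sum_wt_le (f := fun x => EX P (X x)) (c := 0) _ rr; rewrite mul0r; apply.
    by move=> x; apply: EX_ge0_ae.
  rewrite (eq_bigr (fun o => wt o * \sum_(y <- star o) p y o - wt o * \sum_(y <- star o) p o y)).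
    by rewrite sumrB (mtp pinv) subrr.
  by move=> x _; rewrite EE mulrBr.
have Xz : {ae P, forall w, forall x, X x w = 0}.
  by apply: ae_all => // x; apply: EX_ae0.
apply: filterS2 Xz Pforest => w Xz aw x y m fm fxy.
apply: (@balanced_no_flow _ (wadj w) (@star G)) fm fxy.
- exact: wadj_sym.
- exact: wadj_irr.
- exact: aw.
- exact: nbS.
- exact: star_uniq.
- exact: o_one.
- exact: o_inh.
- move=> v; apply/eqP; rewrite eq_sym -(eqr_nat R) -subr_eq0 -XE; exact/eqP.
Qed.

End Flows.

Definition K w z z' : R := conn R (wadj w) z z'.

Lemma K_ind w z z' : K w z z' = ind R (joined (wadj w) z z').
Proof. by rewrite /K connE. Qed.

Lemma mjoined z z' : measurable [set w : config G | joined (wadj w) z z'].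
Proof. by apply: measurable_joined => // a b; exact: measurable_wadj. Qed.

Lemma bndK z z' : bnd (fun w => K w z z').
Proof. have := bnd_ind R (mjoined z z'); congr bnd; apply/funext => w; by rewrite K_ind. Qed.

Lemma K_sym w z z' : K w z z' = K w z' z.
Proof. apply: conn_sym; exact: wadj_sym. Qed.

Lemma K_act g w z z' : K (act g w) (g z) (g z') = K w z z'.
Proof.
rewrite !K_ind /ind; congr (_%:R); congr nat_of_bool.
by apply/asboolP/asboolP => /joined_act.
Qed.

Definition k z z' : R := EX P (fun w => K w z z').

Lemma k_sym z z' : k z z' = k z' z.
Proof. by apply: EX_ext => w; rewrite K_sym. Qed.

Lemma k_inv g z z' : k (g z) (g z') = k z z'.
Proof.
rewrite /k (EX_ext P (fun w => K_ind w (g z) (g z'))) (EX_ext P (fun w => K_ind w z z')).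
by apply: (EX_ind_inv (g := g)); [exact: mjoined|exact: mjoined|move=> w; exact: joined_act].
Qed.

Lemma EX_K L M : EX P (fun w => ev2 L M (K w)) = ev2 L M k.
Proof. exact: (EX_ev2 P L M bndK). Qed.

Lemma k_ge0 L : 0 <= ev2 L L k.
Proof. by rewrite -EX_K; apply: EX_ge0 => w; apply: conn_ge0; exact: wadj_sym. Qed.

(** The factor [deg] cancels the normalisation of a step, so that exposing one step of either walk
    leaves a plain sum over [star], ready for mass transport. *)
Definition amn m n : R := \sum_(o <- reps) wt o * (deg R o * ev2 (walk R m o) (walk R n o) k).

Lemma walk2Sl m n x y (F : G -> G -> R) :
  deg R x * ev2 (walk R m.+1 x) (walk R n y) F =
  \sum_(z <- star x) ev2 (walk R m z) (walk R n y) F.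
Proof. by rewrite {1}/ev2 walkS mulrA mulfV ?mul1r // gt_eqF // deg_gt0. Qed.

Lemma walk2Sr m n x y :
  deg R y * ev2 (walk R m x) (walk R n.+1 y) k =
  \sum_(z <- star y) ev2 (walk R m x) (walk R n z) k.
Proof.
rewrite ev2_sym; last exact: k_sym.
rewrite walk2Sl; apply: eq_bigr => z _; apply: ev2_sym; exact: k_sym.
Qed.

(** Exposing the first step of one walk gives a sum over pairs (root, neighbour) in which that walk
    starts from the neighbour and the other from the root. Exchanging the roles by mass transport
    hands the step to the other walk. *)
Lemma amn_shift m n j : amn (m + j) n = amn m (n + j).
Proof.
suff h m' n' : amn m'.+1 n' = amn m' n'.+1.
  elim: j n => [|j IH] n; first by rewrite !addn0.
  by rewrite addnS h IH addSnnS.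
rewrite /amn.
under eq_bigr do rewrite walk2Sl.
under [RHS]eq_bigr do rewrite walk2Sr.
apply: (mtp (F := fun x y => ev2 (walk R m' y) (walk R n' x) k)) => g x y.
by apply: walk2_aut => // z z'; exact: k_inv.
Qed.

(** Squared distance, in the seminorm of the kernel [k], between the walk laws at one time from two
    roots; [jump] is its analogue for two times and one root. *)
Definition gap n y y' : R :=
  ev2 (evdiff (walk R n y) (walk R n y')) (evdiff (walk R n y) (walk R n y')) k.

Definition jump m n x : R :=
  ev2 (evdiff (walk R m x) (walk R n x)) (evdiff (walk R m x) (walk R n x)) k.

Lemma gap_aut n g y y' : gap n (g y) (g y') = gap n y y'.
Proof. by rewrite /gap !(ev2_evdiff _ _ k_sym) !(walk2_aut Glf _ _ _ _ (k_inv g)). Qed.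

Lemma jump_aut m n g x : jump m n (g x) = jump m n x.
Proof. by rewrite /jump !(ev2_evdiff _ _ k_sym) !(walk2_aut Glf _ _ _ _ (k_inv g)). Qed.

Lemma sum_jump m n :
  \sum_(o <- reps) wt o * (deg R o * jump m n o) = amn m m - 2 * amn m n + amn n n.
Proof.
rewrite /amn mulr_sumr -sumrB -big_split /=; apply: eq_bigr => x _.
by rewrite /jump ev2_evdiff; [ring|exact: k_sym].
Qed.

(** The variance identity: the mean squared norm minus the squared norm of the mean is half the mean
    squared distance of all pairs, applied to the walk laws from the points of [star o]. *)
Lemma sum_gap n :
  \sum_(o <- reps) wt o * ((2 * deg R o)^-1 *
     \sum_(y <- star o) \sum_(y' <- star o) gap n y y') =
  amn n n - amn n.+1 n.+1.
Proof.
pose q y := ev2 (walk R n y) (walk R n y) k.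
pose b y y' := ev2 (walk R n y) (walk R n y') k.
have -> : amn n n = \sum_(o <- reps) wt o * \sum_(y <- star o) q y.
  have := mtp (F := fun x y => q y) _; rewrite /= => ->; last first.
    by move=> g x y; apply: walk2_aut => // z z'; exact: k_inv.
  apply: eq_bigr => x _; congr (_ * _).
  by rewrite big_const_seq count_predT iter_addr_0 mulr_natl.
rewrite /amn -sumrB; apply: eq_bigr => x _; rewrite -mulrBr; congr (_ * _).
rewrite walk2Sl.
have d0 : deg R x != 0 by rewrite gt_eqF // deg_gt0.
have -> : \sum_(y <- star x) ev2 (walk R n y) (walk R n.+1 x) k =
   (deg R x)^-1 * \sum_(y <- star x) \sum_(y' <- star x) b y y'.
  rewrite mulr_sumr; apply: eq_bigr => y _.
  by rewrite -walk2Sr mulrA mulVf // mul1r.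
have -> : \sum_(y <- star x) \sum_(y' <- star x) gap n y y' =
   2 * deg R x * (\sum_(y <- star x) q y) - 2 * \sum_(y <- star x) \sum_(y' <- star x) b y y'.
  have c (c0 : R) : \sum_(y' <- star x) c0 = deg R x * c0.
    by rewrite big_const_seq count_predT iter_addr_0 mulr_natl.
  rewrite (eq_bigr (fun y => deg R x * q y - 2 * \sum_(y' <- star x) b y y' +
     \sum_(y' <- star x) q y')).
    by rewrite big_split sumrB /= c -!mulr_sumr; ring.
  move=> y _; rewrite (eq_bigr (fun y' => q y - 2 * b y y' + q y')).
    by rewrite big_split sumrB /= c -mulr_sumr.
  by move=> y' _; rewrite /gap ev2_evdiff //; exact: k_sym.
by field.
Qed.

(** Even times turn the mixed term of [sum_jump] into a diagonal value, which is bounded below by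
    the limit of the nonincreasing diagonal; this is the Cauchy property. *)
Lemma amn_even i j : amn (i + i) (j + j) = amn (i + j) (i + j).
Proof. by rewrite !amn_shift; congr amn; rewrite addnC addnA. Qed.

Lemma amn_noninc : {homo (fun n => amn n n) : n m / (n <= m)%N >-> m <= n}.
Proof.
apply/nonincreasing_seqP => n; rewrite -subr_ge0 -sum_gap; apply: sumr_ge0 => x _.
rewrite mulr_ge0 //; first exact: ltW.
apply: mulr_ge0; first by rewrite invr_ge0 mulr_ge0 // ltW // deg_gt0.
by apply: sumr_ge0 => y _; apply: sumr_ge0 => y' _; exact: k_ge0.
Qed.

Lemma amn_ge0 n : 0 <= amn n n.
Proof.
apply: sumr_ge0 => x _; rewrite mulr_ge0 //; first exact: ltW.
by rewrite mulr_ge0 ?k_ge0 // ltW // deg_gt0.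
Qed.

Lemma amn_limit : exists l, (forall n, l <= amn n n) /\
  forall eps, 0 < eps -> exists M, forall n, (M <= n)%N -> amn n n <= l + eps.
Proof.
have cv : cvgn (fun n => amn n n).
  apply: nonincreasing_is_cvgn; first exact: amn_noninc.
  by exists 0 => _ [n _ <-]; exact: amn_ge0.
exists (limn (fun n => amn n n)); split=> [n|eps e0].
  exact: nonincreasing_cvgn_ge amn_noninc cv n.
have : limn (fun n => amn n n) < limn (fun n => amn n n) + eps by rewrite ltrDl.
by move=> /(cvgr_le _ cv)[M _ hM]; exists M => n; exact: hM.
Qed.

Lemma jump_gap_small eps : 0 < eps -> exists M, forall m n, (M <= m)%N -> (M <= n)%N ->
  forall x, jump (m + m) (n + n) x <= eps /\
    forall y, y \in star x -> gap (m + m) x y <= eps.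
Proof.
(* The two summands are the factors lost in the bounds for [jump] and for [gap] on passing from the
   weighted sum to a single representative; the 1 in [C] keeps it positive. *)
move=> e0; pose c o := 2 / wt o + 2 * deg R o / wt o.
have c0 o : 0 <= c o by rewrite addr_ge0 // divr_ge0 ?mulr_ge0 // ltW // deg_gt0.
pose C := 1 + \sum_(o <- reps) c o.
have C0 : 0 < C by rewrite ltr_pwDl // sumr_ge0.
have cC o : o \in reps -> c o <= C.
  move=> ors; rewrite /C (bigD1_seq o) //=; last by case: trep.
  by rewrite addrCA lerDl addr_ge0 // sumr_ge0.
pose e := eps / C; have e0' : 0 < e by rewrite divr_gt0.
have [l [lA /(_ e e0')[M hM]]] := amn_limit.
exists M => m n Mm Mn.
have Mmm : (M <= m + m)%N by rewrite (leq_trans Mm) // leq_addr.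
have Mnn : (M <= n + n)%N by rewrite (leq_trans Mn) // leq_addr.
apply: reps_ind => [g x [hj hg]|o ors].
  rewrite jump_aut; split=> // y yx; have [h [gK hK]] := aut_inv_ex g.
  by rewrite -(hK y) gap_aut hg // -(mem_star_aut Glf g) hK.
have eC : e * C = eps by rewrite /e divfK // gt_eqF.
have w0 := wt0 o; have d1 := deg_ge1 R o; have d0 := deg_gt0 R o.
split.
  have jn0 x : 0 <= deg R x * jump (m + m) (n + n) x.
    by rewrite mulr_ge0 ?k_ge0 // ltW // deg_gt0.
  have le2 : \sum_(o <- reps) wt o * (deg R o * jump (m + m) (n + n) o) <= 2 * e.
    rewrite sum_jump amn_even; have := lA (m + n)%N; have := hM _ Mmm; have := hM _ Mnn.
    by lra.
  have := sum_wt_le jn0 ors le2 => h.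
  apply: (@le_trans _ _ (deg R o * jump (m + m) (n + n) o)).
    by rewrite ler_peMl // k_ge0.
  apply: le_trans h _; rewrite -eC.
  have -> : 2 * e / wt o = e * (2 / wt o) by ring.
  rewrite ler_pM2l //; apply: le_trans (cC o ors); rewrite /c lerDl.
  by rewrite divr_ge0 ?mulr_ge0 // ltW.
move=> y yo.
pose S x := \sum_(y <- star x) \sum_(y' <- star x) gap (m + m) y y'.
have S0 x : 0 <= (2 * deg R x)^-1 * S x.
  apply: mulr_ge0; first by rewrite invr_ge0 mulr_ge0 // ltW // deg_gt0.
  by apply: sumr_ge0 => y1 _; apply: sumr_ge0 => y' _; exact: k_ge0.
have le2 : \sum_(o <- reps) wt o * ((2 * deg R o)^-1 * S o) <= e.
  rewrite sum_gap; have := lA (m + m).+1; have := hM _ Mmm; lra.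
have h := sum_wt_le S0 ors le2.
(* Laziness is used here: [o] belongs to [star o], so the pair (o, y) occurs in the double sum. *)
have gS : gap (m + m) o y <= S o.
  rewrite /S (bigD1_seq o) ?star_uniq ?mem_head //= (bigD1_seq y) ?star_uniq //=.
  rewrite -addrA lerDl addr_ge0 //.
    by apply: sumr_ge0 => y' _; exact: k_ge0.
  by apply: sumr_ge0 => y1 _; apply: sumr_ge0 => y' _; exact: k_ge0.
apply: le_trans gS _.
have : S o <= 2 * deg R o * (e / wt o).
  by rewrite mulrC -ler_pdivrMr ?mulr_gt0 // mulrC.
move=> h2; apply: le_trans h2 _.
have -> : 2 * deg R o * (e / wt o) = e * (2 * deg R o / wt o) by ring.
rewrite -eC ler_pM2l //; apply: le_trans (cC o ors); rewrite /c lerDr.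
by rewrite divr_ge0 // ltW.
Qed.

(** With the threshold 4^-i Markov's inequality leaves probability 2^-(i+1), as the Borel-Cantelli
    lemma requires; the square root 2^-i of the threshold is summable. *)
Definition rate i : R := ((4 ^+ i * 2 ^+ i.+1))^-1.

Definition good_times (t : nat -> nat) := forall i x, jump (t i) (t i.+1) x <= rate i /\
  forall y, y \in star x -> gap (t i) x y <= rate i.

Lemma good_times_ex : exists t, good_times t.
Proof.
have r0 i : 0 < rate i by rewrite invr_gt0 mulr_gt0 // exprn_gt0.
pose M i := projT1 (cid (jump_gap_small (r0 i))).
have MP i := projT2 (cid (jump_gap_small (r0 i))).
(* Partial sums dominate each [M i] and are monotone, so that [s i] and [s i.+1] both exceed [M i];
   the times are then doubled to be even. *)
pose s i := (\sum_(j < i.+1) M j)%N.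
have sM i : (M i <= s i)%N by rewrite /s big_ord_recr leq_addl.
have sS i : (s i <= s i.+1)%N by rewrite {2}/s big_ord_recr leq_addr.
by exists (fun i => s i + s i)%N => i; apply: MP; [exact: sM|exact: (leq_trans (sM i) (sS i))].
Qed.

Lemma ae_rate (X : nat -> config G -> R) : (forall i, bnd (X i)) -> (forall i w, 0 <= X i w) ->
  (forall i, EX P (X i) <= rate i) ->
  {ae P, forall w, exists n, forall i, (n <= i)%N -> X i w < (4 ^+ i)^-1}.
Proof.
move=> bX X0 EXr.
have mA i : measurable [set w | (4 ^+ i)^-1 <= X i w].
  have := (bX i).1 measurableT [set` `[(4 ^+ i)^-1, +oo[] (measurable_itv _).
  by rewrite setTI; congr measurable; apply/seteqP; split=> w /=; rewrite in_itv /= andbT.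
have := @ae_eventually_not _ _ R P (fun i => [set w | (4 ^+ i)^-1 <= X i w]) mA.
have h i : (P [set w | ((4 ^+ i)^-1 <= X i w)%R] <= ((2 ^+ i.+1)^-1)%:E)%E.
  rewrite -[X in (X <= _)%E]fineK; last exact: fin_num_measure.
  rewrite lee_fin; have := EX_markov P (4 ^+ i)^-1 (bX i) (X0 i) => mk.
  by have := le_trans mk (EXr i); rewrite /rate invfM ler_pM2l.
move=> /(_ h); apply: filterS => w [n hn]; exists n => i ni; rewrite ltNge.
by apply/negP; exact: hn.
Qed.

Lemma cvg_ext (u v : nat -> R) (l : R) : (forall i, u i = v i) ->
  v i @[i --> \oo] --> l -> u i @[i --> \oo] --> l.
Proof. by move=> /funext ->. Qed.

Lemma cvg_geometric_steps (u : nat -> R) n : (forall i, `|u i| <= 1) ->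
  (forall i, (n <= i)%N -> `|u i.+1 - u i| <= (2 ^+ i)^-1) ->
  exists l : R, u i @[i --> \oo] --> l.
Proof.
(* The subtracted term is the whole geometric tail of the remaining steps, which makes [v]
   nondecreasing. *)
move=> u1 du; pose v i := u (i + n)%N - 2 * (2 ^+ (i + n))^-1.
have vn : {homo v : i j / (i <= j)%N >-> i <= j}.
  apply/nondecreasing_seqP => i; rewrite /v addSn.
  have := du (i + n)%N (leq_addl _ _); rewrite ler_norml => /andP[h _].
  have -> : (2 ^+ (i + n).+1)^-1 = (2 ^+ (i + n))^-1 / 2 :> R.
    by rewrite exprS invfM mulrC.
  lra.
have cvv : cvgn v.
  apply: nondecreasing_is_cvgn => //; exists 1 => _ [i _ <-].
  have := u1 (i + n)%N; rewrite ler_norml => /andP[_ h].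
  have : 0 <= (2 ^+ (i + n))^-1 :> R by rewrite invr_ge0 exprn_ge0.
  by rewrite /v; lra.
have pc : 2 * (2 ^+ (i + n))^-1 @[i --> \oo] --> (2 * 0 : R).
  apply: cvgMl_tmp.
  have g0 : (2^-1 : R) ^+ i @[i --> \oo] --> (0 : R).
    by apply: cvg_expr; rewrite ger0_norm ?invr_ge0 // invf_lt1 // ltr1n.
  by move: g0; rewrite -(cvg_shiftn n); under [X in _ -> X]eq_cvg do rewrite -exprVn.
exists (limn v); rewrite -(cvg_shiftn n).
have h := cvgD cvv pc; rewrite mulr0 addr0 in h.
suff -> : [sequence u (i + n)%N]_i = (fun i => v i + 2 / 2 ^+ (i + n)) by exact: h.
by apply/funext => i; rewrite /v subrK.
Qed.

(** * Existence, positivity and energy of the component densities *)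

Section Frequency.
Variable t : nat -> nat.
Hypothesis tgood : good_times t.

Definition freq w z x i : R := ev (walk R (t i) x) (K w z).

Lemma K_bounds w z z' : 0 <= K w z z' <= 1.
Proof. by rewrite K_ind /ind; case: `[< _ >]; rewrite /= ?lexx ?ler01. Qed.

Lemma freq_bounds w z x i : 0 <= freq w z x i <= 1.
Proof.
apply/andP; split; first by apply: walk_ge0 => // z'; case/andP: (K_bounds w z z').
rewrite -(walk_cst (t i) x 1); apply: walk_le => // z'; by case/andP: (K_bounds w z z').
Qed.

Lemma bnd_freq z x i : bnd (fun w => freq w z x i).
Proof. exact: (bnd_ev (walk R (t i) x) (F := fun z' w => K w z z') (bndK z)). Qed.

Lemma sqr_small (a : R) i : a ^+ 2 < (4 ^+ i)^-1 -> `|a| <= (2 ^+ i)^-1.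
Proof.
move=> h; rewrite -ler_sqr ?nnegrE ?invr_ge0 ?exprn_ge0 // real_normK ?num_real //.
apply: le_trans (ltW h) _; rewrite exprVn -exprM mulnC exprM.
have -> : (2 : R) ^+ 2 = 4 by rewrite -natrX.
by [].
Qed.

(** By [conn_psd], changes of a frequency in time, or between neighbouring roots, are at most the
    square root of a quadratic form that does not involve [z]. Summability gives the limits, and
    connectedness of [G] their independence of the root. *)
Lemma freq_cvg_ae : {ae P, forall w, forall z, exists a : R, forall x,
  freq w z x i @[i --> \oo] --> a}.
Proof.
have J : {ae P, forall w, forall x, exists n, forall i, (n <= i)%N ->
   ev2 (evdiff (walk R (t i) x) (walk R (t i.+1) x))
       (evdiff (walk R (t i) x) (walk R (t i.+1) x)) (K w) < (4 ^+ i)^-1}.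
  apply: ae_all => // x; apply: ae_rate => i.
  - exact: (bnd_ev2 _ _ bndK).
  - by move=> w; apply: conn_ge0; exact: wadj_sym.
  - by rewrite EX_K; case: (tgood i x).
have D : {ae P, forall w, forall x y, y \in star x -> exists n, forall i, (n <= i)%N ->
   ev2 (evdiff (walk R (t i) x) (walk R (t i) y))
       (evdiff (walk R (t i) x) (walk R (t i) y)) (K w) < (4 ^+ i)^-1}.
  apply: ae_all => // x; apply: ae_all => // y.
  have [yx|nyx] := boolP (y \in star x); last by apply: aeW.
  have h : {ae P, forall w, exists n, forall i, (n <= i)%N ->
    ev2 (evdiff (walk R (t i) x) (walk R (t i) y))
       (evdiff (walk R (t i) x) (walk R (t i) y)) (K w) < (4 ^+ i)^-1}.
    apply: ae_rate => i.
    - exact: (bnd_ev2 _ _ bndK).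
    - by move=> w; apply: conn_ge0; exact: wadj_sym.
    - by rewrite EX_K; case: (tgood i x) => _; apply.
  by apply: filterS h => w h _.
apply: filterS2 J D => w J D z.
have ex x : exists a : R, freq w z x i @[i --> \oo] --> a.
  have [n hn] := J x; apply: (@cvg_geometric_steps _ n) => i.
    have /andP[f0 f1] := freq_bounds w z x i; by rewrite ger0_norm.
  move=> ni; rewrite distrC; apply: sqr_small; apply: le_lt_trans (hn i ni).
  rewrite /freq -ev_evdiff; apply: conn_psd; exact: wadj_sym.
have [[x0 _]|nG] := pselect (exists x : G, True); last by exists 0 => x; case: nG; exists x.
have [a ha] := ex x0; exists a => x.
suff step y y' : y' \in star y -> freq w z y i @[i --> \oo] --> a ->
    freq w z y' i @[i --> \oo] --> a.
  apply: (joined_closed (Z := fun y => freq w z y i @[i --> \oo] --> a) _ ha (Gconn x0 x)).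
  by move=> b c hb bc; apply: step hb; rewrite mem_star // bc orbT.
move=> yy' hy; have [n hn] := D y y' yy'; have [a' ha'] := ex y'.
suff -> : a = a' by [].
apply/eqP; rewrite -subr_eq0; apply/eqP.
have c1 : freq w z y i - freq w z y' i @[i --> \oo] --> a - a' by exact: cvgB.
have c2 : freq w z y i - freq w z y' i @[i --> \oo] --> (0 : R).
  apply/norm_cvg0P.
  apply: (@squeeze_cvgr _ _ _ _ (fun=> 0) (fun i => (2 ^+ i)^-1)).
  - exists n => // i ni /=; rewrite normr_ge0 /=; apply: sqr_small.
    apply: le_lt_trans (hn i ni); rewrite /freq -ev_evdiff; apply: conn_psd; exact: wadj_sym.
  - exact: cvg_cst.
  - under eq_cvg do rewrite -exprVn.
    by apply: cvg_expr; rewrite ger0_norm ?invr_ge0 // invf_lt1 // ltr1n.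
exact: (cvg_unique _ c1 c2).
Qed.

Definition fincomp w := exists s : seq G, forall y, exists2 z, z \in s & joined (wadj w) z y.

(** Convergence of the frequencies to 0 from every root, written with countable quantifiers for
    measurability. *)
Definition nullc w z := forall x (j : nat), exists N : nat, forall i, (N <= i)%N ->
  freq w z x i < (j.+1%:R)^-1.

Lemma freq_act g w z x i : freq (act g w) (g z) (g x) i = freq w z x i.
Proof. by rewrite /freq walk_aut //; apply: ev_ext => z' /=; exact: K_act. Qed.

Lemma fincomp_act g w : fincomp w -> fincomp (act g w).
Proof.
move=> [s hs]; exists (map g s) => y; have [h [gK hK]] := aut_inv_ex g.
have [z zs jz] := hs (h y); exists (g z); first exact: map_f.
by rewrite -(hK y); apply/joined_act.
Qed.

Lemma act_cancel g (h : aut G) w : cancel g h -> cancel h g -> act h (act g w) = w.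
Proof.
move=> gK hK; have im (A : set G) : h @` (g @` A) = A.
  apply/seteqP; split=> z; first by move=> [_ [u Au <-] <-]; rewrite gK.
  by move=> Az; exists (g z); [exists z|rewrite gK].
apply/seteqP; split=> e.
  move=> [e1 [e2 we2 e12] e1e]; suff -> : e = e2 by [].
  by apply: edge_inj; rewrite e1e e12 im.
move=> we; exists (exist _ _ (edge_image g e)); first by exists e.
by rewrite /= im.
Qed.

Lemma fincompE g w : fincomp (act g w) <-> fincomp w.
Proof.
split; last exact: fincomp_act.
have [h [gK hK]] := aut_inv_ex g.
by move=> /(fincomp_act h); rewrite act_cancel.
Qed.

Lemma nullcE g w z : nullc (act g w) (g z) <-> nullc w z.
Proof.
have [h [gK hK]] := aut_inv_ex g; split=> nz x j.
  have [N hN] := nz (g x) j; exists N => i Ni; by rewrite -(freq_act g) hN.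
have [N hN] := nz (h x) j; exists N => i Ni; by rewrite -(hK x) freq_act hN.
Qed.

Lemma mfincomp : measurable [set w | fincomp w].
Proof.
apply: meas_ex; first exact: vseq_countable.
move=> s; apply: meas_all => // y.
rewrite (_ : [set w | _] = [set w : config G | exists z, z \in s /\ joined (wadj w) z y]).
  by apply: meas_ex => // z; apply: meas_and; [exact: meas_prop|exact: mjoined].
by apply/seteqP; split=> w /= [z]; [exists z|case; exists z].
Qed.

Lemma meas_lt (X : config G -> R) c : bnd X -> measurable [set w | X w < c].
Proof.
move=> [mX _]; have := mX measurableT [set` `]-oo, c[] (measurable_itv _).
by rewrite setTI; congr measurable; apply/seteqP; split=> w /=; rewrite in_itv.
Qed.

Lemma meas_le (X : config G -> R) c : bnd X -> measurable [set w | X w <= c].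
Proof.
move=> [mX _]; have := mX measurableT [set` `]-oo, c]] (measurable_itv _).
by rewrite setTI; congr measurable; apply/seteqP; split=> w /=; rewrite in_itv.
Qed.

Lemma meas_eventually (A : nat -> config G -> Prop) : (forall i, measurable [set w | A i w]) ->
  measurable [set w | exists N : nat, forall i, (N <= i)%N -> A i w].
Proof.
move=> mA; apply: meas_ex; first exact: nat_countable.
move=> N; apply: meas_all; first exact: nat_countable.
by move=> i; apply: meas_imp; first exact: meas_prop.
Qed.

Lemma mnullc z : measurable [set w | nullc w z].
Proof.
apply: meas_all => // x; apply: meas_all; first exact: nat_countable.
move=> j; apply: meas_eventually => i; apply: meas_lt; exact: bnd_freq.
Qed.

Lemma nullc_cvg w z x : nullc w z -> freq w z x i @[i --> \oo] --> (0 : R).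
Proof.
move=> nz; apply/cvgr0Pnorm_lt => eps e0.
have [j hj] : exists j : nat, (j.+1%:R)^-1 < eps.
  exists (Num.bound eps^-1); rewrite invf_plt ?posrE ?ltr0n //.
  apply: lt_le_trans (archi_boundP _) _; first by rewrite invr_ge0 ltW.
  by rewrite ler_nat.
have [N hN] := nz x j; exists N => // i /= Ni.
have /andP[f0 _] := freq_bounds w z x i; rewrite ger0_norm //.
exact: lt_trans (hN i Ni) hj.
Qed.

Let null_ev w z := fincomp w /\ nullc w z.

Let mnull z : measurable [set w | null_ev w z].
Proof. by apply: meas_and; [exact: mfincomp|exact: mnullc]. Qed.

Let h z := EX P (fun w => ind R (null_ev w z)).

Let h_inv g z : h (g z) = h z.
Proof. by apply: (EX_ind_inv (g := g)) => // w; rewrite /null_ev fincompE nullcE. Qed.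

(** By mass transport the weights [wt o * deg o] are stationary for the walk seen on orbits, and
    [phi] depends on the orbit only. *)
Lemma walk_stationary n (phi : G -> R) : (forall g z, phi (g z) = phi z) ->
  \sum_(o <- reps) wt o * (deg R o * ev (walk R n o) phi) =
  \sum_(o <- reps) wt o * (deg R o * phi o).
Proof.
move=> pinv; elim: n => [|n IH]; first by under eq_bigr do rewrite walk0.
rewrite -IH (eq_bigr (fun o => wt o * \sum_(y <- star o) ev (walk R n y) phi)); last first.
  by move=> x _; rewrite walkS mulVKf // gt_eqF // deg_gt0.
rewrite (mtp (F := fun x y => ev (walk R n y) phi)); last first.
  by move=> g x y; rewrite walk_aut //; apply: ev_ext => z /=; rewrite pinv.
by apply: eq_bigr => x _; rewrite big_const_seq count_predT iter_addr_0 mulr_natl.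
Qed.

Lemma sum_seq_ge (T : eqType) (s : seq T) (f : T -> R) a : (forall b, 0 <= f b) ->
  a \in s -> f a <= \sum_(y <- s) f y.
Proof.
move=> f0 xs; rewrite (perm_big _ (perm_to_rem xs)) big_cons lerDl.
by apply: sumr_ge0.
Qed.

Lemma freq_joined w z z' x i : joined (wadj w) z z' -> freq w z x i = freq w z' x i.
Proof.
move=> jz; apply: ev_ext => y; rewrite !K_ind /ind; congr (_%:R); congr nat_of_bool.
apply/asboolP/asboolP; apply: joined_trans => //.
by apply: joined_sym => //; exact: wadj_sym.
Qed.

Lemma nullc_joined w z z' : joined (wadj w) z z' -> nullc w z' -> nullc w z.
Proof.
by move=> jz nz x j; have [N hN] := nz x j; exists N => i /hN; rewrite (freq_joined _ _ jz).
Qed.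

Let Y o i w := ev (walk R (t i) o) (fun z => ind R (null_ev w z)).

Let ind01 (Q : Prop) : 0 <= ind R Q <= 1.
Proof. by rewrite /ind; case: `[< Q >]; rewrite /= ?lexx ?ler01. Qed.

Let Y0 o i w : 0 <= Y o i w.
Proof. by apply: walk_ge0 => // z; case/andP: (ind01 (null_ev w z)). Qed.

(** With finitely many components, the mass in null components is at most a finite sum of
    frequencies, each tending to 0. *)
Let Y_cvg o w : Y o i w @[i --> \oo] --> (0 : R).
Proof.
have [fc|nf] := pselect (fincomp w); last first.
  have E i : Y o i w = 0.
    rewrite /Y (ev_ext _ (psi := fun=> 0)) ?walk_cst // => z.
    by rewrite /ind asboolF // => -[].
  by apply: (cvg_ext E); exact: cvg_cst.
have [s hs] := fc.
have sc : \sum_(z <- s) ind R (nullc w z) * freq w z o i @[i --> \oo] -->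
    \sum_(z <- s) (0 : R).
  apply: cvg_sum_seq => z; have [nz|nz] := pselect (nullc w z).
    apply: (cvg_ext (v := freq w z o)); last exact: nullc_cvg.
    by move=> i; rewrite /ind asboolT // mul1r.
  apply: (cvg_ext (v := fun=> 0)); last exact: cvg_cst.
  by move=> i; rewrite /ind asboolF // mul0r.
rewrite big1 // in sc.
apply: (squeeze_cvgr _ (cvg_cst 0) sc); apply: nearW => i; rewrite Y0 /=.
rewrite [leRHS](_ : _ = ev (walk R (t i) o) (fun y => \sum_(z <- s) ind R (nullc w z) * K w z y)).
  apply: walk_le => // y; have [ny|ny] := pselect (null_ev w y); last first.
    rewrite {1}/ind asboolF //; apply: sumr_ge0 => z _; apply: mulr_ge0.
      by case/andP: (ind01 (nullc w z)).
    by case/andP: (K_bounds w z y).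
  have [z zs jz] := hs y.
  apply: le_trans (sum_seq_ge (f := fun z => ind R (nullc w z) * K w z y) _ zs).
    rewrite {1 2}/ind (asboolT ny) asboolT ?mul1r ?K_ind /ind ?asboolT //.
    by apply: nullc_joined jz _; case: ny.
  move=> z'; apply: mulr_ge0; first by case/andP: (ind01 (nullc w z')).
  by case/andP: (K_bounds w z' y).
by rewrite ev_sum; apply: eq_bigr => z _; rewrite evZ.
Qed.

(** The probability that the walk ends in a null component tends to 0 by dominated convergence,
    while its weighted average over [reps] is constant in time by stationarity. Hence it is 0
    already at time 0. *)
Lemma not_null_ae : {ae P, forall w, forall z, fincomp w -> ~ nullc w z}.
Proof.
have bY o i : bnd (Y o i).
  by apply: (bnd_ev _ (F := fun z w => ind R (null_ev w z))) => z; exact: bnd_ind.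
have EY o i : EX P (Y o i) = ev (walk R (t i) o) h.
  by apply: (EX_ev P _ (F := fun z w => ind R (null_ev w z))) => z; exact: bnd_ind.
have cY o : ev (walk R (t i) o) h @[i --> \oo] --> (0 : R).
  apply: (cvg_ext (v := fun i => EX P (Y o i))) => [i|]; first by rewrite EY.
  apply: (@EX_dominated _ _ R P (Y o) (bY o)); last by apply: aeW => w; exact: Y_cvg.
  move=> i w; rewrite ger0_norm // -(walk_cst (t i) o 1); apply: walk_le => // z.
  by case/andP: (ind01 (null_ev w z)).
have S0 : \sum_(o <- reps) wt o * (deg R o * h o) = 0.
  have c1 : \sum_(o <- reps) wt o * (deg R o * ev (walk R (t i) o) h) @[i --> \oo] -->
     \sum_(o <- reps) wt o * (deg R o * 0).
    by apply: cvg_sum_seq => o; apply: cvgMl_tmp; apply: cvgMl_tmp; exact: cY.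
  have c2 : \sum_(o <- reps) wt o * (deg R o * ev (walk R (t i) o) h) @[i --> \oo] -->
     \sum_(o <- reps) wt o * (deg R o * h o).
    apply: (cvg_ext (v := fun=> \sum_(o <- reps) wt o * (deg R o * h o))); last exact: cvg_cst.
    by move=> i; apply: walk_stationary => g z; exact: h_inv.
  rewrite (cvg_unique _ c2 c1) //.
  by apply: big1 => o _; rewrite !mulr0.
have h0 z : 0 <= h z by apply: EX_ge0 => w; case/andP: (ind01 (null_ev w z)).
have hz z : h z <= 0.
  move: z; apply: reps_ind => [g z|o ors]; first by rewrite h_inv.
  have := sum_wt_le (f := fun o => deg R o * h o) (c := 0) _ ors; rewrite S0 mul0r => hh.
  have : deg R o * h o <= 0.
    by apply: hh => // z; rewrite mulr_ge0 // ltW // deg_gt0.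
  by rewrite pmulr_rle0 // deg_gt0.
apply: ae_all => // z.
have : {ae P, forall w, ind R (null_ev w z) = 0}.
  apply: EX_ae0 (hz z); first exact: bnd_ind.
  by apply: aeW => w; case/andP: (ind01 (null_ev w z)).
apply: filterS => w; rewrite /ind; case: asboolP => [_ /eqP|nn _ fw nw].
  by rewrite oner_eq0.
by apply: nn.
Qed.

Lemma freq_pos_ae : {ae P, forall w, fincomp w -> forall z (a : R),
  (forall x, freq w z x i @[i --> \oo] --> a) -> 0 < a}.
Proof.
apply: filterS not_null_ae => w nn fw z a ca.
have a0 : 0 <= a.
  apply: (cvgr_to_ge (ca z)); apply: nearW => i.
  by case/andP: (freq_bounds w z z i).
rewrite lt_neqAle a0 andbT; apply/eqP => az; apply: (nn z fw) => x j.
have := ca x; rewrite -az => c0.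
have j0 : 0 < (j.+1%:R : R)^-1 by rewrite invr_gt0 ltr0n.
by have [N _ hN] := cvgr_lt _ c0 _ j0; exists N => i; exact: hN.
Qed.

Definition energy w x i : R := ev2 (walk R (t i) x) (walk R (t i) x) (K w).

Definition energy_le w (q : R) := forall x, exists N : nat, forall i, (N <= i)%N ->
  energy w x i <= q.

Lemma energy_le_ae : (forall A : set (config G), measurable A ->
     (forall g : aut G, act g @^-1` A = A) -> P A = 0%E \/ P A = 1%E) ->
  exists S : rat -> Prop, {ae P, forall w, forall q : rat, energy_le w (ratr q) <-> S q}.
Proof.
move=> erg; exists (fun q => P [set w | energy_le w (ratr q)] = 1%E).
apply: ae_all; first exact: countableP.
move=> q; set A := [set w | energy_le w (ratr q)].
have mA : measurable A.
  apply: meas_all => // x; apply: meas_eventually => i; apply: meas_le.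
  exact: (bnd_ev2 _ _ bndK).
have eact g w x i : energy (act g w) (g x) i = energy w x i.
  rewrite /energy /ev2 walk_aut //; apply: ev_ext => z /=; rewrite walk_aut //.
  by apply: ev_ext => z' /=; exact: K_act.
have inv g : act g @^-1` A = A.
  have [g' [gK hK]] := aut_inv_ex g; apply/seteqP; split=> w /= wq x.
    by have [N hN] := wq (g x); exists N => i Ni; rewrite -(eact g) hN.
  by have [N hN] := wq (g' x); exists N => i Ni; rewrite -(hK x) eact hN.
have [PA|PA] := erg A mA inv.
  exists A; split=> // w /= nw; apply: contrapT => nA; apply: nw; split=> // P1.
  by move: P1; rewrite PA => /eqP; rewrite eq_sym onee_eq0.
exists (~` A); split; first exact: measurableC.
  by have := probability_setC P mA; rewrite PA subee.
by move=> w /= nw wA; apply: nw; split.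
Qed.

End Frequency.

End Invariant.

(** * Switching an edge of a typical configuration *)

Section Endgame.
Variables (R : realType) (G : graph) (t : nat -> nat) (S : rat -> Prop).
Hypotheses (Glf : locally_finite G) (Ginf : infinite_set [set: G]).
Implicit Types (x y z m : G) (A B N : set G) (w : config G).

Definition mass A x i : R := ev (walk R (t i) x) \1_A.

Definition density A (a : R) := forall x, mass A x i @[i --> \oo] --> a.

(** Stated through an eventual positive gap of masses rather than through densities: it is then
    measurable and meaningful also for sides without a density. *)
Definition lighter w v u := forall x, exists j N : nat, forall i, (N <= i)%N ->
  mass (side (wadj w) v u) x i + (j.+1%:R)^-1 <= mass (side (wadj w) u v) x i.

(** The second clause makes the orientation one-way: the furcation lies on one of the two sides, so
    not both can be barren. *)
Definition barren w v u := (forall m, side (wadj w) v u m -> ~ furcation (wadj w) m) /\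
  exists m, joined (wadj w) v m /\ furcation (wadj w) m.

Definition no_flow w (o : config G -> G -> G -> Prop) := forall v u m,
  furcation (wadj w) m -> flow (wadj w) (o w) v u -> ~ joined (wadj w) v m.

Definition comp w z : set G := [set z' | joined (wadj w) z z'].

(* The asymptotic energy is almost surely a constant, represented by the set [S]
   of its rational upper bounds. *)
Definition typical w := [/\ acyclic w, forall z, exists a : R, density (comp w z) a,
  fincomp w -> forall z a, density (comp w z) a -> 0 < a,
  forall q : rat, energy_le t w (ratr q : R) <-> S q
  & no_flow w lighter /\ no_flow w barren].

Lemma mass_le A B x i : A `<=` B -> mass A x i <= mass B x i.
Proof.
move=> AB; apply: walk_le => // z; rewrite !indicE ler_nat.
by case: (boolP (z \in A)) => // /set_mem /AB Bz; rewrite mem_set.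
Qed.

Lemma mass_ge0 A x i : 0 <= mass A x i.
Proof. by apply: walk_ge0 => // z; rewrite indicE ler0n. Qed.

Lemma indicU_disjoint A B z : (forall z, A z -> ~ B z) ->
  \1_(A `|` B) z = \1_A z + \1_B z :> R.
Proof.
move=> AB; rewrite !indicE in_setU -natrD; congr (_%:R).
case: (boolP (z \in A)) => //=; rewrite inE => /AB nB; by rewrite memNset.
Qed.

Lemma massU A B x i : (forall z, A z -> ~ B z) ->
  mass (A `|` B) x i = mass A x i + mass B x i.
Proof.
by move=> AB; rewrite /mass -evD; apply: ev_ext => z; exact: indicU_disjoint.
Qed.

Lemma density_uniq A a b : density A a -> density A b -> a = b.
Proof.
move=> dA dB; have [[x _]|nG] := pselect (exists x : G, True).
  exact: (cvg_unique _ (dA x) (dB x)).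
by case: Ginf; rewrite (_ : setT = set0) // -subset0 => x _; apply: nG; exists x.
Qed.

Lemma densityU A B a b : (forall z, A z -> ~ B z) -> density A a -> density B b ->
  density (A `|` B) (a + b).
Proof.
move=> AB dA dB x; apply: (cvg_ext (v := fun i => mass A x i + mass B x i)).
  by move=> i; exact: massU.
exact: (cvgD (dA x) (dB x)).
Qed.

Lemma densityD A B a b : B `<=` A -> density A a -> density B b -> density (A `\` B) (a - b).
Proof.
move=> BA dA dB x; apply: (cvg_ext (v := fun i => mass A x i - mass B x i)).
  move=> i; rewrite -{2}(setDUK BA) massU ?addrK //.
    by rewrite addrAC subrr add0r.
  by move=> z Bz [].
exact: (cvgB (dA x) (dB x)).
Qed.

Lemma density_sub A N : A `<=` N -> density N 0 -> density A 0.
Proof.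
move=> AN dN x; apply: (squeeze_cvgr _ (cvg_cst 0) (dN x)).
by apply: nearW => i; rewrite mass_ge0 mass_le.
Qed.

Lemma fin_density_le0 (s : seq G) a : density [set` s] a -> a <= 0.
Proof. by move=> ds; apply: (walk_finite_null Glf Ginf ds). Qed.

Lemma lighter_density w v u a b : density (side (wadj w) v u) a ->
  density (side (wadj w) u v) b -> a < b -> lighter w v u.
Proof.
move=> da db ab x; pose e := (b - a) / 3.
have e0 : 0 < e by rewrite divr_gt0 // subr_gt0.
have [j hj] : exists j : nat, (j.+1%:R)^-1 < e.
  exists (Num.bound e^-1); rewrite invf_plt ?posrE ?ltr0n //.
  apply: lt_le_trans (archi_boundP _) _; first by rewrite invr_ge0 ltW.
  by rewrite ler_nat.
have ae : a < a + e by rewrite ltrDl.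
have be : b - e < b by rewrite ltrBlDr ltrDl.
have [M _ hM] := cvgr_le _ (da x) _ ae; have [N _ hN] := cvgr_ge _ (db x) _ be.
exists j, (maxn M N) => i; rewrite geq_max => /andP[Mi Ni].
have h1 := hM i Mi; have h2 := hN i Ni; rewrite /= in h1 h2.
move: h1 h2 hj; rewrite /e.
by move: (mass _ _ _) (mass _ _ _) (j.+1%:R^-1) => p p' q; lra.
Qed.

Lemma mass_sq A x i : ev2 (walk R (t i) x) (walk R (t i) x)
  (fun z z' => \1_A z * \1_A z') = mass A x i ^+ 2.
Proof. by rewrite /ev2 (ev_ext _ (fun z => evZ _ (\1_A z) _)) evZr expr2. Qed.

Lemma energy_cvg w : fincomp w -> (forall z, exists a : R, density (comp w z) a) ->
  exists L : R, forall x, energy R t w x i @[i --> \oo] --> L.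
Proof.
move=> [s hs] dens; case: s hs => [|y s] hs.
  by exists 0 => x; have [z] := hs x.
have [rho [rhoP rhoJ]] := joined_rep (@wadj_sym _ w) y.
pose s' := undup (map rho (y :: s)).
pose a z := projT1 (cid (dens z)); have aP z := projT2 (cid (dens z)).
exists (\sum_(c <- s') a c ^+ 2) => x.
apply: (cvg_ext (v := fun i => \sum_(c <- s') mass (comp w c) x i ^+ 2)); last first.
  apply: cvg_sum_seq => c; rewrite expr2; under eq_cvg do rewrite expr2.
  by apply: cvgM; exact: aP.
move=> i; rewrite /energy.
have E z z' : K R w z z' = \sum_(c <- s') \1_(comp w c) z * \1_(comp w c) z'.
  have rz : rho z \in s'.
    rewrite mem_undup; have [u us juz] := hs z; apply/mapP; exists u => //.
    by apply: rhoJ; apply: joined_sym juz; exact: wadj_sym.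
  rewrite (bigD1_seq (rho z)) ?undup_uniq //= big_seq_cond big1 ?addr0.
    have jrz : comp w (rho z) z by apply: joined_sym (rhoP z); exact: wadj_sym.
    rewrite [X in _ = X * _]indicE mem_set // mul1r /K /conn !indicE.
    congr (_%:R); congr nat_of_bool; apply/idP/idP; rewrite !inE => j.
      exact: joined_trans jrz j.
    exact: joined_trans (rhoP z) j.
  move=> c /andP[cs' crz]; rewrite indicE memNset ?mul0r // => jcz.
  move: cs'; rewrite mem_undup => /mapP[u _ cu]; move/eqP: crz; apply.
  have := rhoJ _ _ jcz; rewrite {1}cu => <-.
  by rewrite cu; apply: rhoJ; exact: rhoP.
transitivity (\sum_(c <- s') ev2 (walk R (t i) x) (walk R (t i) x)
   (fun z z' => \1_(comp w c) z * \1_(comp w c) z')).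
  rewrite /ev2 -ev_sum; apply: ev_ext => z; rewrite -ev_sum; apply: ev_ext => z'; exact: E.
by apply: eq_bigr => c _; exact: mass_sq.
Qed.

(** Both energies converge and have the same rational bounds, so that no rational separates their
    limits. *)
Lemma energy_diff w w' (d : R) : typical w -> typical w' -> fincomp w ->
  (forall x, energy R t w' x i - energy R t w x i @[i --> \oo] --> d) -> d = 0.
Proof.
move=> [_ dens _ Sw _] [_ _ _ Sw' _] fw cd.
have [L hL] := energy_cvg fw dens.
have hL' x : energy R t w' x i @[i --> \oo] --> L + d.
  apply: (cvg_ext (v := fun i => energy R t w x i + (energy R t w' x i - energy R t w x i))).
    by move=> i; rewrite addrC subrK.
  exact: cvgD (hL x) (cd x).
have [[x _]|nG] := pselect (exists x : G, True); last first.
  by case: Ginf; rewrite (_ : setT = set0) // -subset0 => x _; apply: nG; exists x.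
have sep (v v' : config G) (l l' : R) : (forall q : rat, energy_le t v (ratr q : R) <-> S q) ->
    (forall q : rat, energy_le t v' (ratr q : R) <-> S q) ->
    (forall x, energy R t v x i @[i --> \oo] --> l) ->
    (forall x, energy R t v' x i @[i --> \oo] --> l') -> ~ l < l'.
  move=> Sv Sv' hv hv' ll'; have [q] := rat_in_itvoo ll'.
  rewrite in_itv /= => /andP[lq ql'].
  have : energy_le t v (ratr q : R).
    by move=> y; have [N _ hN] := cvgr_le _ (hv y) _ lq; exists N.
  move=> /Sv /Sv' /(_ x)[N hN].
  have : l' <= ratr q by apply: (cvgr_to_le (hv' x)); exists N.
  by rewrite leNgt ql'.
have n1 := sep w w' L (L + d) Sw Sw' hL hL'.
have n2 := sep w' w (L + d) L Sw' Sw hL' hL.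
apply/eqP; rewrite eq_le; apply/andP; split; rewrite leNgt; apply/negP => d0.
  by apply: n1; rewrite ltrDl.
by apply: n2; rewrite gtrDl.
Qed.

Lemma energy_sub w w' x i (F : G -> G -> R) :
  (forall z z', K R w' z z' - K R w z z' = F z z') ->
  energy R t w' x i - energy R t w x i = ev2 (walk R (t i) x) (walk R (t i) x) F.
Proof.
by move=> h; rewrite /energy /ev2 -evB; apply: ev_ext => z; rewrite -evB; apply: ev_ext => z'.
Qed.

Lemma wadj_star w v u : wadj w v u -> u \in star v.
Proof. by move=> /wadj_adj avu; rewrite mem_star // avu orbT. Qed.

Lemma side_infinite_branch w v u a : wadj w v u -> density (side (wadj w) v u) a -> 0 < a ->
  branch (wadj w) u v.
Proof.
move=> evu da a0.
have euv : wadj w u v by rewrite wadj_sym.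
apply: (infinite_side_branch (@wadj_irr _ w) (@wadj_star w) euv) => s.
apply: contrapT => h.
have sub z : side (wadj w) v u z -> z \in s.
  by move=> sz; apply/negPn/negP => zs; apply: h; exists z.
have := @fin_density_le0 [seq z <- s | `[< side (wadj w) v u z >]] a.
rewrite (_ : [set` _] = side (wadj w) v u); first by move=> /(_ da); rewrite leNgt a0.
apply/seteqP; split=> z /=; rewrite mem_filter; first by move=> /andP[/asboolP].
by move=> sz; rewrite asboolT // sub.
Qed.

Lemma lighter_cut w v u m a b : typical w -> wadj w v u -> furcation (wadj w) m ->
  joined (wadj w) v m -> density (side (wadj w) v u) a -> density (side (wadj w) u v) b ->
  branch (wadj w) u v -> ~ a < b.
Proof.
move=> [_ _ _ _ [nf _]] evu fm jvm da db buv ab.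
apply: (nf v u m fm _ jvm); split=> //; exact: (lighter_density da db ab).
Qed.

(** Some branch at [m] contains neither [w1] nor [w2], hence lies in [N] and has density 0. The
    other side of its first edge keeps the full density [c], which produces a forbidden flow. *)
Lemma furcation_not_null w m N (w1 w2 : G) c : typical w -> furcation (wadj w) m ->
  density (comp w m) c -> 0 < c -> density N 0 -> m != w1 -> m != w2 ->
  ~ (forall z, joined (minus (wadj w) [:: w1; w2]) m z -> N z).
Proof.
move=> tw fm dc c0 dN mw1 mw2 subN.
have [aw _ _ _ _] := tw; have es := @wadj_sym _ w; have ei := @wadj_irr _ w.
have [u [bu nu1 nu2]] := furcation_third es ei aw w1 w2 fm.
have emu := branch_adj bu; have eum : wadj w u m by rewrite es.
have um := adj_neq ei eum.
have nw z : side (wadj w) u m z -> z \notin [:: w1; w2].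
  by move=> sz; rewrite !inE; apply/negP => /orP[]/eqP zw; subst z.
have sN : side (wadj w) u m `<=` N.
  move=> z sz; apply: subN; apply: (@joined_trans _ _ _ u).
    apply: joined1; rewrite /minus /= emu (nw u) ?andbT; last exact: joined_refl.
    by rewrite !inE negb_or mw1 mw2.
  apply: joined_mono sz => a b ja mab.
  have sb : side (wadj w) u m b := joined_trans ja (joined1 mab).
  by case/and3P: mab => eab _ _; rewrite /minus /= eab !nw.
have d0 := density_sub sN dN.
have dmu : density (side (wadj w) m u) c.
  rewrite (_ : side (wadj w) m u = comp w m `\` side (wadj w) u m); last first.
    apply/seteqP; split=> z.
      move=> sz; split; first exact: side_joined sz.
      exact: (side_inter es ei aw emu).
    by case=> jz nz; have [] := side_cover ei emu jz.
  rewrite -[c]subr0; apply: densityD => // z sz.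
  apply: joined_trans (joined1 emu) (side_joined sz).
apply: (lighter_cut tw eum fm _ d0 dmu bu c0); exact: joined1.
Qed.

Lemma switch_none w w' x y c d : typical w -> typical w' -> fincomp w ->
  ~ joined (wadj w) x y -> density (comp w x) c -> density (comp w y) d ->
  ~ (forall a b, wadj w' a b <-> wadj w a b \/ [set a; b] = [set x; y]).
Proof.
move=> tw tw' fw nxy dc dd e'E.
have [_ _ pos _ _] := tw; have c0 := pos fw _ _ dc; have d0 := pos fw _ _ dd.
have es := @wadj_sym _ w.
have dis z : comp w x z -> ~ comp w y z.
  by move=> jx jy; apply: nxy; apply: joined_trans jx (joined_sym es jy).
have : 2 * (c * d) = 0.
  apply: (energy_diff tw tw' fw) => z.
  apply: (cvg_ext (v := fun i => 2 * (mass (comp w x) z i * mass (comp w y) z i))).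
    move=> i; rewrite (energy_sub _ _ (merge_joined es nxy e'E R)).
    rewrite /ev2 (ev_ext _ (fun z => evB _ _ _)) evB (ev_ext _ (fun z => evB _ _ _)) evB.
    by rewrite -!/(ev2 _ _ _) !mass_sq massU //; ring.
  apply: cvgMl_tmp; exact: cvgM (dc z) (dd z).
by move/eqP; rewrite !mulf_eq0 pnatr_eq0 (gt_eqF c0) (gt_eqF d0).
Qed.

Lemma switch_some w w' x y v u c d : typical w -> typical w' -> fincomp w ->
  ~ joined (wadj w) x y -> density (comp w x) c -> density (comp w y) d ->
  wadj w v u -> side (wadj w) v u x ->
  (forall a b, wadj w' a b <->
     (wadj w a b \/ [set a; b] = [set x; y]) /\ [set a; b] <> [set v; u]) ->
  exists a b, [/\ density (side (wadj w) v u) a, density (side (wadj w) u v) b,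
    a + b = c & a = 0 \/ b = d].
Proof.
move=> tw tw' fw nxy dc dd evu svx e'E.
have es := @wadj_sym _ w; have ei := @wadj_irr _ w.
have [aw _ _ _ _] := tw; have [_ dens' _ _ _] := tw'.
set A := side (wadj w) v u; set B := side (wadj w) u v; set D := comp w y.
have jxv : joined (wadj w) x v by apply: joined_sym => //; exact: side_joined svx.
have AB z : A z -> ~ B z by exact: side_inter.
have Cx : comp w x = A `|` B.
  apply/seteqP; split=> z.
    by move=> jz; apply: side_cover => //; apply: joined_trans jz; exact: joined_sym.
  case=> sz; first exact: joined_trans jxv (side_joined sz).
  apply: joined_trans jxv (joined_trans (joined1 evu) (side_joined sz)).
have AD z : A z -> ~ D z.
  move=> Az Dz; apply: nxy; apply: (@joined_trans _ _ _ z).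
    by have : comp w x z by rewrite Cx; left.
  exact: joined_sym.
have c1 := exchange_comp1 es ei aw nxy evu svx e'E.
have c2 := exchange_comp2 es ei aw nxy evu svx e'E.
(* Densities of the two sides come from [w'], whose components of [x] and [u] are [A] with [D] added
   and [B] respectively. *)
have [s ds] := dens' x; have [b db] := dens' u.
have Ex : comp w' x = A `|` D.
  by apply/seteqP; split=> z; move=> /(c1 x z (or_introl svx)).
have Eu : comp w' u = B.
  by apply/seteqP; split=> z; move=> /(c2 u z (joined_refl _ _)).
rewrite Ex in ds; rewrite Eu in db.
have dA : density A (s - d).
  rewrite (_ : A = (A `|` D) `\` D); first by apply: densityD => // z; right.
  apply/seteqP; split=> z; first by move=> Az; split; [left|exact: AD].
  by case=> [[]].
have sbc : s - d + b = c.
  by apply: density_uniq dc; rewrite Cx; apply: densityU.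
exists (s - d), b; split=> //.
have : 2 * ((s - d) * (d - b)) = 0.
  apply: (energy_diff tw tw' fw) => z.
  apply: (cvg_ext (v := fun i => 2 * (mass A z i * (mass D z i - mass B z i)))).
    move=> i; rewrite (energy_sub _ _ (exchange_joined es ei aw nxy evu svx e'E R)).
    rewrite /ev2 (ev_ext _ (fun z => evB _ _ _)) evB (ev_ext _ (fun z => evB _ _ _)) evB.
    rewrite (ev_ext _ (fun z => evD _ _ _)) evD.
    by rewrite -!/(ev2 _ _ _) !mass_sq !massU //; ring.
  by apply: cvgMl_tmp; apply: cvgM (dA z) _; exact: cvgB (dd z) (db z).
move/eqP; rewrite !mulf_eq0 pnatr_eq0 /= => /orP[/eqP|]; first by left.
by rewrite subr_eq0 => /eqP; right.
Qed.

Lemma wadj_switch_none w (e : edge G) x y : sval e = [set x; y] -> forall a b,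
  wadj (switch e None w) a b <-> wadj w a b \/ [set a; b] = [set x; y].
Proof.
move=> exy a b; split.
  move=> /asboolP[e' [we'|-> eab]]; last by right; rewrite -eab exy.
  by move=> eab; left; apply/asboolP; exists e'.
case=> [/asboolP[e' we' eab]|ab]; apply/asboolP; first by exists e' => //; left.
by exists e; [right|rewrite exy].
Qed.

Lemma wadj_switch_some w (e c : edge G) x y v u : sval e = [set x; y] ->
  sval c = [set v; u] -> forall a b, wadj (switch e (Some c) w) a b <->
  (wadj w a b \/ [set a; b] = [set x; y]) /\ [set a; b] <> [set v; u].
Proof.
move=> exy cvu a b; split.
  move=> /asboolP[e' [we' e'c] eab]; split.
    case: we' => [we'|ee]; first by left; apply/asboolP; exists e'.
    by right; rewrite -eab ee exy.
  by rewrite -eab -cvu => h; apply: e'c; exact: edge_inj.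
case=> ab nab; apply/asboolP; case: ab => [/asboolP[e' we' eab]|ab].
  exists e' => //; split; first by left.
  by move=> /= ec; apply: nab; rewrite -eab ec.
exists e; last by rewrite exy.
split; first by right.
by move=> /= ec; apply: nab; rewrite ab -exy ec.
Qed.

Definition switchable w x y := forall r : nat, exists (e : edge G) (f : option (edge G)),
  [/\ sval e = [set x; y], typical (switch e f w) & forall c, f = Some c ->
     [/\ w c, sval c `<=` comp w x & sval c `<=` ~` graph_ball x r]].

Lemma far_cut w x y c d r : typical w -> fincomp w -> ~ joined (wadj w) x y ->
  density (comp w x) c -> density (comp w y) d -> switchable w x y ->
  exists v u a b, [/\ wadj w v u, side (wadj w) v u x,
    ~ graph_ball x r v /\ ~ graph_ball x r u,
    density (side (wadj w) v u) a /\ density (side (wadj w) u v) b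
    & a + b = c /\ (a = 0 \/ b = d)].
Proof.
move=> tw fw nxy dc dd /(_ r)[e [[f|] [exy tw' hf]]]; last first.
  by have := switch_none tw tw' fw nxy dc dd; case; exact: wadj_switch_none.
have [wf fx fr] := hf f erefl.
have [v [u [avu fvu]]] := svalP f.
have evu : wadj w v u by apply/(wadj_edge w fvu).
have fv : sval f v by rewrite fvu; left.
have fu : sval f u by rewrite fvu; right.
have es := @wadj_sym _ w; have ei := @wadj_irr _ w.
have jvx : joined (wadj w) v x by apply: joined_sym => //; exact: fx.
have e'E := wadj_switch_some w exy fvu.
have [sx|sx] := side_cover ei evu jvx.
  have [a [b [da db abc ab]]] := switch_some tw tw' fw nxy dc dd evu sx e'E.
  by exists v, u, a, b; split=> //; split; exact: fr.
have euv : wadj w u v by rewrite es.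
rewrite (setUC [set v]) in fvu.
have [a [b [da db abc ab]]] :=
  switch_some tw tw' fw nxy dc dd euv sx (wadj_switch_some w exy fvu).
by exists u, v, a, b; split=> //; split; exact: fr.
Qed.

(** A path that stays in the ball misses both endpoints of the cut, hence remains on the side of
    [x]. *)
Lemma side_far w x p v u r : wadj w v u -> side (wadj w) v u x -> path (wadj w) x p ->
  (size p <= r)%N -> ~ graph_ball x r v -> ~ graph_ball x r u ->
  forall z, z \in x :: p -> side (wadj w) v u z /\ z != v.
Proof.
move=> evu sx pp pr nv nu z zp.
have ball a : a \in x :: p -> graph_ball x r a.
  move=> /splitPl ap; case: ap pp pr => p1 p2 <-; rewrite cat_path size_cat => /andP[p1x _] le.
  exists p1; first by apply: sub_path p1x => b c; exact: wadj_adj.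
  by split=> //; apply: leq_trans le; exact: leq_addr.
split; last by apply/eqP => zv; subst z; apply: nv; exact: ball.
have us : u \notin x :: p by apply/negP => /ball.
apply: joined_trans sx _; exact: path_side_mem pp us zp.
Qed.

Theorem not_switchable w x y m : typical w -> fincomp w -> ~ joined (wadj w) x y ->
  joined (wadj w) x m -> furcation (wadj w) m -> ~ switchable w x y.
Proof.
move=> tw fw nxy jxm fm sw.
have [aw dens pos _ [_ nfb]] := tw.
have es := @wadj_sym _ w; have ei := @wadj_irr _ w.
have [c dc] := dens x; have [d dd] := dens y.
have c0 := pos fw _ _ dc; have d0 := pos fw _ _ dd.
have compE z : joined (wadj w) x z -> density (comp w z) c.
  move=> jz; rewrite (_ : comp w z = comp w x) //; apply/seteqP; split=> z'; first exact: joined_trans.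
  by apply: joined_trans; exact: joined_sym.
have [pm ppm lpm] := jxm.
(* Beyond the path to [m], the furcation stays on the side of [x]. It excludes [a = 0] and makes
   that side infinite, so [a < d] is a forbidden flow; the far side has density [d > 0], hence is
   infinite, so [d < a] is one as well. *)
have half r : (size pm <= r)%N -> exists v u, [/\ wadj w v u, side (wadj w) v u x,
    ~ graph_ball x r v /\ ~ graph_ball x r u,
    density (side (wadj w) v u) d /\ density (side (wadj w) u v) d & c = d + d].
  move=> pr; have [v [u [a [b [evu sx [nv nu] [da db] [abc ab]]]]]] :=
    far_cut r tw fw nxy dc dd sw.
  have [sm mv] := side_far evu sx ppm pr nv nu (mem_last x pm).
  rewrite lpm in sm mv.
  have mu : m != u := side_notin (adj_neq ei evu) sm.
  have euv : wadj w u v by rewrite es.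
  have buv := furcation_side es ei aw evu sm fm.
  have jvm := side_joined sm.
  case: ab => [a0|bd].
    subst a; exfalso; apply: (furcation_not_null tw fm (compE m jxm) c0 da mu mu) => z.
    move=> jz; apply: joined_trans sm _; apply: joined_sub jz => p q.
    by rewrite /minus /= !inE !orbb.
  subst b; have [ad|da'|ad] := ltgtP a d.
  - by case: (lighter_cut tw evu fm jvm da db buv ad).
  - have bvu := side_infinite_branch euv db d0.
    case: (lighter_cut tw euv fm _ db da bvu da').
    exact: joined_trans (joined1 euv) jvm.
  by rewrite ad in da abc; exists v, u.
have [v1 [u1 [e1 s1 [nv1 nu1] [da1 db1] cdd]]] := half _ (leqnn (size pm)).
have [sm mv1] := side_far e1 s1 ppm (leqnn _) nv1 nu1 (mem_last x pm).
rewrite lpm in sm mv1.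
have mu1 : m != u1 := side_notin (adj_neq ei e1) sm.
have e1' : wadj w u1 v1 by rewrite es.
have jxv1 : joined (wadj w) x v1 by apply: joined_sym (side_joined s1).
(* A far side without furcation would be barren and infinite, and its edge would carry a forbidden
   flow. *)
have [m2 sm2 fm2] : exists2 m2, side (wadj w) u1 v1 m2 & furcation (wadj w) m2.
  apply: contrapT => h; apply: (nfb u1 v1 m fm).
    split=> //; last exact: (side_infinite_branch e1' db1 d0).
    split; first by move=> z sz fz; apply: h; exists z.
    by exists m; split=> //; apply: joined_trans (joined1 e1') (side_joined sm).
  exact: joined_trans (joined1 e1') (side_joined sm).
have jxm2 : joined (wadj w) x m2.
  exact: joined_trans jxv1 (joined_trans (joined1 e1) (side_joined sm2)).
have [p2 pp2 lp2] := jxm2.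
(* The radius covers the paths to both furcations, so that [m] and [m2] lie on the near side of the
   second cut. *)
have [v2 [u2 [e2 s2 [nv2 nu2] [da2 db2] _]]] :=
  half (maxn (size pm) (size p2)) (leq_maxl _ _).
have far2 := side_far e2 s2 pp2 (leq_maxr (size pm) (size p2)) nv2 nu2.
have [A2m2 m2v2] := far2 _ (mem_last x p2); rewrite lp2 in A2m2 m2v2.
have [A2m mv2] := side_far e2 s2 ppm (leq_maxl _ (size p2)) nv2 nu2 (mem_last x pm).
rewrite lpm in A2m mv2.
(* The path from [x] to [m2] has to cross the first cut, so both endpoints of that cut are near
   too. *)
have v1p : v1 \in x :: p2.
  apply/negPn/negP => nv; have : side (wadj w) x v1 m2.
    by rewrite -lp2; apply: path_side_mem pp2 nv (mem_last _ _).
  move=> sxm2; apply: (side_inter es ei aw e1 s1).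
  by apply: joined_trans sm2 _; apply: joined_sym sxm2; exact: minus_sym.
have u1p : u1 \in x :: p2.
  apply/negPn/negP => nu; have : side (wadj w) x u1 m2.
    by rewrite -lp2; apply: path_side_mem pp2 nu (mem_last _ _).
  move=> sxm2; apply: (side_inter es ei aw e1 _ sm2).
  exact: joined_trans s1 sxm2.
have [A2v1 _] := far2 _ v1p; have [A2u1 _] := far2 _ u1p.
have e2' : wadj w u2 v2 by rewrite es.
have sideS a b z z' : side (wadj w) a b z -> wadj w z z' -> z != b -> z' != b ->
    side (wadj w) a b z'.
  move=> sz ez zb z'b; apply: joined_trans sz (joined1 _).
  by rewrite /minus /= ez !inE zb z'b.
have stay a b a' b' n z : side (wadj w) a b n -> side (wadj w) a' b' n ->
    joined (minus (wadj w) [:: b; b']) n z -> side (wadj w) a b z /\ side (wadj w) a' b' z.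
  move=> sn sn' jz.
  apply: (joined_closed (Z := fun z => side (wadj w) a b z /\ side (wadj w) a' b' z) _ _ jz) => //.
  move=> p q [sp sp'] /and3P[epq]; rewrite !inE !negb_or => /andP[pb pb'] /andP[qb qb'].
  by split; [exact: sideS sp epq pb qb|exact: sideS sp' epq pb' qb'].
have jv1u2 : joined (wadj w) v1 u2.
  apply: joined_trans (joined_sym es jxv1) _.
  exact: joined_trans (joined_sym es (side_joined s2)) (joined1 e2).
(* A path leaving the side of [a] must enter [b], but [b] is on the near side of the second cut,
   which is disjoint from the far one. *)
have within a b : wadj w a b -> side (wadj w) a b u2 -> side (wadj w) v2 u2 b ->
    side (wadj w) u2 v2 `<=` side (wadj w) a b.
  move=> eab su2 A2b z Bz.
  suff [] : side (wadj w) a b z /\ side (wadj w) u2 v2 z by [].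
  apply: (joined_closed (Z := fun z => side (wadj w) a b z /\ side (wadj w) u2 v2 z) _ _ Bz).
    move=> p q [sp Bp] mpq; have Bq : side (wadj w) u2 v2 q := joined_trans Bp (joined1 mpq).
    split=> //; case/and3P: mpq => epq _ _.
    have [[qb _]|//] := side_step es ei aw eab sp epq.
    by case: (side_inter es ei aw e2 A2b); rewrite -qb.
  by split=> //; exact: joined_refl.
(* The second far side lies entirely within one side of the first cut. Both have density [d], so the
   difference has density 0, although it surrounds [m] or [m2] up to the cut vertices. *)
have [su2|su2] := side_cover ei e1 jv1u2.
  have BA := within _ _ e1 su2 A2u1.
  have dN : density (side (wadj w) v1 u1 `\` side (wadj w) u2 v2) 0.
    by rewrite -(subrr d); apply: densityD.
  apply: (furcation_not_null tw fm (compE m jxm) c0 dN mu1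
    (side_notin (adj_neq ei e2) A2m)) => z jz.
  have [h1 h2] := stay _ _ _ _ _ _ sm A2m jz.
  by split=> //; exact: (side_inter es ei aw e2).
have BB := within _ _ e1' su2 A2v1.
have dN : density (side (wadj w) u1 v1 `\` side (wadj w) u2 v2) 0.
  by rewrite -(subrr d); apply: densityD.
apply: (furcation_not_null tw fm2 (compE m2 jxm2) c0 dN
  (side_notin (adj_neq ei e1') sm2) (side_notin (adj_neq ei e2) A2m2)) => z jz.
have [h1 h2] := stay _ _ _ _ _ _ sm2 A2m2 jz.
by split=> //; exact: (side_inter es ei aw e2).
Qed.

End Endgame.

(** * Almost every configuration is typical *)

Section Orientations.
Variables (R : realType) (G : graph) (t : nat -> nat).
Hypotheses (Glf : locally_finite G) (Gconn : graph_connected G).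
Implicit Types (x y z v u m : G) (w : config G) (g : aut G).

Let vc := vertex_countable Glf Gconn.

Lemma mass_ind (A : set G) x i : mass R t A x i = ev (walk R (t i) x) (fun z => ind R (A z)).
Proof. by apply: ev_ext => z; rewrite indicE -/(in_mem _ _) /in_mem. Qed.

Lemma mass_side_act g w v u x i :
  mass R t (side (wadj (act g w)) (g v) (g u)) (g x) i = mass R t (side (wadj w) v u) x i.
Proof.
rewrite !mass_ind walk_aut //; apply: ev_ext => z; rewrite /= /ind.
by congr (_%:R); congr nat_of_bool; apply/asboolP/asboolP => /side_act.
Qed.

Lemma lighter_act g w v u : lighter R t (act g w) (g v) (g u) <-> lighter R t w v u.
Proof.
have [h [gK hK]] := aut_inv_ex g; split=> H x.
  by have [j [N hN]] := H (g x); exists j, N => i Ni; rewrite -(mass_side_act g) -(mass_side_act g w u) hN.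
by have [j [N hN]] := H (h x); exists j, N => i Ni; rewrite -(hK x) !mass_side_act hN.
Qed.

Lemma measurable_lighter v u : measurable [set w | lighter R t w v u].
Proof.
apply: meas_all => // x; apply: meas_ex => [|j]; first exact: nat_countable.
apply: meas_eventually => i.
rewrite (_ : [set w | _] = [set w : config G | mass R t (side (wadj w) v u) x i -
    mass R t (side (wadj w) u v) x i <= - (j.+1%:R)^-1]); last first.
  by apply/seteqP; split=> w /=; move: (mass _ _ _ _ _) (mass _ _ _ _ _) (_^-1) => *; lra.
have b a b : bnd (fun w : config G => mass R t (side (wadj w) a b) x i).
  rewrite (_ : (fun w => _) = fun w : config G => ev (walk R (t i) x)
     (fun z => ind R (side (wadj w) a b z))); last by apply/funext => w; exact: mass_ind.
  apply: (bnd_ev _ (F := fun z (w : config G) => ind R (side (wadj w) a b z))) => z.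
  by apply: bnd_ind; exact: measurable_side.
by apply: meas_le; apply: bndB.
Qed.

Lemma lighter_one_way w : one_way (wadj w) (lighter R t w).
Proof.
move=> v u _ /(_ v)[j [N hN]] /(_ v)[k [M hM]].
have := hN _ (leq_maxl N M); have := hM _ (leq_maxr N M).
have j0 : 0 < (j.+1%:R : R)^-1 by rewrite invr_gt0.
have k0 : 0 < (k.+1%:R : R)^-1 by rewrite invr_gt0.
by move: (_^-1) (_^-1) j0 k0 => *; lra.
Qed.

(** One edge back, the tail side becomes smaller and the head side larger, so the gap persists with
    the same [j] and [N]. *)
Lemma lighter_inherited w : acyclic w -> inherited (wadj w) (lighter R t w).
Proof.
move=> aw u v v' evv' lvv' euv uv' x; have [j [N hN]] := lvv' x.
have es := @wadj_sym _ w; have ei := @wadj_irr _ w.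
exists j, N => i /hN h.
apply: le_trans (le_trans h _).
  by rewrite lerD2r; apply: mass_le; exact: (side_sub es ei aw).
apply: mass_le; apply: (side_sub es ei aw); rewrite 1?es // 1?es //.
by rewrite eq_sym.
Qed.

Lemma barren_act g w v u : barren (act g w) (g v) (g u) <-> barren w v u.
Proof.
have [h [gK hK]] := aut_inv_ex g; split=> -[H [m [jm fm]]]; split.
- by move=> z sz fz; apply: (H (g z)); [exact/side_act|exact/furcation_act].
- by exists (h m); rewrite -(joined_act g) -(furcation_act g) hK.
- move=> z; rewrite -(hK z) => /side_act sz /furcation_act; exact: H.
- by exists (g m); split; [exact/joined_act|exact/furcation_act].
Qed.

Lemma measurable_barren v u : measurable [set w : config G | barren w v u].
Proof.
apply: meas_and.
  apply: meas_all => // m; apply: meas_imp; first exact: measurable_side.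
  by apply: meas_not; exact: measurable_furcation.
apply: meas_ex => // m; apply: meas_and; first exact: mjoined.
exact: measurable_furcation.
Qed.

Lemma barren_one_way w : one_way (wadj w) (barren w).
Proof.
move=> v u evu [Hvu [m [jm fm]]] [Huv _].
by have [sm|sm] := side_cover (@wadj_irr _ w) evu jm; [exact: Hvu sm fm|exact: Huv sm fm].
Qed.

Lemma barren_inherited w : acyclic w -> inherited (wadj w) (barren w).
Proof.
move=> aw u v v' evv' [H [m [jm fm]]] euv uv'; split=> [z sz|].
  by apply: H; exact: (side_sub (@wadj_sym _ w) (@wadj_irr _ w) aw) sz.
by exists m; split=> //; apply: joined_trans (joined1 euv) jm.
Qed.

End Orientations.

(** * Almost sure properties survive a switch *)

Section Transfer.
Variables (R : realType) (G : graph) (P : probability (config G) R).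
Hypotheses (Glf : locally_finite G) (Gconn : graph_connected G).
Implicit Types (x y z : G) (w : config G).

Let vc := vertex_countable Glf Gconn.

Lemma comp_of_eq w x y : comp_of w x = comp_of w y <-> joined (wadj w) x y.
Proof.
have ws := @wadj_sym _ w; split=> [E|jxy].
  have : comp_of w y y by exact: joined_refl.
  by rewrite -E.
apply/seteqP; split=> z /=; last exact: joined_trans.
by apply: joined_trans; exact: joined_sym.
Qed.

(* Otherwise the configurations whose switch is bad would be an event of positive
   probability with image in a null set. *)
Lemma wit_transfer (good : config G -> Prop) : {ae P, forall w, good w} ->
  weakly_insertion_tolerant P ->
  {ae P, forall w, forall x y (r : nat), adj x y -> ~ joined (wadj w) x y ->
    exists (e : edge G) (f : option (edge G)), [/\ sval e = [set x; y],
      good (switch e f w) & forall c, f = Some c ->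
      [/\ w c, sval c `<=` comp_of w x & sval c `<=` ~` graph_ball x r]]}.
Proof.
move=> [N [mN PN gN]] wit; apply: ae_all => // x; apply: ae_all => // y.
apply: ae_all => [|r]; first exact: nat_countable.
have [axy|naxy] := boolP (adj x y); last by apply: aeW.
have exy : is_edge [set x; y] by exists x, y.
have [f [mf pos far]] := wit (exist _ _ exy) x y erefl r.
set e : edge G := exist _ _ exy in pos far.
pose A : set (config G) := [set w | ~ joined (wadj w) x y] `&`
  (fun w => switch e (f w) w) @^-1` N.
have mA : measurable A.
  apply: measurableI; first by apply: meas_not; exact: mjoined.
  exact: measurable_switch.
have PA : P A = 0%E.
  apply/eqP; rewrite eq_le measure_ge0 andbT leNgt; apply/negP => A0.
  have /(pos A mA A0) : {ae P, forall w, A w -> comp_of w x <> comp_of w y}.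
    by apply: aeW => w [nj _] /comp_of_eq.
  rewrite ltNge => /negP; apply.
  rewrite -PN; apply: le_measure; rewrite ?inE //.
    exact: measurable_switch_image.
  by move=> _ [w [_ Nw] <-].
have nA : {ae P, forall w, ~ A w}.
  by exists A; split=> // w /= /contrapT.
apply: filterS2 nA far => w nAw farw _ nj.
exists e, (f w); split=> //.
  by apply: contrapT => ng; apply: nAw; split=> //; exact: gN.
by apply: farw => /comp_of_eq.
Qed.

End Transfer.

Section Typical.
Variables (R : realType) (G : graph) (P : probability (config G) R).
Hypotheses (Glf : locally_finite G) (Gconn : graph_connected G).
Hypotheses (Gunim : unimodular R G) (Gqt : quasitransitive G).
Hypotheses (Pforest : random_forest P) (Perg : ergodic P).

Lemma typical_ae : exists t S, {ae P, forall w, typical R t S w}.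
Proof.
have [mu muH muR] := Gunim; have [reps trep] := orbit_reps_ex Gqt.
(* The mass-transport weight of an orbit: the reciprocal of the Haar measure of the stabiliser. *)
pose wt x := (haar mu x x)^-1.
have wt0 x : 0 < wt x by rewrite invr_gt0; exact: haar_pos.
have mtp := @mass_transport R G Glf Gconn mu muH muR reps trep.
have [Pinv P01] := Perg.
have [t tgood] := good_times_ex Glf Gconn wt0 trep mtp Pinv.
have [S aS] := energy_le_ae Glf Gconn t P01.
have fl := flow_ae Glf Gconn wt0 trep mtp Pinv Pforest
  (measurable_lighter R t Glf Gconn) (lighter_act R t Glf)
  (fun w _ => @lighter_one_way R G t w) (@lighter_inherited R G t).
have fb := flow_ae Glf Gconn wt0 trep mtp Pinv Pforest
  (measurable_barren Glf Gconn) (@barren_act G)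
  (fun w _ => @barren_one_way _ w) (@barren_inherited G).
exists t, S.
have := ae_and Pforest (ae_and (freq_cvg_ae Glf Gconn tgood) (ae_and
  (freq_pos_ae Glf Gconn wt0 trep mtp Pinv t) (ae_and aS (ae_and fl fb)))).
apply: filterS => w [aw [cw [pw [Sw [lw bw]]]]]; split=> //.
Qed.

End Typical.

(** * From ends and components to the hypotheses of the combinatorial argument *)

Section Ends.
Variable G : graph.
Hypothesis Glf : locally_finite G.
Implicit Types (x y z : G) (w : config G) (r s : nat -> G).

Lemma same_end_sym w r s : same_end w r s -> same_end w s r.
Proof.
move=> rs S; have [N hN] := rs S; exists N => m n Nm Nn.
have [h1 h2 h3] := hN n m Nn Nm; split=> //.
by apply: joined_sym h3; apply: minus_sym; exact: wadj_sym.
Qed.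

Lemma same_end_trans w r s q : same_end w r s -> same_end w s q -> same_end w r q.
Proof.
move=> rs sq S; have [N hN] := rs S; have [M hM] := sq S.
exists (maxn N M) => m n; rewrite !geq_max => /andP[Nm Mm] /andP[Nn Mn].
have [h1 h2 h3] := hN m m Nm Nm; have [h4 h5 h6] := hM m n Mm Mn.
by split=> //; exact: joined_trans h3 h6.
Qed.

(** Three pairwise inequivalent rays suffice; they are picked one after another, each outside the
    ends already chosen. *)
Lemma infinite_ends_furcation w z : acyclic w -> infinite_set (ends w (comp_of w z)) ->
  exists2 m, joined (wadj w) z m & furcation (wadj w) m.
Proof.
move=> aw infE; set C := comp_of w z in infE *.
pose cls r := [set s | ray_in w C s /\ same_end w r s].
have pick (F : seq (set (nat -> G))) : exists2 r, ray_in w C r & cls r \notin F.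
  apply: contrapT => h; apply: infE; apply: sub_finite_set (finite_seq F).
  by move=> _ [r rC <-] /=; apply/negPn/negP => nF; apply: h; exists r.
have [r rC _] := pick [::]; have [s sC ns] := pick [:: cls r].
have [q qC nq] := pick [:: cls r; cls s].
have cE (a b : nat -> G) : same_end w a b -> cls a = cls b.
  move=> ab; apply/seteqP; split=> c [cC h]; split=> //.
    exact: same_end_trans (same_end_sym ab) h.
  exact: same_end_trans ab h.
move: ns nq; rewrite !inE negb_or => /eqP ns /andP[/eqP nqr /eqP nqs].
have ws := @wadj_sym _ w.
have jr a n : ray_in w C a -> joined (wadj w) z (a n) by case=> _ /(_ n).
have jj a : ray_in w C a -> joined (wadj w) (r 0%N) (a 0%N).
  by move=> aC; apply: joined_trans (joined_sym ws (jr _ 0%N rC)) (jr _ 0%N aC).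
have [|||m jm fm] := furcation_rays (nb := @star G) ws (@wadj_irr _ w) aw
   (@wadj_star _ Glf w) rC.1 sC.1 qC.1 (jj _ sC) (jj _ qC).
- by move=> /cE E; apply: ns.
- by move=> /cE E; apply: nqr.
- by move=> /cE E; apply: nqs.
by exists m => //; apply: joined_trans (jr _ 0%N rC) jm.
Qed.

Lemma finite_components_fincomp w : finite_set (components w) -> fincomp w.
Proof.
move=> /finite_seqP[F FE].
have [[z0 _]|nG] := pselect (exists z : G, True); last first.
  by exists [::] => y; case: nG; exists y.
exists [seq xget z0 [set z | comp_of w z = C] | C <- F] => y.
have yF : comp_of w y \in F by have : components w (comp_of w y) by [exists y]; rewrite FE.
exists (xget z0 [set z | comp_of w z = comp_of w y]).
  by apply/mapP; exists (comp_of w y).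
by apply/comp_of_eq; exact: (@xgetPex _ z0 [set z | comp_of w z = comp_of w y]) (ex_intro _ y erefl).
Qed.

Lemma boundary_edge (Gconn : graph_connected G) w x y : ~ joined (wadj w) x y ->
  exists a b : G, [/\ adj a b, joined (wadj w) x a & ~ joined (wadj w) x b].
Proof.
move=> nxy; apply: contrapT => h; apply: nxy.
apply: (joined_closed (Z := fun z => joined (wadj w) x z) _ (joined_refl _ _) (Gconn x y)).
by move=> a b ja ab; apply: contrapT => nb; apply: h; exists a, b.
Qed.

End Ends.

Theorem theorem3p3 (R : realType) (G : graph) (P : probability (config G) R)
  (Ginf : infinite_set [set: G])
  (Gconn : graph_connected G)
  (Glf : locally_finite G)
  (Gunim : unimodular R G)
  (Gqt : quasitransitive G)
  (Pforest : random_forest P)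
  (Perg : ergodic P)
  (Pwit : weakly_insertion_tolerant P)
  (Pends : {ae P, forall w,
     exists2 C, components w C & infinite_set (ends w C)}) :
  {ae P, forall w,
     (exists C, components w = [set C]) \/ infinite_set (components w)}.
Proof.
have [t [S typ]] := typical_ae Glf Gconn Gunim Gqt Pforest Perg.
apply: filterS3 typ (wit_transfer Glf Gconn typ Pwit) Pends.
move=> w tw sw [_ [z _ <-] infE];
apply: contrapT => /not_orP[not1 /contrapT fin].
have [aw _ _ _ _] := tw; have fw := finite_components_fincomp fin.
have [m jzm fm] := infinite_ends_furcation Glf aw infE.
have [y nzy] : exists y, ~ joined (wadj w) z y.
  apply: contrapT => h; apply: not1; exists (comp_of w z).
  apply/seteqP; split=> [_ [y _ <-]|_ ->]; last by exists z.
  apply/comp_of_eq; apply: joined_sym (contrapT _); first exact: wadj_sym.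
  by move=> nj; apply: h; exists y.
(* An edge of [G] leaving the component with infinitely many ends; its inner endpoint [a] plays the
   role of [x], so that the removed edge lies in the component of the furcation. *)
have [a [b [ab ja nb]]] := boundary_edge Gconn nzy.
have nab : ~ joined (wadj w) a b by move=> jab; apply: nb; exact: joined_trans ja jab.
have jam : joined (wadj w) a m.
  by apply: joined_trans jzm; apply: joined_sym ja; exact: wadj_sym.
apply: (not_switchable Glf Ginf tw fw nab jam fm) => r.
exact: (sw a b r ab nab).
Qed.
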